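(* Let $c>0$ be given. There exist constants $\alpha_0, C_0, L_0>0$ and a constant $C>0$ (all depending only on $c$) such that for all $0<\alpha<\alpha_0$ and all $L>L_0$ the following holds. Assume that $u_0\in H^1(\mathbb{R}^+)$ satisfies $u_0(0)=0$ and $$\|u_0-Q_c(\cdot-L)\|_{H^1(\mathbb{R}^+)}<\alpha .$$ Let $u=u(x,t)$ be the global solution of the initial boundary value problem $$\partial_t u+\partial_x(\partial_x^2u+u^2)=0 \ \ (x>0,\ t>0),\qquad u(x,0)=u_0(x)\ \ (x>0),\qquad u(0,t)=0\ \ (t>0).$$ Then there is a $C^1$ function $\rho:[0,\infty)\to\mathbb{R}$ such that $$\sup_{t\ge 0}\|u(t)-Q_c(\cdot-\rho(t)-L)\|_{H^1(\mathbb{R}^+)}<C_0\big(\alpha+e^{-\sqrt{c}\,L}\big)$$ and $$\sup_{t\ge 0}|\rho'(t)-c|<C\,C_0\,\alpha .$$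
   Context: $\mathbb{R}^+=(0,+\infty)$. For $c>0$ the KdV soliton profile on the line is $\widetilde Q_c(s)=\frac{3c}{2}\,\mathrm{sech}^2\!\big(\frac{\sqrt c\, s}{2}\big)$, $s\in\mathbb{R}$. For $y\in\mathbb{R}$, $Q_c(\cdot-y)$ denotes the restriction to $\mathbb{R}^+$ of the function $x\mapsto\widetilde Q_c(x-y)$. $H^s(\mathbb{R}^+)$ is the space of restrictions to $\mathbb{R}^+$ of functions in $H^s(\mathbb{R})$, with the infimum-over-extensions norm. Notion of solution (known well-posedness theory): for $u_0\in H^1(\mathbb{R}^+)$ with $u_0(0)=0$ and zero boundary datum, for every $T>0$ there is a solution $u$ of the problem on $\mathbb{R}^+\times(0,T)$ in the space $Z^1_T(\mathbb{R}^+)$, that is, $u\in C([0,T];H^1(\mathbb{R}^+))$ and $\partial_x^l u\in C(\mathbb{R}^+;H^{(2-l)/3}(0,T))$ for $l=0,1,2$. It is unique (in $C([0,T];H^1(\mathbb{R}^+))$, as a mild solution) and depends Lipschitz-continuously on $u_0$ on balls, so it is also a limit in $Z^1_T$ of smoother solutions with zero boundary datum. ''The global solution'' is this one. *)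

(* Defs.v *)
From HB Require Import structures.
From mathcomp Require Import all_boot all_order all_algebra.
From mathcomp Require Import all_classical all_reals all_analysis.

Set Implicit Arguments.
Unset Strict Implicit.
Unset Printing Implicit Defensive.

Import Order.TTheory GRing.Theory Num.Theory.
Import numFieldNormedType.Exports.

Local Open Scope classical_set_scope.
Local Open Scope ring_scope.

Section Sobolev.
Context {R : realType}.
Local Notation mu := (@lebesgue_measure R).

Definition Rplus : set R := [set x | 0 < x].

Definition test_fun (Omega : set R) (phi : R -> R) : Prop :=
  (forall n x, derivable (derive1n n phi) x 1) /\
  exists K : set R,
    [/\ compact K, K `<=` Omega & forall x, ~ K x -> phi x = 0].

Definition L2 (f : R -> R) : Prop :=
  measurable_fun [set: R] f /\ (\int[mu]_x ((f x) ^+ 2)%:E < +oo)%E.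

Definition weak_deriv (f g : R -> R) : Prop :=
  forall phi, test_fun setT phi ->
    \int[mu]_x (f x * derive1 phi x) = - \int[mu]_x (g x * phi x).

Definition weak_deriv_chain (k : nat) (f : R -> R) (d : nat -> R -> R) : Prop :=
  [/\ d 0%N = f, (forall j, (j <= k)%N -> L2 (d j)) &
      forall j, (j < k)%N -> weak_deriv (d j) (d j.+1)].

(* The norm of H^k(R).  Weak derivatives are unique up to null sets, so the
   infimum ranges over at most one value; it is +oo iff f is not in H^k(R). *)
Definition Hk_norm (k : nat) (f : R -> R) : \bar R :=
  ereal_inf [set sqrte (\sum_(j < k.+1) \int[mu]_x ((d j x) ^+ 2)%:E)%E
            | d in weak_deriv_chain k f].

(* The Sobolev-Slobodeckij norm of H^s(R), for 0 <= s < 1 and f measurable. *)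
Definition Hs_norm (s : R) (f : R -> R) : \bar R :=
  sqrte (\int[mu]_x ((f x) ^+ 2)%:E +
         (if s == 0%R then 0 else
          \int[mu]_x \int[mu]_y
            ((f x - f y) ^+ 2 / `|x - y| `^ (1 + 2 * s))%:E))%E.

(* The norm on restrictions to Omega: infimum over all extensions; +oo if f
   has no extension of finite norm. *)
Definition restr_norm (Omega : set R) (N : (R -> R) -> \bar R) (f : R -> R)
    : \bar R :=
  ereal_inf [set N g | g in
    [set g : R -> R | measurable_fun [set: R] g /\ ae_eq mu Omega g f]].

Definition Hk_plus_norm (k : nat) : (R -> R) -> \bar R :=
  restr_norm Rplus (Hk_norm k).

Definition Hs_time_norm (T s : R) : (R -> R) -> \bar R :=
  restr_norm `]0, T[ (Hs_norm s).

(* Elements of H^1(R^+) are represented by their continuous representative on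
   [0, +oo), so that boundary values are pointwise values.  Values at negative
   points are irrelevant. *)
Definition H1_plus (f : R -> R) : Prop :=
  (Hk_plus_norm 1 f < +oo)%E /\ {within `[0, +oo[, continuous f}.

(* u belongs to C(I; X), X being the space where N is finite. *)
Definition cont_into (I : set R) (N : (R -> R) -> \bar R) (u : R -> R -> R)
    : Prop :=
  forall t0, I t0 -> (N (u t0) < +oo)%E /\
    N (u t \- u t0) @[t --> within I (nbhs t0)] --> 0%E.

End Sobolev.

Section KdV.
Context {R : realType}.
Local Notation mu := (@lebesgue_measure R).

Definition sech (s : R) : R := 2 / (expR s + expR (- s)).

Definition Q (c s : R) : R :=
  3 * c / 2 * (sech (Num.sqrt c * s / 2)) ^+ 2.

(* Space-time functions are written u t x.  Here d l x t is the l-th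
   x-derivative of w at (x, t), l <= 2: d l.+1 is the derivative of the map
   x |-> d l x from (0, +oo) to L^2(0, T).  For continuous L^2(0, T)-valued
   maps this is the same as the distributional x-derivative. *)
Definition x_derivs (T : R) (w : R -> R -> R) (d : nat -> R -> R -> R) : Prop :=
  (forall x t, 0 < x -> 0 < t < T -> d 0%N x t = w t x) /\
  forall l, (l < 2)%N -> forall x, 0 < x ->
    Hs_time_norm T 0
      (fun t => h^-1 * (d l (x + h) t - d l x t) - d l.+1 x t)
    @[h --> 0^'] --> 0%E.

Definition in_Z1 (T : R) (u : R -> R -> R) : Prop :=
  [/\ cont_into `[0, T] (Hk_plus_norm 1) u,
      (forall t, 0 <= t <= T -> H1_plus (u t)) &
      exists2 d, x_derivs T u d &
        forall l, (l < 3)%N ->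
          cont_into Rplus (Hs_time_norm T ((2 - l%:R) / 3)) (d l)].

Definition Z1_norm (T : R) (w : R -> R -> R) : \bar R :=
  ereal_inf [set (ereal_sup [set Hk_plus_norm 1 (w t) | t in `[0%R, T]] +
    \sum_(l < 3)
      ereal_sup [set Hs_time_norm T ((2 - l%:R) / 3) (d l x) | x in Rplus])%E
    | d in x_derivs T w].

(* u_t + (u_xx + u^2)_x = 0 in the sense of distributions on (0, +oo), for
   each 0 < t < T. *)
Definition kdv_eq (T : R) (u : R -> R -> R) : Prop :=
  forall phi, test_fun Rplus phi -> forall t, 0 < t < T ->
    is_derive t 1 (fun s => \int[mu]_(x in Rplus) (u s x * phi x))
      (\int[mu]_(x in Rplus)
         (u t x * derive1n 3 phi x + (u t x) ^+ 2 * derive1 phi x)).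

Definition kdv_solution (T : R) (u0 : R -> R) (u : R -> R -> R) : Prop :=
  [/\ in_Z1 T u,
      kdv_eq T u,
      (forall x, 0 < x -> u 0 x = u0 x) &
      forall t, 0 < t < T -> u t 0 = 0].

Definition smoother_kdv_solution (T : R) (v : R -> R -> R) : Prop :=
  kdv_solution T (v 0) v /\ cont_into `[0, T] (Hk_plus_norm 3) v.

(* The solution given by the well-posedness theory in H^1: on every [0, T] it
   is a Z^1_T solution and a limit in Z^1_T of smoother solutions with zero
   boundary datum. *)
Definition global_kdv_solution (u0 : R -> R) (u : R -> R -> R) : Prop :=
  forall T, 0 < T ->
    kdv_solution T u0 u /\
    exists v : nat -> R -> R -> R,
      (forall n, smoother_kdv_solution T (v n)) /\
      Z1_norm T (fun t => v n t \- u t) @[n --> \oo] --> 0%E.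

(* rho is C^1 on [0, +oo) with derivative rho'; at t = 0 the derivative is
   one-sided. *)
Definition C1_halfline (rho rho' : R -> R) : Prop :=
  (forall t, 0 <= t ->
     (rho s - rho t) / (s - t) @[s --> within `[0, +oo[ t^'] --> rho' t) /\
  {within `[0, +oo[, continuous rho'}.

End KdV.

(* Main.v *)
Require Import Defs.
From HB Require Import structures.
From mathcomp Require Import all_boot all_order all_algebra.
From mathcomp Require Import all_classical all_reals all_analysis.
From mathcomp Require Import measurable_realfun ring lra.

Set Implicit Arguments.
Unset Strict Implicit.
Unset Printing Implicit Defensive.

Import Order.TTheory GRing.Theory Num.Theory.
Import numFieldNormedType.Exports.

Local Open Scope classical_set_scope.
Local Open Scope ring_scope.

(** Extended by zero to the left of the boundary, u(t) lies in H^1(R). Its mass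
    and its energy do not increase in time: for the smoother approximating
    solutions the boundary fluxes have a sign because u(0, t) = 0, and testing the
    increments of u against u and u_xx + u^2 needs no time derivative beyond the
    weak equation.

    Let w be the difference between a translate of u(t) and the soliton Q. Then
    energy + (c / 2) mass, at Q + w minus at Q, is half the linearized quadratic
    form of w up to a cubic term. That form is coercive on functions orthogonal to
    Q and to a bump phi pairing nontrivially with Q': on each half-line one subtracts
    a multiple of Q' and combines a Poincare inequality near the center with a
    Riccati inequality away from it. The pairing of w with Q is bounded above by
    the decay of the mass and below by the decay of the energy, hence it is
    O(alpha + |w|^2), and a continuity argument in time gives the orbital bound.

    The position Y(t) is chosen so that w is orthogonal to phi. Pairing the weak
    equation with the translates of phi turns this condition into a relation
    between increments of Y and of t, whence Y is C^1, with a derivative that is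
    a quotient of two pairings equal to c when w = 0. *)

(** * Square-integrable functions and their primitives *)

Section SquareIntegrable.
Context {R : realType}.
Local Notation mu := (@lebesgue_measure R).
Local Notation itg D f := (mu.-integrable D (EFin \o f)).
Implicit Types (f g h : R -> R) (D : set R) (a b : R).

(** The solution is only a continuous curve in H^1, and the weak equation may be tested only against
    functions compactly supported in the open half-line. This shapes the modulation: the direction
    that fixes the position is a bump supported in [1, 3] instead of Q', because its translates by a
    positive distance remain test functions. The position Y(t) stays positive because u(t), extended
    by zero, vanishes to the left of the boundary, whereas the soliton has height 3c/2 at its
    center. The support on one side also lets the bump determine the right-hand multiple of Q'
    alone; the pairing with Q then determines the left-hand one.

    The position is picked separately at each time, with no continuity at first. Two positions from
    which one function looks close to Q must be close to each other, and its regularity starts from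
    there.

    The extension of the datum by zero differs from the soliton on the negative half-line as well.
    Since u_0(0) = 0, the trace of u_0 - Q_c(. - L) is -Q_c(-L); hence Q_c(-L), and with it the
    whole tail, is O(alpha).

    In the code c = 4 k^2 and Q = 6 k^2 sech^2(k x); the speed of the reference soliton is never
    changed. *)

Definition ip D f g : R := \int[mu]_(x in D) (f x * g x).

Lemma itgS D f : measurable D -> itg setT f -> itg D f.
Proof. by move=> mD; apply: integrableS. Qed.

Lemma itgD D f g : measurable D -> itg D f -> itg D g -> itg D (f + g).
Proof. by move=> mD fi gi; exact: (@integrableD _ _ _ mu _ mD (EFin \o f) (EFin \o g)). Qed.

Lemma itgZ D (k : R) f : measurable D -> itg D f -> itg D (k *: f).
Proof. by move=> mD fi; exact: (@integrableZl _ _ _ mu _ mD k (EFin \o f)). Qed.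

Lemma itgN D f : measurable D -> itg D f -> itg D (- f).
Proof. by move=> mD fi; exact: (@integrableN _ _ _ mu _ (EFin \o f)). Qed.

Lemma itgB D f g : measurable D -> itg D f -> itg D g -> itg D (f - g).
Proof. by move=> mD fi gi; exact: (@integrableB _ _ _ mu _ mD (EFin \o f) (EFin \o g)). Qed.

Lemma itg_meas D f : itg D f -> measurable_fun D f.
Proof. by move=> /integrableP[/measurable_EFinP]. Qed.

Lemma itg_le D f g : measurable D -> measurable_fun D f ->
  (forall x, D x -> `|f x| <= g x) -> itg D g -> itg D f.
Proof.
move=> mD mf fg; apply: le_integrable => //; first exact/measurable_EFinP.
by move=> x Dx /=; rewrite lee_fin (le_trans (fg x Dx))// ler_norm.
Qed.

Lemma L2_meas f : L2 f -> measurable_fun setT f.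
Proof. by case. Qed.

Lemma L2_sqr f : L2 f -> itg setT (f * f).
Proof.
move=> [mf foo]; apply/integrableP; split.
  by apply/measurable_EFinP; apply: measurable_funM.
move: foo; congr (_ < _)%E; apply: eq_integral => x _ /=.
by rewrite ger0_norm ?sqr_ge0// -expr2.
Qed.

Lemma L2_of_sqr f : measurable_fun setT f -> itg setT (f * f) -> L2 f.
Proof.
move=> mf /integrableP[_ foo]; split=> //.
move: foo; congr (_ < _)%E; apply: eq_integral => x _ /=.
by rewrite ger0_norm ?sqr_ge0// -expr2.
Qed.

Lemma L2_itgM f g : L2 f -> L2 g -> itg setT (f * g).
Proof.
move=> f2 g2; apply: (@itg_le _ _ (f * f + g * g)) => //.
- by apply: measurable_funM; exact: L2_meas.
- move=> x _; rewrite normrM /= !fctE.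
  have := sqr_ge0 (`|f x| - `|g x|).
  have := real_normK (num_real (f x)); have := real_normK (num_real (g x)).
  by rewrite /= !expr2; have := normr_ge0 (f x); have := normr_ge0 (g x); nra.
- by apply: itgD => //; exact: L2_sqr.
Qed.

Lemma L2_itg D f g : measurable D -> L2 f -> L2 g -> itg D (f * g).
Proof. by move=> mD f2 g2; apply: itgS => //; exact: L2_itgM. Qed.

Lemma L2_bd f g (K : R) : measurable_fun setT f -> (forall x, `|f x| <= K * `|g x|) ->
  L2 g -> L2 f.
Proof.
move=> mf fg g2; apply: L2_of_sqr => //.
apply: (@itg_le _ _ ((K ^+ 2) *: (g * g))) => //.
- exact: measurable_funM.
- move=> x _; rewrite normrM; change (`|f x| * `|f x| <= K ^+ 2 * (g x * g x)).
  have := fg x; have := real_normK (num_real (g x)).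
  by rewrite /= !expr2; have := normr_ge0 (f x); have := normr_ge0 (g x); nra.
- by apply: itgZ => //; exact: L2_sqr.
Qed.

Lemma L2D f g : L2 f -> L2 g -> L2 (f + g).
Proof.
move=> f2 g2; have mfg : measurable_fun setT (f + g).
  by apply: measurable_funD; exact: L2_meas.
apply: L2_of_sqr => //.
apply: (@itg_le _ _ (2 *: (f * f) + 2 *: (g * g))) => //.
- exact: measurable_funM.
- move=> x _; rewrite /= !fctE ger0_norm ?sqr_ge0 -?expr2//.
  rewrite /GRing.scale /= !expr2; have := sqr_ge0 (f x - g x); rewrite expr2; nra.
- by apply: itgD => //; apply: itgZ => //; exact: L2_sqr.
Qed.

Lemma L2Z (k : R) f : L2 f -> L2 (k *: f).
Proof.
move=> f2; apply: (@L2_bd _ f `|k|) => //.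
  by apply: measurable_funM => //; exact: L2_meas.
by move=> x; rewrite -normrM.
Qed.

Lemma L2N f : L2 f -> L2 (- f).
Proof. by move=> f2; rewrite -scaleN1r; exact: L2Z. Qed.

Lemma L2B f g : L2 f -> L2 g -> L2 (f - g).
Proof. by move=> f2 g2; apply: L2D => //; exact: L2N. Qed.

Lemma L2_0 : @L2 R 0.
Proof.
split; first exact: measurable_cst.
rewrite integral0_eq// => x _; by rewrite /= expr2 mul0r.
Qed.

Lemma L2_bdM f g (K : R) : measurable_fun setT f -> (forall x, `|f x| <= K) ->
  L2 g -> L2 (f * g).
Proof.
move=> mf fK g2; apply: (@L2_bd _ g K) => //.
  by apply: measurable_funM => //; exact: L2_meas.
by move=> x; rewrite normrM ler_wpM2r.
Qed.

Lemma L2_restr D f : measurable D -> L2 f -> L2 (\1_D * f).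
Proof.
move=> mD f2; apply: (@L2_bdM _ _ 1) => //.
by move=> x; rewrite indicE; case: (_ \in _); rewrite ?normr1 ?normr0.
Qed.

Lemma ipC D f g : ip D f g = ip D g f.
Proof. by apply: eq_Rintegral => x _; rewrite mulrC. Qed.

Lemma ipDl D f g h : measurable D -> L2 f -> L2 g -> L2 h ->
  ip D (f + g) h = ip D f h + ip D g h.
Proof.
move=> mD f2 g2 h2; rewrite /ip -RintegralD//; try exact: L2_itg.
by apply: eq_Rintegral => x _; rewrite fctE mulrDl.
Qed.

Lemma ipZl D (k : R) f h : measurable D -> L2 f -> L2 h ->
  ip D (k *: f) h = k * ip D f h.
Proof.
move=> mD f2 h2; rewrite /ip -RintegralZl//; try exact: L2_itg.
by apply: eq_Rintegral => x _; rewrite -mulrA.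
Qed.

Lemma ipNl D f h : measurable D -> L2 f -> L2 h -> ip D (- f) h = - ip D f h.
Proof. by move=> *; rewrite -scaleN1r ipZl// mulN1r. Qed.

Lemma ipBl D f g h : measurable D -> L2 f -> L2 g -> L2 h ->
  ip D (f - g) h = ip D f h - ip D g h.
Proof. by move=> *; rewrite ipDl ?ipNl//; exact: L2N. Qed.

Lemma ipDr D f g h : measurable D -> L2 f -> L2 g -> L2 h ->
  ip D h (f + g) = ip D h f + ip D h g.
Proof. by move=> *; rewrite ipC ipDl// ipC [ip D g h]ipC. Qed.

Lemma ipZr D (k : R) f h : measurable D -> L2 f -> L2 h ->
  ip D h (k *: f) = k * ip D h f.
Proof. by move=> *; rewrite ipC ipZl// ipC. Qed.

Lemma ipNr D f h : measurable D -> L2 f -> L2 h -> ip D h (- f) = - ip D h f.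
Proof. by move=> *; rewrite ipC ipNl// ipC. Qed.

Lemma ipBr D f g h : measurable D -> L2 f -> L2 g -> L2 h ->
  ip D h (f - g) = ip D h f - ip D h g.
Proof. by move=> *; rewrite ipC ipBl// ipC [ip D g h]ipC. Qed.

Lemma ip_ge0 D f : 0 <= ip D f f.
Proof. by apply: Rintegral_ge0 => x _; rewrite -expr2 sqr_ge0. Qed.

Lemma eq_ip_mul D f f' g g' : (forall x, D x -> f x * g x = f' x * g' x) ->
  ip D f g = ip D f' g'.
Proof. by move=> fg; apply: eq_Rintegral => x /set_mem xD; rewrite fg. Qed.

Lemma ip_le D f g f' g' : measurable D -> L2 f -> L2 g -> L2 f' -> L2 g' ->
  (forall x, D x -> f x * g x <= f' x * g' x) -> ip D f g <= ip D f' g'.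
Proof. by move=> mD *; apply: le_Rintegral => //; exact: (L2_itg mD). Qed.

Lemma ip_restr D f g : measurable D -> ip setT (\1_D * f) g = ip D f g.
Proof.
move=> mD; rewrite /ip [RHS]Rintegral_mkcond; apply: eq_Rintegral => x _.
rewrite patchE fctE indicE; case: ifP => _; by rewrite ?mul1r// !mul0r.
Qed.

Lemma ip_sub D D' f : measurable D -> measurable D' -> D `<=` D' -> L2 f ->
  ip D f f <= ip D' f f.
Proof.
move=> mD mD' DD f2; rewrite -[ip D _ _]ip_restr// -[ip D' _ _]ip_restr//.
apply: ip_le => //; try exact: L2_restr.
move=> x _; rewrite !fctE !indicE -!mulrA ler_wpM2r -?expr2 ?sqr_ge0// ler_nat.
by case: (boolP (x \in D)) => // /set_mem/DD/mem_set ->.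
Qed.

Lemma ip_leT D f : measurable D -> L2 f -> ip D f f <= ip setT f f.
Proof. by move=> *; apply: ip_sub. Qed.

Lemma ip_young D f g (k : R) : measurable D -> L2 f -> L2 g -> 0 < k ->
  2 * `|ip D f g| <= k * ip D f f + k^-1 * ip D g g.
Proof.
move=> mD f2 g2 k0.
(* Expansion of the squared norm of [k f + e g], divided by [k]; [e = 1] and [e = -1] give the two
   signs. *)
have H e : 0 <= k * ip D f f + (2 * e) * ip D f g + k^-1 * (e ^+ 2 * ip D g g).
  have := ip_ge0 D (k *: f + e *: g).
  have k2 := L2Z k f2; have e2 := L2Z e g2.
  rewrite ipDl// ?ipDr//; last exact: L2D.
  rewrite !ipZl// !ipZr// [ip D g f]ipC => h.
  have : 0 <= k^-1 * (k * (k * ip D f f) + k * (e * ip D f g) +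
    (e * (k * ip D f g) + e * (e * ip D g g))) by rewrite mulr_ge0// invr_ge0 ltW.
  by congr (_ <= _); field; rewrite gt_eqF.
have H1 := H 1; have HN := H (-1).
rewrite sqrrN expr1n mul1r in H1 HN.
by case: (lerP 0 (ip D f g)) => h; [rewrite ger0_norm|rewrite ltr0_norm]; lra.
Qed.

(** Multiplied by [k], Young's inequality is quadratic in [k] with vertex at [|C| / A]. When
    [A = 0], the choice [k = (B + 1) / |C|] contradicts it unless [C = 0]. *)
Lemma ip_CS D f g : measurable D -> L2 f -> L2 g ->
  ip D f g ^+ 2 <= ip D f f * ip D g g.
Proof.
move=> mD f2 g2; set A := ip D f f; set B := ip D g g; set C := ip D f g.
have A0 : 0 <= A := ip_ge0 D f; have B0 : 0 <= B := ip_ge0 D g.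
have H k : 0 < k -> 2 * `|C| <= k * A + k^-1 * B by exact: ip_young.
rewrite -real_normK ?num_real//; have := normr_ge0 C; move: (`|C|) H => c H c0.
have H' k : 0 < k -> 2 * c * k <= k * k * A + B.
  move=> k0; have := H k k0; rewrite -(ler_pM2l k0) => h.
  have e : k * (k * A + k^-1 * B) = k * k * A + B by field; rewrite gt_eqF.
  by rewrite e in h; lra.
have [A00|A1] := ltP 0 A.
  have [c00|c1] := ltP 0 c; last by rewrite (_ : c = 0); [rewrite expr0n/= mulr_ge0|lra].
  have := H' (c / A) (divr_gt0 c00 A00).
  have -> : c / A * (c / A) * A = c * c / A by field; rewrite gt_eqF.
  rewrite -(ler_pM2r A00) [(_ + B) * A]mulrDl => h.
  have e1 : 2 * c * (c / A) * A = 2 * c ^+ 2 by field; rewrite gt_eqF.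
  have e2 : c * c / A * A = c ^+ 2 by field; rewrite gt_eqF.
  by rewrite e1 e2 in h; rewrite [A * B]mulrC; lra.
have AE : A = 0 by lra.
rewrite AE mul0r; have [c00|c1] := ltP 0 c; last first.
  by rewrite (_ : c = 0) ?expr0n//; lra.
have := H' ((B + 1) / c) (divr_gt0 (ltr_wpDl B0 ltr01) c00).
rewrite AE mulr0 add0r.
have -> : 2 * c * ((B + 1) / c) = 2 * (B + 1) by field; rewrite gt_eqF.
lra.
Qed.

Lemma ip_CS_bd D f g (A B : R) : measurable D -> L2 f -> L2 g -> 0 <= A -> 0 <= B ->
  ip D f f <= A ^+ 2 -> ip D g g <= B ^+ 2 -> `|ip D f g| <= A * B.
Proof.
move=> mD f2 g2 A0 B0 fA gB.
rewrite -(@ler_pXn2r _ 2)// ?nnegrE ?mulr_ge0// real_normK ?num_real// exprMn.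
by rewrite (le_trans (ip_CS mD f2 g2))// ler_pM// ip_ge0.
Qed.

Lemma ip_sqrD D f g : measurable D -> L2 f -> L2 g ->
  ip D (f + g) (f + g) = ip D f f + 2 * ip D f g + ip D g g.
Proof.
move=> mD f2 g2; have fg := L2D f2 g2.
by rewrite ipDl// !ipDr// [ip D g f]ipC; ring.
Qed.

Lemma ip_sqrB D f g : measurable D -> L2 f -> L2 g ->
  ip D (f - g) (f - g) = ip D f f - 2 * ip D f g + ip D g g.
Proof.
move=> mD f2 g2; have fg := L2B f2 g2.
by rewrite ipBl// !ipBr// [ip D g f]ipC; ring.
Qed.

Lemma ip_triangle D f g (A B : R) : measurable D -> L2 f -> L2 g -> 0 <= A -> 0 <= B ->
  ip D f f <= A ^+ 2 -> ip D g g <= B ^+ 2 -> ip D (f + g) (f + g) <= (A + B) ^+ 2.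
Proof.
move=> mD f2 g2 A0 B0 fA gB; rewrite ip_sqrD//.
have := ip_CS_bd mD f2 g2 A0 B0 fA gB; have := ler_norm (ip D f g).
by rewrite sqrrD -mulr_natl; lra.
Qed.

End SquareIntegrable.

(** * Induction along the real line *)

Section RealInduction.
Context {R : realType}.

(** If [P] failed at some [b], the supremum of the [x] with [P] on all of [[a, x]] would satisfy [P]
    and could still be exceeded. Every continuation argument rests on this: the product rule,
    approximation by step functions, Dini derivatives in time and the orbital bound. *)
Lemma real_induction (a : R) (P : R -> Prop) : P a ->
  (forall x, a <= x -> (forall y, a <= y <= x -> P y) ->
     exists2 d, 0 < d & forall y, x < y < x + d -> P y) ->
  (forall x, a < x -> (forall y, a <= y < x -> P y) -> P x) ->
  forall x, a <= x -> P x.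
Proof.
move=> Pa Pstep Pcl b ab; apply: contrapT => nPb.
pose S : set R := [set x | a <= x /\ forall y, a <= y <= x -> P y].
have Sa : S a.
  by split=> // y /andP[ay ya]; rewrite (_ : y = a)//; apply/eqP; rewrite eq_le ya ay.
have Sb : ubound S b.
  move=> x [ax Px]; rewrite leNgt; apply/negP => bx.
  by apply: nPb; apply: Px; rewrite ab ltW.
have hS : has_sup S by split; [exists a|exists b].
set s := sup S; have as_ : a <= s by apply: ub_le_sup => //; exists b.
have Plt y : a <= y < s -> P y.
  move=> /andP[ay ys]; have [|x [ax Px]] := @sup_adherent _ S (s - y) _ hS.
    by rewrite subr_gt0.
  by rewrite -/s subKr => yx; apply: Px; rewrite ay ltW.
have Ps : P s.
  move: as_; rewrite le_eqVlt => /orP[/eqP <-//|as_]; exact: Pcl.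
have Ple y : a <= y <= s -> P y.
  rewrite [y <= s]le_eqVlt => /andP[ay /orP[/eqP ->//|ys]].
  by apply: Plt; rewrite ay.
have [d d0 Pd] := Pstep s as_ Ple.
have : S (s + d / 2).
  split; first by rewrite (le_trans as_)// lerDl divr_ge0 ?ltW.
  move=> y /andP[ay yd]; have [ys|sy] := leP y s; first by apply: Ple; rewrite ay.
  by apply: Pd; rewrite sy (le_lt_trans yd)// ltrD2l ltr_pdivrMr// ltr_pMr// ltr1n.
have hub : has_ubound S by exists b.
move=> /(ub_le_sup hub); rewrite -/s leNgt ltrDl divr_gt0//.
Qed.

End RealInduction.

(** * Absolutely continuous functions and their product rule *)

Section Primitives.
Context {R : realType}.
Local Notation mu := (@lebesgue_measure R).
Local Notation itg D f := (mu.-integrable D (EFin \o f)).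
Implicit Types (f g h F : R -> R) (D : set R) (a b x y : R).

Definition locint g := forall a b, itg `[a, b] g.

Lemma le_Rint D f g : measurable D -> itg D f -> itg D g ->
  (forall x, D x -> f x <= g x) ->
  \int[mu]_(x in D) f x <= \int[mu]_(x in D) g x.
Proof. by move=> mD fi gi fg; exact: le_Rintegral. Qed.

Lemma itg_norm D f : itg D f -> itg D (Num.norm \o f).
Proof. by move=> fi; exact: integrable_norm. Qed.

Lemma Rint_norm_le D f : measurable D -> itg D f ->
  `|\int[mu]_(x in D) f x| <= \int[mu]_(x in D) `|f x|.
Proof. by move=> mD fi; exact: le_normr_Rintegral. Qed.

Lemma RintD D f g : measurable D -> itg D f -> itg D g ->
  \int[mu]_(x in D) (f + g) x = \int[mu]_(x in D) f x + \int[mu]_(x in D) g x.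
Proof. by move=> mD fi gi; exact: RintegralD. Qed.

Lemma RintB D f g : measurable D -> itg D f -> itg D g ->
  \int[mu]_(x in D) (f - g) x = \int[mu]_(x in D) f x - \int[mu]_(x in D) g x.
Proof. by move=> mD fi gi; exact: RintegralB. Qed.

Lemma RintZ D k f : measurable D -> itg D f ->
  \int[mu]_(x in D) (k *: f) x = k * \int[mu]_(x in D) f x.
Proof. by move=> mD fi; exact: RintegralZl. Qed.

Lemma Rint_subset D D' f : measurable D -> measurable D' -> D `<=` D' ->
  itg D' f -> (forall x, 0 <= f x) ->
  \int[mu]_(x in D) f x <= \int[mu]_(x in D') f x.
Proof.
move=> mD mD' DD fi f0; rewrite /Rintegral fine_le//.
- by apply: integrable_fin_num => //; apply: integrableS fi.
- by apply: integrable_fin_num.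
- apply: ge0_subset_integral => //; first exact: measurable_int fi.
  by move=> x _; rewrite lee_fin.
Qed.

Lemma mu_itv a b : a <= b -> mu `[a, b] = (b - a)%:E.
Proof.
rewrite le_eqVlt => /orP[/eqP ->|ab].
  by rewrite set_itv1 lebesgue_measure_set1 subrr.
by rewrite lebesgue_measure_itv /= lte_fin ab EFinB.
Qed.

Lemma Rint_cst_itv a b (k : R) : a <= b -> \int[mu]_(x in `[a, b]) k = k * (b - a).
Proof.
move=> ab; rewrite Rintegral_cst//; congr (k * _).
by transitivity (fine (b - a)%:E) => //; congr fine; exact: mu_itv.
Qed.

Lemma itg_cst_itv a b (k : R) : itg `[a, b] (cst k).
Proof.
apply: measurable_bounded_integrable => //.
  have [ab|ab] := leP a b; first by have := mu_itv ab => /= ->; rewrite ltry.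
  by rewrite set_itv_ge ?measure0// bnd_simp -ltNge.
exists `|k|; split; first exact: num_real.
by move=> M kM x _ /=; exact: ltW.
Qed.

Lemma locintD f g : locint f -> locint g -> locint (f + g).
Proof. by move=> fi gi a b; apply: itgD. Qed.

Lemma locintZ k f : locint f -> locint (k *: f).
Proof. by move=> fi a b; apply: itgZ. Qed.

Lemma continuous_bounded_itv f a b : continuous f ->
  exists2 M, 0 < M & forall x, a <= x <= b -> `|f x| <= M.
Proof.
move=> cf; have [ab|ba] := leP a b; last first.
  by exists 1 => // x /andP[ax xb]; have := le_trans ax xb; rewrite leNgt ba.
have cn : {within `[a, b], continuous (fun x => `|f x|)}.
  apply: continuous_subspaceT => x; apply: continuous_comp; first exact: cf.
  exact: norm_continuous.
have [c cab fc] := EVT_max ab cn.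
exists (`|f c| + 1) => [|x xab]; first by rewrite ltr_wpDl.
by rewrite (le_trans (fc x _)) ?lerDl// in_itv.
Qed.

Lemma locint_contM f g : continuous f -> locint g -> locint (f * g).
Proof.
move=> cf gi a b; have mf : measurable_fun setT f := continuous_measurable_fun cf.
have [M M0 fM] := continuous_bounded_itv a b cf.
apply: (@itg_le _ _ _ (M *: (Num.norm \o g))) => //.
- apply: measurable_funM; last exact: itg_meas.
  exact: measurable_funS mf.
- move=> x /=; rewrite in_itv/= => xab; rewrite normrM ler_wpM2r//; exact: fM.
- by apply: itgZ => //; apply: itg_norm.
Qed.

Lemma continuous_locint f : continuous f -> locint f.
Proof.
move=> cf; rewrite -[f]mulr1; apply: locint_contM => // a b; exact: itg_cst_itv.
Qed.

Lemma itg_locint f : itg setT f -> locint f.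
Proof. by move=> fi a b; exact: itgS. Qed.

Lemma L2_locint f : L2 f -> locint f.
Proof.
move=> f2 a b; apply: (@itg_le _ _ _ (cst 1 + f * f)) => //.
- by apply: measurable_funS (L2_meas f2).
- move=> x _; rewrite !fctE /cst; have := real_normK (num_real (f x)).
  by rewrite expr2; have := sqr_ge0 (`|f x| - 1); rewrite expr2; nra.
- by apply: itgD => //; [exact: itg_cst_itv|exact: L2_itg].
Qed.

Lemma Rint_split f a m b : locint f -> a <= m -> m <= b ->
  \int[mu]_(x in `[a, b]) f x =
  \int[mu]_(x in `[a, m]) f x + \int[mu]_(x in `[m, b]) f x.
Proof.
move=> fi am mb; have := @Rintegral_itvB _ f (BLeft a) (BRight b) m (fi a b).
rewrite !bnd_simp => /(_ am mb) e; rewrite -(Rintegral_itv_obnd_cbnd (r := m)).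
  by rewrite -e; ring.
by apply: integrableS (fi m b) => //; apply: subset_itvr; rewrite bnd_simp.
Qed.

(** Absolute continuity expressed through the fundamental theorem of calculus. The density [h] is
    determined only almost everywhere, so a function is always carried together with a chosen
    derivative. *)
Definition prim F h := [/\ continuous F, locint h &
  forall a b, a <= b -> F b - F a = \int[mu]_(x in `[a, b]) h x].

Lemma prim_intro F h : locint h ->
  (forall a b, a <= b -> F b - F a = \int[mu]_(x in `[a, b]) h x) -> prim F h.
Proof.
move=> hi e; split=> // x.
have x1 : x - 1 < x + 1 by lra.
have := parameterized_integral_continuous (ltW x1) (hi (x - 1) (x + 1)).
move=> /(@within_continuous_continuous R R R _ _ _ x x1).
rewrite in_itv/= => /(_ ltac:(lra)) H.
have -> : F = (fun y => F (x - 1) + (F y - F (x - 1))).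
  by apply/funext => y; ring.
rewrite /continuous_at; apply: cvgD; first exact: cvg_cst.
have E y : x - 1 <= y -> parameterized_integral mu (x - 1) y h = F y - F (x - 1).
  by move=> xy; rewrite e.
rewrite -E ?lerBlDr ?lerDl//.
apply: cvg_trans H; apply: near_eq_cvg; near=> y.
apply: E; near: y; exists 1 => //= y /=.
by rewrite ltr_norml => /andP[_]; lra.
Unshelve. all: by end_near. Qed.

Lemma primD F G f g : prim F f -> prim G g -> prim (F + G) (f + g).
Proof.
move=> [cF fi Ff] [cG gi Gg]; apply: prim_intro; first exact: locintD.
move=> a b ab; rewrite RintD; try solve [by []|exact: fi|exact: gi].
by rewrite -Ff// -Gg// !fctE; ring.
Qed.

Lemma primZ k F f : prim F f -> prim (k *: F) (k *: f).
Proof.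
move=> [cF fi Ff]; apply: prim_intro; first exact: locintZ.
move=> a b ab; rewrite RintZ; try solve [by []|exact: fi].
by rewrite -Ff// -mulrBr.
Qed.

(** Over a short interval the defect [Z] of the product rule changes by at most [e] times the
    integral of [|f| + |g|], where [e] bounds the oscillation of [F] and [G] there. Continuity makes
    [e] arbitrary, and [real_induction] propagates [|Z| <= e * A]. *)
Lemma primM F G f g : prim F f -> prim G g -> prim (F * G) (f * G + F * g).
Proof.
move=> [cF fi Ff] [cG gi Gg].
have hi : locint (f * G + F * g).
  by apply: locintD; [rewrite mulrC|]; exact: locint_contM.
have nfi : locint ((Num.norm \o f) + (Num.norm \o g)).
  by apply: locintD => u v; apply: itg_norm; [exact: fi|exact: gi].
apply: prim_intro => // a b ab; apply/eqP; rewrite -subr_eq0; apply/eqP.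
set Z := fun x : R => (F * G) x - (F * G) a - \int[mu]_(t in `[a, x]) (f * G + F * g) t.
rewrite -/(Z b); apply/normr0_eq0/eqP; rewrite eq_le normr_ge0 andbT.
set A := fun x : R => \int[mu]_(t in `[a, x]) ((Num.norm \o f) + (Num.norm \o g)) t.
have step x y e : a <= x -> x <= y -> 0 <= e ->
    (forall s, x <= s <= y -> `|F x - F s| <= e) ->
    (forall s, x <= s <= y -> `|G y - G s| <= e) ->
    `|Z y - Z x| <= e * (A y - A x).
  move=> ax xy e0 Fe Ge.
  have -> : A y - A x = \int[mu]_(t in `[x, y]) ((Num.norm \o f) + (Num.norm \o g)) t.
    by rewrite /A (Rint_split nfi ax xy); ring.
  have fxy : itg `[x, y] f := fi x y.
  have gxy : itg `[x, y] g := gi x y.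
  have hxy : itg `[x, y] (f * G + F * g) := hi x y.
  have nxy : itg `[x, y] ((Num.norm \o f) + (Num.norm \o g)) := nfi x y.
  have f1 : itg `[x, y] (G y *: f) by exact: itgZ.
  have g1 : itg `[x, y] (F x *: g) by exact: itgZ.
  have fg1 : itg `[x, y] (G y *: f + F x *: g) by exact: itgD.
  (* [F y G y - F x G x = G y (F y - F x) + F x (G y - G x)], so the increment of [Z] is the
     integral of [k]. *)
  pose k := (G y *: f + F x *: g) - (f * G + F * g).
  have i1 : itg `[x, y] k by exact: itgB.
  have -> : Z y - Z x = \int[mu]_(t in `[x, y]) k t.
    rewrite /Z (Rint_split hi ax xy) RintB// [X in _ = X - _]RintD//.
    rewrite (RintZ _ _ fxy)// (RintZ _ _ gxy)//.
    rewrite -(Ff _ _ xy) -(Gg _ _ xy) !fctE; ring.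
  rewrite -RintZ//.
  rewrite (le_trans (Rint_norm_le _ i1))// le_Rint//; first exact: itg_norm.
    exact: itgZ.
  move=> t /=; rewrite in_itv/= => xty.
  have -> : k t = f t * (G y - G t) + (F x - F t) * g t.
    by rewrite /k !fctE /GRing.scale/=; ring.
  rewrite (le_trans (ler_normD _ _))// !normrM.
  rewrite [leRHS](_ : _ = e * `|f t| + e * `|g t|); last by rewrite -mulrDr.
  by rewrite lerD//; [rewrite mulrC ler_wpM2r// Ge|rewrite ler_wpM2r// Fe].
have key e x : 0 < e -> a <= x -> `|Z x| <= e * A x.
  move=> e0; move: x; apply: real_induction.
  - rewrite /Z /A set_itv1 !Rintegral_set1 !subrr normr0 mulr0//.
  - move=> x ax IH.
    have e2 : 0 < e / 2 by rewrite divr_gt0.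
    have [d1 /= d10 H1] := (@cvgrPdist_le _ _ _ _ _ F (F x)).1 (cF x) (e / 2) e2.
    have [d2 /= d20 H2] := (@cvgrPdist_le _ _ _ _ _ G (G x)).1 (cG x) (e / 2) e2.
    exists (Num.min d1 d2); first by rewrite lt_min d10.
    move=> y /andP[xy]; rewrite -ltrBlDl lt_min => /andP[yd1 yd2].
    have IHx : `|Z x| <= e * A x by apply: IH; rewrite ax lexx.
    have : `|Z y - Z x| <= e * (A y - A x).
      apply: step => //; [exact: ltW|exact: ltW| |] => s /andP[xs sy].
      + rewrite (le_trans (H1 s _)) ?ler_pdivrMr ?ler_pMr ?ler1n//= ler0_norm; lra.
      + have h1 : `|G x - G y| <= e / 2 by apply: H2 => /=; rewrite ler0_norm; lra.
        have h2 : `|G x - G s| <= e / 2 by apply: H2 => /=; rewrite ler0_norm; lra.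
        have -> : G y - G s = (G x - G s) - (G x - G y) by ring.
        by rewrite (le_trans (ler_normB _ _))//; lra.
    have := ler_normD (Z y - Z x) (Z x); rewrite subrK; lra.
  - move=> x ax IH.
    have e2 : 0 < e / 2 by rewrite divr_gt0.
    have [d1 /= d10 H1] := (@cvgrPdist_le _ _ _ _ _ F (F x)).1 (cF x) (e / 2) e2.
    have [d2 /= d20 H2] := (@cvgrPdist_le _ _ _ _ _ G (G x)).1 (cG x) (e / 2) e2.
    pose y := Num.max a (x - Num.min d1 d2 / 2).
    have m0 : 0 < Num.min d1 d2 by rewrite lt_min d10.
    have ay : a <= y by rewrite le_max lexx.
    have yx : y < x by rewrite gt_max ax; lra.
    have xy1 : x - y < d1.
      have : x - Num.min d1 d2 / 2 <= y by rewrite le_max lexx orbT.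
      have : Num.min d1 d2 <= d1 by rewrite ge_min lexx.
      lra.
    have xy2 : x - y < d2.
      have : x - Num.min d1 d2 / 2 <= y by rewrite le_max lexx orbT.
      have : Num.min d1 d2 <= d2 by rewrite ge_min lexx orbT.
      lra.
    have IHy : `|Z y| <= e * A y by apply: IH; rewrite ay.
    have : `|Z x - Z y| <= e * (A x - A y).
      apply: step => //; [exact: ltW|exact: ltW| |] => s /andP[ys sx].
      + have h1 : `|F x - F y| <= e / 2 by apply: H1 => /=; rewrite ger0_norm; lra.
        have h2 : `|F x - F s| <= e / 2 by apply: H1 => /=; rewrite ger0_norm; lra.
        have -> : F y - F s = (F x - F s) - (F x - F y) by ring.
        by rewrite (le_trans (ler_normB _ _))//; lra.
      + by rewrite (le_trans (H2 s _)) ?ler_pdivrMr ?ler_pMr ?ler1n//= ger0_norm; lra.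
    have := ler_normD (Z x - Z y) (Z y); rewrite subrK; lra.
have [A0|] := lerP (A b) 0.
  have := key 1 b ltr01 ab; rewrite mul1r; lra.
move=> A0; apply/ler_addgt0Pr => e e0; rewrite add0r.
have := key (e / A b) b (divr_gt0 e0 A0) ab; rewrite divfK ?gt_eqF//.
Qed.

End Primitives.

(** * Decay at infinity of functions with an integrable derivative *)

Section Vanishing.
Context {R : realType}.
Local Notation mu := (@lebesgue_measure R).
Local Notation itg D f := (mu.-integrable D (EFin \o f)).
Implicit Types (f g h F : R -> R) (D : set R) (a b x y : R).

Lemma Rint_mkcond D f : \int[mu]_(x in D) f x = \int[mu]_x (\1_D * f) x.
Proof.
rewrite Rintegral_mkcond; apply: eq_Rintegral => x _.
by rewrite patchE fctE indicE; case: ifP => _; rewrite ?mul1r ?mul0r.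
Qed.

Lemma Rint_setU D D' f : measurable D -> measurable D' -> itg setT f ->
  (forall x, D x -> D' x -> False) ->
  \int[mu]_(x in D `|` D') f x = \int[mu]_(x in D) f x + \int[mu]_(x in D') f x.
Proof.
move=> mD mD' fi DD; apply: Rintegral_setU => //.
  by apply: itgS => //; exact: measurableU.
by apply/disj_setPS => x [/DD]; exact.
Qed.

Lemma itg_tail h e : itg setT h -> 0 < e ->
  exists2 N, 0 < N & forall D, measurable D -> (forall x, D x -> N < `|x|) ->
    \int[mu]_(x in D) `|h x| < e.
Proof.
move=> hi e0; pose A (n : nat) : set (measurableTypeR R) := `[- n%:R, n%:R]%classic.
have mh : measurable_fun setT (fun x => `|h x|%:E).
  by apply/measurable_EFinP; apply: measurableT_comp => //; exact: itg_meas hi.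
have ni : itg setT (Num.norm \o h) by exact: itg_norm.
have := @ge0_nondecreasing_set_cvg_integral _ (measurableTypeR R) _ A (fun x => `|h x|%:E) mu.
have -> : \bigcup_i A i = setT.
  rewrite -subTset => x _; exists (Num.truncn `|x|).+1 => //.
  by rewrite /A/= in_itv/= -ler_norml ltW// truncnS_gt.
move=> /(_ _ _ _ _) H.
have {}H : (\int[mu]_(x in A i) `|h x|%:E)%E @[i --> \oo] --> (\int[mu]_x `|h x|%:E)%E.
  apply: H => //.
  - move=> n m nm; apply/subsetPset => x; rewrite /A/= !in_itv/=.
    have : n%:R <= m%:R :> R by rewrite ler_nat.
    lra.
  - by move=> i; exact: measurable_itv.
  - by move=> i; apply: measurable_funS mh.
have fin : (\int[mu]_x `|h x|%:E)%E \is a fin_num by exact: integrable_fin_num ni.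
rewrite -(fineK fin) in H.
move/fine_cvgP : H => [_ /cvgrPdist_lt /(_ e e0)] [n _ /(_ n (leqnn n)) /=].
rewrite -/(Rintegral mu setT (fun x => `|h x|)) -/(Rintegral mu (A n) (fun x => `|h x|)).
move=> Hn; exists (n%:R + 1); first by rewrite ltr_wpDl.
move=> D mD Dn; apply: le_lt_trans Hn; rewrite -[leRHS]opprK.
have dis x : A n x -> D x -> False.
  by move=> + /Dn; rewrite /A/= in_itv/= -ler_norml; lra.
have mA : measurable (A n) by exact: measurable_itv.
have e1 := Rint_setU mA mD ni dis.
have e2 : \int[mu]_(x in A n `|` D) (Num.norm \o h) x <= \int[mu]_x (Num.norm \o h) x.
  by apply: Rint_subset => //; [exact: measurableU|move=> x /=].
rewrite e1 in e2; rewrite opprK (le_trans _ (ler_norm _))//.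
rewrite lerBrDl; exact: e2.
Qed.

(** Far out, the tail of [h] makes the oscillation of [F] small, and the tail of [F] provides in
    every unit interval a point where [F] itself is small. *)
Lemma prim_vanish F h e : prim F h -> itg setT F -> itg setT h -> 0 < e ->
  exists2 N, 0 < N & forall x, N <= `|x| -> `|F x| <= e.
Proof.
move=> [cF _ Fh] Fi hi e0.
have e2 : 0 < e / 2 by rewrite divr_gt0.
have [N1 N10 H1] := itg_tail Fi e2; have [N2 N20 H2] := itg_tail hi e2.
pose N := Num.max N1 N2; exists (N + 2); first by rewrite ltr_wpDl// le_max (ltW N10).
have NN1 : N1 <= N by rewrite le_max lexx.
have NN2 : N2 <= N by rewrite le_max lexx orbT.
have key (u v : R) : u <= v -> (forall x, u <= x <= v -> N < `|x|) -> `|F v - F u| <= e / 2.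
  move=> uv far; rewrite Fh//.
  rewrite (le_trans (Rint_norm_le _ _))//; first exact: itgS.
  apply/ltW/H2 => // x /=; rewrite in_itv/= => /far; exact: le_lt_trans.
have pt (u : R) : (forall x, u <= x <= u + 1 -> N < `|x|) ->
    exists2 p, u <= p <= u + 1 & `|F p| <= e / 2.
  move=> far; apply: contrapT => nex.
  have : \int[mu]_(x in `[u, u + 1]) `|F x| < e / 2.
    by apply: H1 => // x /=; rewrite in_itv/= => /far; exact: le_lt_trans.
  apply/negP; rewrite -leNgt.
  rewrite -[leLHS]mulr1 -[X in _ * X](_ : u + 1 - u = 1); last by ring.
  rewrite -Rint_cst_itv ?lerDl//; apply: le_Rint => //.
  - exact: itg_cst_itv.
  - by apply: itg_norm; exact: itgS.
  - move=> x /=; rewrite in_itv/= => xu; rewrite leNgt; apply/negP => Fx.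
    by apply: nex; exists x => //; exact: ltW.
move=> x; have [x0|x0] := ger0P x => Nx.
- have [|p /andP[p1 p2] Fp] := pt (x - 1).
    by move=> y /andP[y1 _]; rewrite ger0_norm; lra.
  have : `|F x - F p| <= e / 2.
    apply: key; first lra.
    by move=> y /andP[y1 _]; rewrite ger0_norm; lra.
  have := ler_normD (F x - F p) (F p); rewrite subrK; lra.
- have [|p /andP[p1 p2] Fp] := pt x.
    by move=> y /andP[_ y1]; rewrite ltr0_norm; lra.
  have : `|F p - F x| <= e / 2.
    apply: key; first lra.
    by move=> y /andP[_ y1]; rewrite ltr0_norm; lra.
  have := ler_normB (F p) (F p - F x); rewrite opprB addrC subrK; lra.
Qed.

Lemma Rint_cvgT h (D : set R) e : itg setT h -> measurable D -> 0 < e ->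
  exists2 N, 0 < N & forall a b, a <= - N -> N <= b ->
    `|\int[mu]_(x in D) h x - \int[mu]_(x in D `&` `[a, b]) h x| <= e.
Proof.
move=> hi mD e0; have [N N0 H] := itg_tail hi e0; exists (N + 1); first lra.
move=> a b aN Nb.
have m1 : measurable (D `&` `[a, b]) by apply: measurableI.
have m2 : measurable (D `\` `[a, b]) by apply: measurableD.
have -> : \int[mu]_(x in D) h x - \int[mu]_(x in D `&` `[a, b]) h x =
    \int[mu]_(x in D `\` `[a, b]) h x.
  rewrite -[X in \int[mu]_(x in X) _ - _](@setUIDK _ D `[a, b]%classic).
  rewrite Rint_setU//; first by rewrite addrC addKr.
  by move=> x [_ xab] [_].
rewrite (le_trans (Rint_norm_le _ _))//; first exact: itgS.
apply/ltW/H => // x /= [_]; rewrite in_itv/= => nx; rewrite ltNge; apply/negP.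
by rewrite ler_norml => xN; apply: nx; lra.
Qed.

Lemma prim_int_right F h a : prim F h -> itg setT F -> itg setT h ->
  \int[mu]_(x in `]a, +oo[) h x = - F a.
Proof.
move=> pF Fi hi; have [cF lh Fh] := pF; apply/eqP; rewrite -subr_eq0 opprK; apply/eqP.
apply/normr0_eq0/eqP; rewrite eq_le normr_ge0 andbT; apply/ler_addgt0Pr => e e0; rewrite add0r.
have e2 : 0 < e / 2 by rewrite divr_gt0.
have mD : measurable (`]a, +oo[%classic : set R) by exact: measurable_itv.
have [N1 N10 H1] := Rint_cvgT hi mD e2.
have [N2 N20 H2] := prim_vanish pF Fi hi e2.
pose b := Num.max (Num.max N1 N2) a; pose a' := Num.min (- N1) a.
have := H1 a' b; rewrite !le_max !lexx ge_min lexx => /(_ isT isT).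
have -> : `]a, +oo[ `&` `[a', b] = `]a, b]%classic.
  apply/seteqP; split=> x /=; rewrite !in_itv/= andbT.
    by move=> [-> /andP[_ ->]].
  move=> /andP[ax ->]; rewrite ax andbT; split=> //.
  by rewrite (le_trans _ (ltW ax))// ge_min lexx orbT.
have ab : a <= b by rewrite le_max lexx orbT.
have -> : \int[mu]_(x in `]a, b]) h x = \int[mu]_(x in `[a, b]) h x.
  by apply: Rintegral_itv_obnd_cbnd; exact: itgS.
rewrite -Fh// => h1.
have : `|F b| <= e / 2.
  apply: H2; rewrite (le_trans _ (ler_norm _))//.
  by rewrite !le_max lexx orbT.
have := ler_normD (\int[mu]_(x in `]a, +oo[) h x - (F b - F a)) (F b).
rewrite (_ : _ - _ + F b = \int[mu]_(x in `]a, +oo[) h x + F a); last by ring.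
lra.
Qed.

Lemma prim_intT F h : prim F h -> itg setT F -> itg setT h ->
  \int[mu]_x h x = 0.
Proof.
move=> pF Fi hi; have [cF lh Fh] := pF.
apply/normr0_eq0/eqP; rewrite eq_le normr_ge0 andbT; apply/ler_addgt0Pr => e e0; rewrite add0r.
have e2 : 0 < e / 3 by rewrite divr_gt0.
have [N1 N10 H1] := Rint_cvgT hi (@measurableT _ _) e2.
have [N2 N20 H2] := prim_vanish pF Fi hi e2.
pose b := Num.max N1 N2.
have b1 : N1 <= b by rewrite le_max lexx.
have b2 : N2 <= b by rewrite le_max lexx orbT.
have := H1 (- b) b; rewrite lerN2 => /(_ b1 b1).
rewrite setTI -Fh; last lra.
have : `|F b| <= e / 3 by apply: H2; rewrite (le_trans _ (ler_norm _)).
have : `|F (- b)| <= e / 3 by apply: H2; rewrite normrN (le_trans _ (ler_norm _)).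
move=> h1 h2 h3.
have := ler_normD (\int[mu]_x h x - (F b - F (- b))) (F b - F (- b)); rewrite subrK.
have := ler_normB (F b) (F (- b)); lra.
Qed.

Lemma prim_int_left F h a : prim F h -> itg setT F -> itg setT h ->
  \int[mu]_(x in `]-oo, a]) h x = F a.
Proof.
move=> pF Fi hi; have := prim_intT pF Fi hi; have := prim_int_right a pF Fi hi.
have -> : [set: R] = `]-oo, a] `|` `]a, +oo[.
  apply/seteqP; split=> x //= _; rewrite !in_itv/= andbT.
  by have [xa|xa] := leP x a; [left|right].
rewrite Rint_setU//; first by move=> ->; lra.
by move=> x /=; rewrite !in_itv/= andbT leNgt => /negP.
Qed.

End Vanishing.

(** * The Sobolev space H^1 of the line *)

Section H1line.
Context {R : realType}.
Local Notation mu := (@lebesgue_measure R).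
Local Notation itg D f := (mu.-integrable D (EFin \o f)).
Implicit Types (f g h F : R -> R) (D : set R) (a b x y : R).

(** [f] is the continuous representative, [g] any representative of the weak derivative. *)
Definition H1 f g := [/\ L2 f, L2 g & prim f g].

Lemma H1_L2 f g : H1 f g -> L2 f. Proof. by case. Qed.
Lemma H1_L2d f g : H1 f g -> L2 g. Proof. by case. Qed.
Lemma H1_cont f g : H1 f g -> continuous f. Proof. by case=> _ _ []. Qed.
Lemma H1_prim f g : H1 f g -> prim f g. Proof. by case. Qed.
Lemma H1_ftc f g a b : H1 f g -> a <= b -> f b - f a = \int[mu]_(x in `[a, b]) g x.
Proof. by case=> _ _ [_ _]; exact. Qed.

Lemma H1D f g f' g' : H1 f g -> H1 f' g' -> H1 (f + f') (g + g').
Proof. by move=> [f2 g2 p] [f2' g2' p']; split; [exact: L2D|exact: L2D|exact: primD]. Qed.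

Lemma H1Z k f g : H1 f g -> H1 (k *: f) (k *: g).
Proof. by move=> [f2 g2 p]; split; [exact: L2Z|exact: L2Z|exact: primZ]. Qed.

Lemma H1N f g : H1 f g -> H1 (- f) (- g).
Proof. by move=> fg; rewrite -[- f]scaleN1r -[- g]scaleN1r; exact: H1Z. Qed.

Lemma H1B f g f' g' : H1 f g -> H1 f' g' -> H1 (f - f') (g - g').
Proof. by move=> fg fg'; apply: H1D => //; exact: H1N. Qed.

Let ip_norm_le D f g : measurable D -> L2 f -> L2 g ->
  2 * `|ip D f g| <= ip setT f f + ip setT g g.
Proof.
move=> mD f2 g2; have := ip_young mD f2 g2 ltr01; rewrite invr1 !mul1r.
by have := ip_leT mD f2; have := ip_leT mD g2; lra.
Qed.

Let ip_primM D f g f' g' : measurable D -> L2 f -> L2 g -> L2 f' -> L2 g' ->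
  \int[mu]_(x in D) (g * f' + f * g') x = ip D g f' + ip D f g'.
Proof. by move=> mD *; rewrite RintD//; exact: L2_itg. Qed.

Let itg_primM f g f' g' : L2 f -> L2 g -> L2 f' -> L2 g' -> itg setT (g * f' + f * g').
Proof. by move=> *; apply: itgD => //; exact: L2_itgM. Qed.

Lemma H1_ibp_right a f g f' g' : H1 f g -> H1 f' g' ->
  ip `]a, +oo[ g f' + ip `]a, +oo[ f g' = - (f a * f' a).
Proof.
move=> [f2 g2 p] [f2' g2' p'].
rewrite -ip_primM// (prim_int_right a (primM p p'))//; first exact: L2_itgM.
exact: itg_primM.
Qed.

Lemma H1_ibp_left a f g f' g' : H1 f g -> H1 f' g' ->
  ip `]-oo, a] g f' + ip `]-oo, a] f g' = f a * f' a.
Proof.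
move=> [f2 g2 p] [f2' g2' p'].
rewrite -ip_primM// (prim_int_left a (primM p p'))//; first exact: L2_itgM.
exact: itg_primM.
Qed.

Lemma H1_ibp f g f' g' : H1 f g -> H1 f' g' -> ip setT g f' + ip setT f g' = 0.
Proof.
move=> [f2 g2 p] [f2' g2' p'].
rewrite -ip_primM// (prim_intT (primM p p'))//; first exact: L2_itgM.
exact: itg_primM.
Qed.

(** [f x ^+ 2] is minus twice the integral of [f * g] over []x, +oo[]. *)
Lemma H1_sup f g x : H1 f g -> f x ^+ 2 <= ip setT f f + ip setT g g.
Proof.
move=> fg; have [f2 g2 _] := fg; have := H1_ibp_right x fg fg.
rewrite [ip _ g f]ipC expr2.
have mD : measurable (`]x, +oo[%classic : set R) by [].
have := ip_norm_le mD f2 g2.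
have := ler_norm (- ip (`]x, +oo[) f g); rewrite normrN; lra.
Qed.

Lemma H1_sup_bd f g x (A : R) : H1 f g -> 0 <= A ->
  ip setT f f + ip setT g g <= A ^+ 2 -> `|f x| <= A.
Proof.
move=> fg A0 fA; rewrite -(@ler_pXn2r _ 2)// ?nnegrE// real_normK ?num_real//.
exact: le_trans (H1_sup x fg) fA.
Qed.

Lemma H1_bounded f g : H1 f g -> exists2 A, 0 < A & forall x, `|f x| <= A.
Proof.
move=> fg; have s0 : 0 <= ip setT f f + ip setT g g by rewrite addr_ge0 ?ip_ge0.
exists (ip setT f f + ip setT g g + 1) => [|x]; first lra.
apply: (H1_sup_bd x fg); first lra.
by rewrite expr2; nra.
Qed.

Lemma L2_H1M f g h : H1 f g -> L2 h -> L2 (f * h).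
Proof.
move=> fg h2; have [A A0 fA] := H1_bounded fg.
apply: (L2_bdM (K := A)) => //; exact: L2_meas (H1_L2 fg).
Qed.

Lemma H1M f g f' g' : H1 f g -> H1 f' g' -> H1 (f * f') (g * f' + f * g').
Proof.
move=> fg fg'; split; last by apply: primM; exact: H1_prim.
- exact: L2_H1M fg (H1_L2 fg').
- apply: L2D; last exact: L2_H1M fg (H1_L2d fg').
  by rewrite mulrC; exact: L2_H1M fg' (H1_L2d fg).
Qed.

Lemma locint_locally f : measurable_fun setT f -> locint f ->
  locally_integrable setT f.
Proof.
move=> mf fi; split=> //; first exact: openT.
move=> K _ cK; have [M [_ MK]] := compact_bounded cK.
have {}MK x : K x -> `[- (`|M| + 1), `|M| + 1]%classic x.
  move=> Kx; rewrite /= in_itv/= -ler_norml; apply: MK => //.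
  by rewrite (le_lt_trans (ler_norm M))// ltrDl.
apply: (@le_lt_trans _ _ (\int[mu]_(x in `[(- (`|M| + 1))%R, (`|M| + 1)%R]) `|(f x)%:E|)%E).
  apply: ge0_subset_integral => //; first exact: compact_measurable.
  apply/measurable_EFinP; apply: measurableT_comp => //.
  by apply: measurable_funS mf.
by have /integrableP[_] := fi (- (`|M| + 1)) (`|M| + 1).
Qed.

(** At a Lebesgue point [h x] is the derivative of a primitive, and here the primitive vanishes near
    [x]. *)
Lemma locint_zero_ae h : measurable_fun setT h -> locint h ->
  (forall a b, a <= b -> \int[mu]_(x in `[a, b]) h x = 0) ->
  \forall x \ae mu, h x = 0.
Proof.
move=> mh hi h0; have := lebesgue_differentiation (locint_locally mh hi).
apply: filterS; first exact: (ae_filter_ringOfSetsType mu).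
move=> x xh; have x1 : x < x + 1 by lra.
have := FTC1_lebesgue_pt x1 (hi (x - 1) (x + 1)) _ xh.
have y1 : x - 1 < x by lra.
case; first by [].
move=> _ <-.
rewrite derive1E -[RHS](@derive_cst _ _ _ (0 : R) x 1).
apply: near_eq_derive => //; near=> y; rewrite h0//.
near: y; exists 1 => //= y /=; rewrite ltr_norml; lra.
Unshelve. all: by end_near. Qed.

Lemma H1_uniq_ae f g g' : H1 f g -> H1 f g' -> \forall x \ae mu, (g - g') x = 0.
Proof.
move=> fg fg'; have gg : H1 (f - f) (g - g') by exact: H1B.
apply: locint_zero_ae; first exact: L2_meas (H1_L2d gg).
  exact: L2_locint (H1_L2d gg).
by move=> a b ab; rewrite -(H1_ftc gg ab) !fctE; ring.
Qed.

Lemma ip_ae0 D f g : measurable D -> L2 f -> L2 g ->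
  (\forall x \ae mu, f x = 0) -> ip D f g = 0.
Proof.
move=> mD f2 g2 f0; rewrite /ip /Rintegral.
have -> : (\int[mu]_(x in D) (f x * g x)%:E = \int[mu]_(x in D) (cst 0%E x))%E.
  apply: ae_eq_integral => //.
  - exact: measurable_int (L2_itg mD f2 g2).
  - apply: filterS f0; first exact: (ae_filter_ringOfSetsType mu).
    by move=> x fx Dx /=; rewrite fx mul0r.
by rewrite integral0.
Qed.

(** Derivatives of the same function obtained by different routes agree almost everywhere only; this
    makes them interchangeable in every pairing. *)
Lemma H1_ip_uniq D f g g' h : measurable D -> H1 f g -> H1 f g' -> L2 h ->
  ip D g h = ip D g' h.
Proof.
move=> mD fg fg' h2; have := ip_ae0 mD (L2B (H1_L2d fg) (H1_L2d fg')) h2 (H1_uniq_ae fg fg').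
rewrite ipBl//; [lra|exact: H1_L2d fg|exact: H1_L2d fg'].
Qed.

(** Since [f] vanishes at the boundary, cutting there creates no jump. This is how the Dirichlet
    condition moves the problem from the half-line to the line. *)
Lemma H1_zero_ext f g : H1 f g -> f 0 = 0 ->
  H1 (\1_(@Rplus R) * f) (\1_(@Rplus R) * g).
Proof.
have -> : @Rplus R = `]0, +oo[%classic by apply/seteqP; split=> x /=; rewrite in_itv/= andbT.
move=> fg f0; set D := `]0, +oo[%classic; have mD : measurable (D : set R) by exact: measurable_itv.
have [f2 g2 [cf gi fe]] := fg.
have D2 := L2_restr mD f2; have D2' := L2_restr mD g2; split=> //.
have li := L2_locint D2'.
have Dpos x : 0 < x -> \1_D x = 1 :> R.
  by move=> x0; rewrite indicE mem_set// /D/= in_itv/= x0.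
have Dneg x : x <= 0 -> \1_D x = 0 :> R.
  by move=> x0; rewrite indicE memNset// /D/= in_itv/= andbT; apply/negP; rewrite -leNgt.
have pos x : 0 <= x -> (\1_D * f) x = \int[mu]_(t in `[0, x]) (\1_D * g) t.
  move=> x0; have <- : \int[mu]_(t in `]0, x]) (\1_D * g) t = \int[mu]_(t in `[0, x]) (\1_D * g) t.
    by apply: Rintegral_itv_obnd_cbnd; apply: integrableS (li 0 x) => //; apply: subset_itvr; rewrite bnd_simp.
  have -> : \int[mu]_(t in `]0, x]) (\1_D * g) t = \int[mu]_(t in `]0, x]) g t.
    apply: eq_Rintegral => t; rewrite inE/= in_itv/= => /andP[t0 _].
    by rewrite fctE Dpos// mul1r.
  have -> : \int[mu]_(t in `]0, x]) g t = \int[mu]_(t in `[0, x]) g t.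
    by apply: Rintegral_itv_obnd_cbnd; apply: integrableS (gi 0 x) => //; apply: subset_itvr; rewrite bnd_simp.
  rewrite -fe// f0 subr0 fctE; move: x0; rewrite le_eqVlt => /orP[/eqP <-|x0].
    by rewrite f0 mulr0.
  by rewrite Dpos// mul1r.
have neg a b : b <= 0 -> \int[mu]_(t in `[a, b]) (\1_D * g) t = 0.
  move=> b0; rewrite -(Rintegral_set0 mu (\1_D * g)) [LHS]Rint_mkcond [RHS]Rint_mkcond.
  apply: eq_Rintegral => t _; rewrite !fctE !indicE in_set0 mul0r.
  case: (boolP (t \in _)) => [|_]; last by rewrite mul0r.
  rewrite inE/= in_itv/= => /andP[_ tb]; rewrite -indicE Dneg ?mul0r ?mulr0//.
  exact: le_trans b0.
apply: prim_intro => // a b ab.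
have [a0|a0] := leP 0 a.
  rewrite !pos//; last exact: le_trans ab.
  by rewrite (Rint_split li a0 ab); ring.
have -> : (\1_D * f) a = 0 by rewrite fctE Dneg ?mul0r// ltW.
rewrite subr0.
have [b0|b0] := leP 0 b.
  by rewrite (Rint_split li (ltW a0) b0) neg// add0r pos.
by rewrite neg ?ltW// fctE Dneg ?mul0r// ltW.
Qed.

End H1line.

(** * Test functions and Sobolev norms *)

Section Smooth.
Context {R : realType}.
Local Notation mu := (@lebesgue_measure R).
Implicit Types (f g : R -> R) (P : {poly R}).

Lemma is_derive_quadratic f (x l C d : R) : 0 < d ->
  (forall h, `|h| < d -> `|f (x + h) - f x - l * h| <= C * h ^+ 2) ->
  is_derive x 1 f l.
Proof.
move=> d0 H.
have key : h^-1 *: (f (h *: (1 : R) + x) - f x) @[h --> 0^'] --> l.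
  apply/cvgrPdist_le => e e0.
  have C0 : 0 < `|C| + 1 by rewrite ltr_wpDl.
  have ec : 0 < e / (`|C| + 1) by rewrite divr_gt0.
  exists (Num.min d (e / (`|C| + 1))); first by rewrite /= lt_min d0.
  move=> h /=; rewrite sub0r normrN lt_min => /andP[hd he] h0.
  have hn : 0 < `|h| by rewrite normr_gt0.
  have -> : l - h^-1 *: (f (h *: (1 : R) + x) - f x) =
      - (h^-1 * (f (x + h) - f x - l * h)).
    rewrite /GRing.scale/= mulr1 [h + x]addrC; field; exact: h0.
  rewrite normrN normrM normfV -(ler_pM2l hn) mulrA divff ?mul1r ?gt_eqF//.
  rewrite (le_trans (H h hd))// -[h ^+ 2]real_normK ?num_real// expr2 mulrA mulrC.
  rewrite ler_wpM2l// (le_trans (ler_wpM2r (ltW hn) (ler_norm C)))//.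
  have : (`|C| + 1) * `|h| <= e by rewrite mulrC -ler_pdivlMr// ltW.
  by have := normr_ge0 h; nra.
apply: DeriveDef; first by apply: cvgP key.
by apply: cvg_lim key.
Qed.

Definition smooth f := forall n x, derivable (derive1n n f) x 1.

Lemma derive1nD n m f : derive1n n (derive1n m f) = derive1n (n + m) f.
Proof. by rewrite /derive1n iterD. Qed.

Lemma smooth_derive f : smooth f -> smooth (derive1 f).
Proof. by move=> sf n x; rewrite -(derive1n1 f) derive1nD addn1; exact: sf. Qed.

Lemma smooth_deriven n f : smooth f -> smooth (derive1n n f).
Proof. by move=> sf m x; rewrite derive1nD; exact: sf. Qed.

Lemma smooth_is_derive f (x : R) : smooth f -> is_derive x 1 f ((derive1 f) x).
Proof. by move=> /(_ 0%N x) sf; apply: DeriveDef => //; rewrite derive1E. Qed.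

Lemma derivable_cont f (x : R) : derivable f x 1 -> {for x, continuous f}.
Proof. by move=> /derivable1_diffP/differentiable_continuous. Qed.

Lemma smooth_cont f : smooth f -> continuous f.
Proof. by move=> sf x; apply: derivable_cont; exact: (sf 0%N). Qed.

(** Smoothness without a formula for the iterated derivatives: membership in a class closed under
    differentiation is enough. *)
Lemma smooth_class (S : (R -> R) -> Prop) :
  (forall f, S f -> exists2 f', S f' & forall x : R, is_derive x 1 f (f' x)) ->
  forall f, S f -> smooth f.
Proof.
move=> SS f Sf; have Sn n : S (derive1n n f).
  elim: n => [//|n /SS[f' Sf' H]]; rewrite derive1nS.
  rewrite (_ : derive1 _ = f')//; apply/funext => x; rewrite derive1E.
  by have [] := H x.
by move=> n x; have [f' _ /(_ x)[]] := SS _ (Sn n).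
Qed.

(** A class to feed to [smooth_class]. It contains sums as well as products so that Leibniz's rule
    does not leave it. *)
Inductive smooth_gen : (R -> R) -> Prop :=
| sg_smooth f : smooth f -> smooth_gen f
| sg_cst k : smooth_gen (cst k)
| sg_add f g : smooth_gen f -> smooth_gen g -> smooth_gen (f + g)
| sg_mul f g : smooth_gen f -> smooth_gen g -> smooth_gen (f * g)
| sg_comp f (a b : R) : smooth f -> smooth_gen (fun x => f (a * x + b)).

Lemma is_derive_affine f (a b x l : R) : is_derive (a * x + b) 1 f l ->
  is_derive x 1 (fun y => f (a * y + b)) (l * a).
Proof.
move=> df; have da : is_derive x (1 : R) (fun y : R => a * y + b) a.
  apply: (@is_derive_quadratic _ _ _ 0 1) => // h _.
  by rewrite (_ : _ - _ = 0) ?normr0 ?mul0r//; ring.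
exact: (@is_derive1_comp _ f (fun y => a * y + b) x l a df da).
Qed.

Lemma smooth_genP f : smooth_gen f -> smooth f.
Proof.
apply: smooth_class => {}f; elim => {f}.
- move=> f sf; exists (derive1 f); first by apply: sg_smooth; exact: smooth_derive.
  by move=> x; exact: smooth_is_derive.
- by move=> k; exists (cst 0); [exact: sg_cst|move=> x; exact: is_derive_cst].
- move=> f g _ [f' sf' df] _ [g' sg' dg]; exists (f' + g'); first exact: sg_add.
  by move=> x; have := is_deriveD (df x) (dg x).
- move=> f g sf [f' sf' df] sg [g' sg' dg]; exists (f * g' + g * f').
    by apply: sg_add; exact: sg_mul.
  by move=> x; have := is_deriveM (df x) (dg x).
- move=> f a b sf; exists ((fun x => (derive1 f) (a * x + b)) * cst a).
    by apply: sg_mul; [apply: sg_comp; exact: smooth_derive|exact: sg_cst].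
  by move=> x; apply: is_derive_affine; exact: smooth_is_derive.
Qed.

Lemma smoothD f g : smooth f -> smooth g -> smooth (f + g).
Proof. by move=> *; apply/smooth_genP/sg_add; exact: sg_smooth. Qed.

Lemma smoothM f g : smooth f -> smooth g -> smooth (f * g).
Proof. by move=> *; apply/smooth_genP/sg_mul; exact: sg_smooth. Qed.

Lemma smoothZ k f : smooth f -> smooth (k *: f).
Proof.
move=> sf; have : smooth (cst k * f).
  by apply/smooth_genP/sg_mul; [exact: sg_cst|exact: sg_smooth].
by [].
Qed.

Lemma smooth_affine a b f : smooth f -> smooth (fun x => f (a * x + b)).
Proof. by move=> *; exact/smooth_genP/sg_comp. Qed.

(** The classical function [exp (-1/x)] with a polynomial factor in [1/x]. The factor closes the
    family under differentiation, [P] becoming [X^2 (P - P')]. *)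
Definition flat P (x : R) : R := if 0 < x then P.[x^-1] * expR (- x^-1) else 0.

Lemma poly_expR_bound P : exists C, forall y : R, 0 <= y -> `|P.[y]| * expR (- y) <= C.
Proof.
exists (\sum_(i < size P) `|P`_i| * i`!%:R) => y y0.
rewrite horner_coef mulrC -ler_pdivlMl ?expR_gt0// expRN invrK mulr_sumr.
apply: (le_trans (ler_norm_sum _ _ _)); apply: ler_sum => i _.
rewrite normrM mulrCA ler_wpM2l// normrX ger0_norm//.
case: (nat_of_ord i) => [|n].
  by rewrite expr0 mulr1 (le_trans _ (expR_ge1Dx y))// lerDl.
have f0 : 0 < (n.+1)`!%:R :> R by rewrite ltr0n fact_gt0.
have := expR_ge1Dxn n y0; rewrite -ler_pdivrMr//; lra.
Qed.

Lemma is_derive_flat P (x : R) :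
  is_derive x 1 (flat P) (flat ('X^2 * (P - P^`())) x).
Proof.
have [x0|x0|->] := ltgtP x 0.
- rewrite {2}/flat ltNge (ltW x0)/=.
  apply: (@near_eq_is_derive _ _ _ (cst 0)).
  near=> y; rewrite /flat ltNge ifF//; apply/negbTE; rewrite negbK ltW//.
  by near: y; exact: lt_nbhsl.
- rewrite {2}/flat x0.
  have xn0 : x != 0 by rewrite gt_eqF.
  have dV : is_derive x (1 : R) (fun y : R => y^-1) (- x ^- 2).
    have := @is_deriveV _ id x 1 1 xn0 (is_derive_id x 1).
    by rewrite /GRing.scale/= mulr1.
  have dP : is_derive x (1 : R) (fun y : R => P.[y^-1]) (P^`().[x^-1] * - x ^- 2).
    exact: (@is_derive1_comp _ (fun y => P.[y]) (fun y => y^-1) x _ _ (is_derive_poly P x^-1) dV).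
  have dN : is_derive x (1 : R) (fun y : R => - y^-1) (x ^- 2).
    by have := is_deriveN dV; rewrite opprK.
  have dE : is_derive x (1 : R) (fun y : R => expR (- y^-1)) (expR (- x^-1) * x ^- 2).
    exact: (@is_derive1_comp _ expR (fun y => - y^-1) x _ _ (is_derive_expR _) dN).
  have H := is_deriveM dP dE.
  rewrite (_ : _ * _ = P.[x^-1] *: (expR (- x^-1) * x ^- 2) +
      expR (- x^-1) *: (P^`().[x^-1] * - x ^- 2)); last first.
    by rewrite /GRing.scale/= !hornerE /=; field; exact: xn0.
  apply: (near_eq_is_derive _ H).
  near=> y; rewrite /flat ifT//; near: y; exact: lt_nbhsr.
(* At the origin, the bound for [X^2 P] evaluated at [1/h] reads [|P(1/h)| exp (-1/h) <= C h^2], a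
   quadratic remainder with zero slope. *)
- rewrite {2}/flat ltxx; have [C HC] := poly_expR_bound ('X^2 * P).
  apply: (@is_derive_quadratic _ _ _ C 1) => // h _.
  rewrite mul0r subr0 add0r /flat ltxx subr0; case: ifP => h0; last first.
    have : 0 <= C.
      apply: le_trans (HC 0 (lexx 0)); rewrite mulr_ge0// ltW ?expR_gt0//.
    by rewrite normr0 => C0; rewrite mulr_ge0// sqr_ge0.
  have hn : h != 0 by rewrite gt_eqF.
  rewrite normrM [X in _ * X]gtr0_norm ?expR_gt0// [C * _]mulrC -ler_pdivrMl ?exprn_gt0//.
  have := HC h^-1; rewrite invr_ge0 ltW// => /(_ isT).
  have -> : ('X^2 * P).[h^-1] = (h ^+ 2)^-1 * P.[h^-1].
    by rewrite hornerM hornerXn exprVn.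
  rewrite normrM ger0_norm ?invr_ge0 ?sqr_ge0//; congr (_ <= _).
  by rewrite mulrA.
Unshelve. all: by end_near. Qed.

Lemma smooth_flat P : smooth (flat P).
Proof.
apply: (@smooth_class (fun f => exists P, f = flat P)); last by exists P.
move=> _ [{}P ->]; exists (flat ('X^2 * (P - P^`()))); first by eexists.
by move=> x; exact: is_derive_flat.
Qed.

(** This bump serves twice: normalized, as the mollifier of the du Bois-Reymond argument, and as the
    modulation direction. The distance of its support from 0 keeps its translates by [y > 0] inside
    the open half-line. *)
Lemma smooth_bump_exists : exists2 phi : R -> R, smooth phi &
  [/\ forall x, 0 <= phi x, forall x, 1 < x < 3 -> 0 < phi x &
      forall x, ~~ (1 < x < 3) -> phi x = 0].
Proof.
have fge x : 0 <= flat 1 x.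
  by rewrite /flat; case: ifP => //; rewrite hornerC mul1r expR_ge0.
have fgt x : 0 < x -> 0 < flat 1 x.
  by move=> x0; rewrite /flat x0 hornerC mul1r expR_gt0.
have f0 x : x <= 0 -> flat 1 x = 0 by move=> x0; rewrite /flat ltNge x0.
exists ((fun x => flat 1 (1 * x + (-1))) * (fun x => flat 1 (-1 * x + 3))).
  by apply: smoothM; apply: smooth_affine; exact: smooth_flat.
split=> x.
- by rewrite fctE mulr_ge0.
- by move=> /andP[x1 x3]; rewrite fctE mulr_gt0//; apply: fgt; lra.
- rewrite negb_and -!leNgt fctE => /orP[x1|x3].
    by rewrite f0 ?mul0r//; lra.
  by rewrite [X in _ * X]f0 ?mulr0//; lra.
Qed.

End Smooth.

Section TestFunctions.
Context {R : realType}.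
Local Notation mu := (@lebesgue_measure R).
Local Notation itg D f := (mu.-integrable D (EFin \o f)).
Implicit Types (f g phi : R -> R) (Omega : set R).

Lemma test_intro Omega phi a b : smooth phi ->
  (forall x, ~ (a <= x <= b) -> phi x = 0) -> `[a, b] `<=` Omega ->
  test_fun Omega phi.
Proof.
move=> sphi z KO; split=> //; exists `[a, b]%classic; split=> //.
exact: segment_compact.
Qed.

Lemma test_smooth Omega phi : test_fun Omega phi -> smooth phi.
Proof. by case. Qed.

Lemma test_sub Omega Omega' phi : Omega `<=` Omega' -> test_fun Omega phi ->
  test_fun Omega' phi.
Proof. by move=> OO [sp [K [cK KO z]]]; split=> //; exists K; split=> // x /KO/OO. Qed.

Lemma test_derive Omega phi : test_fun Omega phi -> test_fun Omega (derive1 phi).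
Proof.
move=> [sp [K [cK KO z]]]; split; first exact: smooth_derive.
exists K; split=> // x nKx; rewrite derive1E -[RHS](@derive_cst _ _ _ (0 : R) x 1).
apply: near_eq_derive; have := compact_closed (@Rhausdorff R) cK.
move=> /closed_openC; rewrite openE => /(_ x nKx); rewrite /interior /=.
by apply: filterS => y; exact: z.
Qed.

Lemma test_deriven Omega n phi : test_fun Omega phi -> test_fun Omega (derive1n n phi).
Proof. by move=> tp; elim: n => // n; rewrite derive1nS; exact: test_derive. Qed.

Lemma test_supp Omega phi : test_fun Omega phi ->
  exists2 M, 0 < M & forall x, M < `|x| -> phi x = 0.
Proof.
move=> [sp [K [cK KO z]]]; have [M [_ MK]] := compact_bounded cK.
exists (`|M| + 1) => [|x xM]; first by rewrite ltr_wpDl.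
apply: z => Kx; move: xM; rewrite ltNge => /negP; apply.
by apply: MK => //; rewrite (le_lt_trans (ler_norm M))// ltrDl.
Qed.

Lemma testD Omega f g : test_fun Omega f -> test_fun Omega g -> test_fun Omega (f + g).
Proof.
case=> sf [K [cK KO z]]; case=> sg [K' [cK' KO' z']]; split; [exact: (smoothD sf sg)|].
exists (K `|` K'); split; first exact: compactU.
- by move=> x [/KO|/KO'].
- move=> x nx; rewrite fctE z ?z' ?addr0// => Kx; apply: nx; [by right|by left].
Qed.

Lemma testZ Omega k f : test_fun Omega f -> test_fun Omega (k *: f).
Proof.
move=> [sf [K [cK KO z]]]; split; first exact: smoothZ.
by exists K; split=> // x nx; rewrite fctE z// /GRing.scale/= mulr0.
Qed.

Lemma L2_compact_supp f (M : R) : continuous f -> (forall x, M < `|x| -> f x = 0) -> L2 f.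
Proof.
move=> cf z; have mf : measurable_fun setT f := continuous_measurable_fun cf.
apply: L2_of_sqr => //.
have -> : EFin \o (f * f) = (EFin \o (f * f)) \_ `[- `|M|, `|M|].
  apply/funext => x; rewrite patchE; case: ifPn => // /negP nx.
  have Mx : M < `|x|.
    rewrite (le_lt_trans (ler_norm M))// ltNge ler_norml; apply/negP => xM; apply: nx.
    by rewrite inE/= in_itv.
  by rewrite /= fctE z// mul0r.
apply/(@integrable_mkcond _ _ _ mu `[- `|M|, `|M|]%classic (EFin \o (f * f))) => //.
have := @continuous_locint R (f * f); apply.
by move=> x; apply: continuousM; exact: cf.
Qed.

Lemma prim_C1 f : (forall x, derivable f x 1) -> continuous (derive1 f) ->
  prim f (derive1 f).
Proof.
move=> df cdf; apply: prim_intro; first exact: continuous_locint.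
move=> a b; rewrite le_eqVlt => /orP[/eqP ->|ab].
  by rewrite subrr set_itv1 Rintegral_set1.
have E : (\int[mu]_(x in `[a, b]) (derive1 f x)%:E = (f b)%:E - (f a)%:E)%E.
  apply: continuous_FTC2; first exact: ab.
  - exact: continuous_subspaceT.
  - have cf x : {for x, continuous f} := derivable_cont (df x).
    split; [by move=> x _; exact: df|exact: cvg_at_right_filter (cf a)|
            exact: cvg_at_left_filter (cf b)].
  - by move=> x _.
by rewrite /Rintegral E.
Qed.

Lemma test_H1 Omega phi : test_fun Omega phi -> H1 phi (derive1 phi).
Proof.
move=> tp; have td := test_derive tp.
have cp := smooth_cont (test_smooth tp); have cd := smooth_cont (test_smooth td).
have [M _ zp] := test_supp tp; have [M' _ zd] := test_supp td.
split; [exact: L2_compact_supp zp|exact: L2_compact_supp zd|].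
by apply: prim_C1; [exact: (test_smooth tp) 0%N|exact: cd].
Qed.

Lemma H1_weak f g : H1 f g -> weak_deriv f g.
Proof.
move=> fg phi /test_H1 tp; have := H1_ibp fg tp; rewrite /ip; lra.
Qed.

(** [eta] is the bump divided by its integral and [S] its primitive, a smooth step rising from 0 to
    1 across [[1, 3]]. *)
Lemma mollifier_exists : exists eta S : R -> R,
  [/\ smooth eta, smooth S, derive1 S = eta,
      forall x, ~ (1 <= x <= 3) -> eta x = 0 &
      [/\ forall x, 0 <= eta x, forall x, 0 <= S x <= 1, forall x, x <= 1 -> S x = 0 &
          forall x, 3 <= x -> S x = 1]].
Proof.
have [p sp [p0 ppos pz]] := @smooth_bump_exists R.
have tp : test_fun setT p.
  apply: (@test_intro _ _ 1 3) => // x nx; apply: pz; apply/negP => xx; apply: nx; lra.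
have [p2 _ _] := test_H1 tp.
have lp := L2_locint p2.
have pint : itg setT p.
  apply: (@itg_le _ _ _ (p * p + \1_`[1, 3])) => //.
  - exact: L2_meas.
  - move=> x _; rewrite ger0_norm// !fctE; case: (boolP (1 < x < 3)) => h; last first.
      by rewrite pz// mul0r add0r.
    rewrite indicE mem_set ?mulr1n/=; last by rewrite in_itv/=; lra.
    have := sqr_ge0 (p x - 1); rewrite expr2; have := p0 x; nra.
  - apply: itgD => //; first exact: L2_sqr.
    exact: integrable_indic_itv.
pose I := \int[mu]_x p x.
have splitI x : \int[mu]_(t in `]-oo, x]) p t + \int[mu]_(t in `]x, +oo[) p t = I.
  rewrite -Rint_setU//.
    congr Rintegral; apply/seteqP; split=> y //= _; rewrite !in_itv/= andbT.
    by have [yx|yx] := leP y x; [left|right].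
  by move=> y /=; rewrite !in_itv/= andbT leNgt => /negP.
have zint (D : set R) : (forall x, D x -> ~ (1 < x < 3)) -> \int[mu]_(t in D) p t = 0.
  move=> Dz; rewrite (@eq_Rintegral _ _ _ mu D (cst 0)); last first.
    by move=> x; rewrite inE => /Dz/negP/pz.
  by rewrite /Rintegral integral0.
have c0 x : x <= 1 -> \int[mu]_(t in `]-oo, x]) p t = 0.
  by move=> x1; apply: zint => y /=; rewrite in_itv/=; lra.
have c3 x : 3 <= x -> \int[mu]_(t in `]x, +oo[) p t = 0.
  by move=> x3; apply: zint => y /=; rewrite in_itv/= andbT; lra.
have I0 : 0 < I.
  have [c c13 cmin] : exists2 c, c \in `[3 / 2, 5 / 2] &
      forall t, t \in `[3 / 2, 5 / 2] -> p c <= p t.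
    apply: EVT_min; first lra.
    by apply: continuous_subspaceT; exact: smooth_cont.
  have pc : 0 < p c by apply: ppos; move: c13; rewrite in_itv/=; lra.
  apply: (@lt_le_trans _ _ (\int[mu]_(x in `[3 / 2, 5 / 2]) p x)).
    apply: (@lt_le_trans _ _ (p c * (5 / 2 - 3 / 2))); first by rewrite mulr_gt0//; lra.
    rewrite -Rint_cst_itv; last lra.
    by apply: le_Rint => //; exact: itg_cst_itv.
  by apply: Rint_subset.
have dS (x : R) : is_derive x (1 : R) (fun y => I^-1 * \int[mu]_(t in `]-oo, y]) p t) (I^-1 * p x).
  have cp : continuous p := smooth_cont sp.
  have x1 : x < x + 1 by rewrite ltrDl.
  have iu : itg `]-oo, x + 1] p by exact: itgS.
  have := continuous_FTC1 x1 iu _ (cp x); case; first by rewrite ltNyr.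
  move=> d e.
  have H : is_derive x (1 : R) (fun y => \int[mu]_(t in `]-oo, y]) p t) (p x).
    by apply: DeriveDef; [exact: d|rewrite -derive1E].
  by have := is_deriveZ I^-1 H.
exists (I^-1 *: p), (fun y => I^-1 * \int[mu]_(t in `]-oo, y]) p t).
have dSE : derive1 (fun y => I^-1 * \int[mu]_(t in `]-oo, y]) p t) = I^-1 *: p.
  by apply/funext => x; rewrite derive1E; have [] := dS x.
have se : smooth (I^-1 *: p) by exact: smoothZ.
split; [exact: se| |exact: dSE| |].
- move=> n x; case: n => [|n]; first by have [] := dS x.
  by rewrite -addn1 -derive1nD derive1n1 dSE; exact: se.
- by move=> x nx; rewrite fctE pz ?[_ *: _]mulr0//; apply/negP => xx; apply: nx; lra.
- split=> x.
  + by rewrite mulr_ge0// invr_ge0 ltW.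
  + have h1 : 0 <= \int[mu]_(t in `]-oo, x]) p t by apply: Rintegral_ge0.
    have h2 : 0 <= \int[mu]_(t in `]x, +oo[) p t by apply: Rintegral_ge0.
    have h3 := splitI x.
    rewrite mulr_ge0 ?invr_ge0 ?(ltW I0)//= ler_pdivrMl// mulr1.
    by rewrite -h3 lerDl.
  + by move=> x1; rewrite c0// mulr0.
  + move=> x3; have := splitI x; rewrite c3// addr0 => ->.
    by rewrite mulVf// gt_eqF.
Qed.

End TestFunctions.

(** * The du Bois-Reymond lemma *)

Section DuBoisReymond.
Context {R : realType}.
Local Notation mu := (@lebesgue_measure R).
Local Notation itg D f := (mu.-integrable D (EFin \o f)).
Implicit Types (f g phi : R -> R) (a b c d e : R).

Lemma itg_indic a b : itg setT (\1_`[a, b[ : R -> R).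
Proof. exact: integrable_indic_itv. Qed.

Lemma Rint_indic a b : a <= b -> \int[mu]_x (\1_`[a, b[ : R -> R) x = b - a.
Proof.
move=> ab; transitivity (\int[mu]_x (\1_`[a, b[ * cst 1) x).
  by apply: eq_Rintegral => x _; rewrite fctE mulr1.
have i1 : itg `[a, b[ (cst 1 : R -> R).
  by apply: integrableS (itg_cst_itv a b 1) => //; apply: subset_itvl; rewrite bnd_simp.
by rewrite -Rint_mkcond (Rintegral_itv_bndo_bndc i1) Rint_cst_itv// mul1r.
Qed.

Lemma L2_indic a b : L2 (\1_`[a, b[ : R -> R).
Proof.
apply: L2_of_sqr => //; have -> : \1_`[a, b[ * \1_`[a, b[ = (\1_`[a, b[ : R -> R).
  by apply/funext => x; rewrite fctE indicE; case: (_ \in _); rewrite ?mulr1 ?mulr0.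
exact: itg_indic.
Qed.

(** [chi a b d] is the difference of two smooth steps at scale [d], one at [a] and one at [b]. It
    departs from the indicator only over two stretches of length [3 d], and by at most 1, whence
    [6 d]. Its derivative is the difference of two mollifier kernels, each carried by the ball of
    radius [4 d] about its endpoint. *)
Lemma smooth_indic_exists : exists eta (B : R) (chi : R -> R -> R -> R -> R),
  [/\ 0 <= B, forall x, 0 <= eta x <= B, forall x, ~ (1 <= x <= 3) -> eta x = 0,
      (forall a d, 0 < d -> \int[mu]_(x in ball a (4 * d)) (d^-1 * eta (d^-1 * (x - a))) = 1) /\ continuous eta &
      forall a b d, a <= b -> 0 < d ->
      [/\ test_fun `[a, b + 4 * d] (chi a b d), 
          forall x, derive1 (chi a b d) x = d^-1 * eta (d^-1 * (x - a)) - d^-1 * eta (d^-1 * (x - b)),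
          ip setT (chi a b d - \1_`[a, b[) (chi a b d - \1_`[a, b[) <= 6 * d &
          forall x, x <= a -> chi a b d x = 0]].
Proof.
have [eta [S [se sS dS eta0 [etage0 S01 S0 S1]]]] := @mollifier_exists R.
have ceta : continuous eta by exact: smooth_cont.
have [B B0 etaB] := continuous_bounded_itv 1 3 ceta.
pose T a d (x : R) := S (d^-1 * x + (- (d^-1 * a))).
have TE a d x : T a d x = S (d^-1 * (x - a)) by rewrite /T mulrBr.
have sT a d : smooth (T a d) by exact: smooth_affine.
have dT a d x : is_derive x (1 : R) (T a d) (d^-1 * eta (d^-1 * (x - a))).
  rewrite mulrC mulrBr; apply: is_derive_affine; rewrite -dS.
  exact: smooth_is_derive.
have ed x : 0 <= eta x <= B.
  rewrite etage0; have [xx|/negP xx] := boolP (1 <= x <= 3); last by rewrite eta0// ltW.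
  by rewrite (le_trans (ler_norm _))// etaB.
pose chi a b d := T a d - T b d.
exists eta, B, chi; split; [exact: ltW|exact: ed|exact: eta0| |].
  split; last exact: ceta. move=> a d d0; have d4 : 0 < 4 * d by rewrite mulr_gt0.
  have cde : continuous (fun x => d^-1 * eta (d^-1 * (x - a))).
    have -> : (fun x => d^-1 * eta (d^-1 * (x - a))) =
        d^-1 *: (fun x => eta (d^-1 * x + (- (d^-1 * a)))).
      by apply/funext => x; rewrite mulrBr.
    by apply: smooth_cont; apply: smoothZ; exact: smooth_affine.
  have dTE : derive1 (T a d) = (fun x => d^-1 * eta (d^-1 * (x - a))).
    by apply/funext => x; rewrite derive1E; have [] := dT a d x.
  have pT : prim (T a d) (fun x => d^-1 * eta (d^-1 * (x - a))).
    by rewrite -dTE; apply: prim_C1; [exact: (sT a d 0%N)|rewrite dTE].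
  have [_ li Te] := pT.
  rewrite ball_itv.
  have i1 : itg `]a - 4 * d, a + 4 * d] (fun x => d^-1 * eta (d^-1 * (x - a))).
    apply: integrableS (li (a - 4 * d) (a + 4 * d)) => //.
    by apply: subset_itvr; rewrite bnd_simp.
  have i2 : itg `]a - 4 * d, a + 4 * d[ (fun x => d^-1 * eta (d^-1 * (x - a))).
    by apply: integrableS i1 => //; apply: subset_itvl; rewrite bnd_simp.
  rewrite (Rintegral_itv_bndo_bndc i2) (Rintegral_itv_obnd_cbnd i1) -Te; last lra.
  rewrite !TE S1; last by rewrite ler_pdivlMl//; lra.
  by rewrite S0 ?subr0// ler_pdivrMl//; lra.
move=> a b d ab d0.
have dn0 : 0 <= d^-1 by rewrite invr_ge0 ltW.
have T0 u x : x <= u + d -> T u d x = 0.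
  by move=> xu; rewrite TE S0// ler_pdivrMl//; lra.
have T1 u x : u + 3 * d <= x -> T u d x = 1.
  by move=> xu; rewrite TE S1// ler_pdivlMl//; lra.
have T01 u x : 0 <= T u d x <= 1 by rewrite TE S01.
have schi : smooth (chi a b d).
  apply: smoothD; first exact: sT.
  by rewrite -scaleN1r; apply: smoothZ; exact: sT.
have tchi : test_fun `[a, b + 4 * d] (chi a b d).
  apply: (@test_intro _ _ _ a (b + 4 * d)) => // x nx; rewrite /chi !fctE.
  have [xa|ax] := leP x a; first by rewrite !T0 ?subrr//; lra.
  by rewrite !T1 ?subrr//; have := nx; lra.
split=> //.
- move=> x; rewrite derive1E.
  have H := is_deriveB (dT a d x) (dT b d x).
  by have [] := H.
- have test2 := H1_L2 (test_H1 tchi).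
  have i2 := L2B test2 (L2_indic a b).
  pose k := (\1_`[a, (a + 3 * d)[ : R -> R) + \1_`[b, (b + 3 * d)[.
  have ki : itg setT k by apply: itgD => //; exact: itg_indic.
  have -> : 6 * d = \int[mu]_x k x.
    by rewrite RintD ?Rint_indic; [ring|lra|lra|by []|exact: itg_indic|exact: itg_indic].
  apply: le_Rint => //; first exact: L2_itg.
  move=> x _; rewrite /k /chi !fctE !indicE !mem_setE !in_itv/=.
  have := T01 a x; have := T01 b x.
  have [xa|ax] := ltP x a.
    rewrite !T0 ?mul0r ?subr0; [|lra|lra].
    rewrite [b <= x]leNgt (lt_le_trans xa ab)/=. lra.
  have [xa3|ax3] := ltP x (a + 3 * d).
    have xb3 : x < b + 3 * d by lra.
    have [xb|bx] := ltP x b.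
      by rewrite (T0 b)/=; [nra|lra].
    by rewrite xb3/=; nra.
  rewrite (T1 a)//.
  have [xb|bx] := ltP x b; first by rewrite (T0 b)/=; [lra|lra].
  have [xb3|bx3] := ltP x (b + 3 * d); last by rewrite (T1 b)//=; lra.
  by rewrite /=; nra.
- by move=> x xa; rewrite /chi !fctE !T0 ?subrr//; lra.
Qed.

Lemma prim_exists g : locint g -> exists G, prim G g.
Proof.
move=> gi; exists (fun x => \int[mu]_(t in `[0, x]) g t - \int[mu]_(t in `[x, 0]) g t).
have z x y : x < y -> \int[mu]_(t in `[y, x]) g t = 0.
  by move=> xy; rewrite set_itv_ge ?Rintegral_set0// bnd_simp -ltNge.
apply: prim_intro => // a b ab; have [a0|a0] := leP 0 a.
  have b0 := le_trans a0 ab; rewrite (Rint_split gi a0 ab).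
  move: a0 b0; rewrite le_eqVlt => /orP[/eqP<-|a0]; rewrite le_eqVlt => /orP[/eqP<-|b0];
  rewrite ?set_itv1 ?Rintegral_set1 ?(z 0 a)// ?(z 0 b)//; ring.
rewrite (z a 0)//; have [b0|b0] := leP 0 b.
  rewrite (Rint_split gi (ltW a0) b0); move: b0; rewrite le_eqVlt => /orP[/eqP<-|b0];
  rewrite ?set_itv1 ?Rintegral_set1 ?(z 0 b)//; ring.
by rewrite (z b 0)// (Rint_split gi ab (ltW b0)); ring.
Qed.

Lemma lebesgue_pt_bound f a e : lebesgue_pt f a -> locint f -> measurable_fun setT f -> 0 < e ->
  exists2 r, 0 < r & forall s, 0 < s < r ->
    \int[mu]_(x in ball a s) `|f x - f a| <= e * s.
Proof.
move=> fa fi mf e0; have e2 : 0 < e / 2 by rewrite divr_gt0.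
have := (fine_cvgP _ _).1 fa => -[fin] /cvgrPdist_le /(_ _ e2) => H.
move: fin H => [r1 /= r10 H1] [r2 /= r20 H2].
exists (Num.min r1 r2); first by rewrite lt_min r10.
move=> s /andP[s0]; rewrite lt_min => /andP[s1 s2].
have s1' : ball_ Num.norm 0 r1 s by rewrite /= sub0r normrN gtr0_norm.
have s2' : ball_ Num.norm 0 r2 s by rewrite /= sub0r normrN gtr0_norm.
have := H2 s s2' s0; rewrite sub0r normrN => h2.
have := le_trans (ler_norm _) h2; rewrite /davg /iavg lebesgue_measure_ball ?(ltW s0)//.
have bE : ball a s = `]a - s, a + s[%classic by rewrite ball_itv.
have bi : itg (ball a s) (fun x => `|f x - f a|).
  apply: (@itg_norm _ _ (f - cst (f a))); rewrite bE.
  have i0 : itg `[a - s, a + s] (f - cst (f a)).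
    by apply: itgB => //; exact: itg_cst_itv.
  apply: integrableS i0 => //; apply: subset_itvW; lra.
have -> : (\int[mu]_(y in ball a s) `|((center (f a) \o f) y)%:E| =
    (\int[mu]_(y in ball a s) `|f y - f a|)%:E)%E.
  rewrite /Rintegral fineK//.
  by apply: (integrable_fin_num _ bi); exact: measurable_ball.
rewrite inver; have s2n : s *+ 2 == 0 = false by rewrite mulrn_eq0/= gt_eqF.
have sp : 0 < s *+ 2 by rewrite pmulrn_lgt0.
rewrite s2n /= ler_pdivrMl// => h; apply: (le_trans h).
by rewrite le_eqVlt; apply/orP; left; apply/eqP; field.
Qed.

Lemma ae_exists (P : R -> Prop) : (\forall x \ae mu, P x) -> exists x, P x.
Proof.
move=> [N [mN N0 PN]]; apply: contrapT => nP.
have NT : N = setT by apply/seteqP; split=> // x _; apply: PN => /= Px; apply: nP; exists x.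
move: N0; rewrite NT => h; have : mu (`[0, 1] : set R) = 0%E.
  by apply: (@subset_measure0 _ _ _ mu _ setT).
have := @mu_itv R 0 1 ler01 => -> /eqP; rewrite subr0 eqe oner_eq0//.
Qed.

(** Tested against [chi a b d], the weak derivative compares averages of [f] near [a] and near [b]
    with the integral of [g]. Letting [d] tend to 0 at Lebesgue points gives
    [f b - f a = G b - G a], so [f] agrees almost everywhere with [G] plus a constant. *)
Lemma weak_H1 f g : L2 f -> L2 g -> weak_deriv f g ->
  exists2 F, H1 F g & \forall x \ae mu, f x = F x.
Proof.
move=> f2 g2 fg; have [G pG] := prim_exists (L2_locint g2).
have [cG lg Ge] := pG.
have [eta [B [chi [B0 etaB eta0 [eta1 ceta] Hchi]]]] := smooth_indic_exists.
have mf := L2_meas f2; have lf := L2_locint f2.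
have key a b : a <= b -> lebesgue_pt f a -> lebesgue_pt f b -> f b - f a = G b - G a.
  move=> ab fa fb; rewrite Ge//.
  apply/eqP; rewrite -subr_eq0 -normr_le0; apply/ler_addgt0Pr => e e0; rewrite add0r.
  have B1 : 0 < B + 1 by rewrite ltr_wpDl.
  (* The kernel is at most [B / d] on a ball of radius [4 d], so the averaging error is
     [4 B e' <= e / 4]. *)
  pose e' := e / 16 / (B + 1).
  have e'0 : 0 < e' by rewrite !divr_gt0.
  have [ra ra0 Ha] := lebesgue_pt_bound fa lf mf e'0.
  have [rb rb0 Hb] := lebesgue_pt_bound fb lf mf e'0.
  have n0 := ip_ge0 setT g; pose n := ip setT g g + 1.
  have n1 : 0 < n by rewrite ltr_wpDl.
  (* The first two bounds keep [4 d] within the radii of the Lebesgue points; the third makes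
     [6 d n <= (e / 2)^2] in the Cauchy-Schwarz estimate of the smoothing error. *)
  pose d := Num.min (Num.min (ra / 8) (rb / 8)) (e ^+ 2 / 24 / n).
  have d0 : 0 < d by rewrite !lt_min !divr_gt0 ?exprn_gt0.
  have da : 4 * d < ra.
    have : d <= ra / 8 by rewrite !ge_min lexx.
    lra.
  have db : 4 * d < rb.
    have : d <= rb / 8 by rewrite !ge_min lexx orbT.
    lra.
  have dn : d * (24 * n) <= e ^+ 2.
    rewrite -ler_pdivlMr ?mulr_gt0// invfM mulrA.
    by rewrite ge_min lexx orbT.
  have [tchi dchi chi2 _] := Hchi a b d ab d0.
  have tT := test_sub (@subsetT _ _) tchi.
  have := fg _ tT; rewrite (_ : \int[mu]_x (g x * chi a b d x) = ip setT g (chi a b d))//.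
  have i2 := L2_indic a b.
  have chiL2 := H1_L2 (test_H1 tT).
  have -> : chi a b d = \1_`[a, b[ + (chi a b d - \1_`[a, b[) by rewrite addrC subrK.
  rewrite ipDr//; last exact: L2B.
  have -> : ip setT g \1_`[a, b[ = \int[mu]_(x in `[a, b]) g x.
    have gi1 : itg `[a, b[ g.
      by apply: integrableS (lg a b) => //; apply: subset_itvl; rewrite bnd_simp.
    rewrite -(Rintegral_itv_bndo_bndc gi1) Rint_mkcond.
    by apply: eq_Rintegral => x _; rewrite fctE mulrC.
  set er := ip setT g _.
  have er_le : `|er| <= e / 2.
    rewrite -(@ler_pXn2r _ 2)// ?nnegrE ?divr_ge0 ?(ltW e0)// real_normK ?num_real//.
    apply: (le_trans (ip_CS measurableT g2 (L2B chiL2 i2))).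
    apply: (@le_trans _ _ (n * (6 * d))).
      by rewrite ler_pM ?ip_ge0// /n lerDl.
    by rewrite exprMn exprVn; lra.
  have ek c u : u = d^-1 * eta (d^-1 * c) -> 0 <= u <= d^-1 * B.
    move=> ->; have /andP[h1 h2] := etaB (d^-1 * c).
    have dn0 : 0 <= d^-1 by rewrite invr_ge0 ltW.
    by rewrite mulr_ge0//= ler_wpM2l.
  pose k c x := d^-1 * eta (d^-1 * (x - c)).
  have kc c : continuous (k c).
    move=> x; rewrite /k; apply: (@cvgM _ _ _ _ (fun=> d^-1) (fun x => eta (d^-1 * (x - c)))).
      exact: cvg_cst.
    apply: (@continuous_comp _ _ _ (fun x => d^-1 * (x - c)) eta); last exact: ceta.
    apply: (@cvgM _ _ _ _ (fun=> d^-1) (fun x => x - c)); first exact: cvg_cst.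
    by apply: cvgB; [exact: cvg_id|exact: cvg_cst].
  have kz c x : ~ ball c (4 * d) x -> k c x = 0.
    move=> nb; rewrite /k eta0 ?mulr0// => /andP[h1 h2]; apply: nb.
    rewrite ball_itv /= in_itv/=; move: h1 h2.
    rewrite ler_pdivlMl// ler_pdivrMl//; clear -d0; lra.
  have k2 c : L2 (k c).
    apply: (@L2_compact_supp _ _ (`|c| + 4 * d)) => // x xc; apply: kz.
    rewrite ball_itv/= in_itv/= => xx; move: xc; rewrite ltNge => /negP; apply.
    have := ler_normD c (x - c); rewrite addrC subrK => h; apply: (le_trans h).
    by rewrite lerD2l ler_norml; clear -xx; lra.
  have kint c e1 : lebesgue_pt f c ->
      (forall s, 0 < s < e1 -> \int[mu]_(x in ball c s) `|f x - f c| <= e' * s) ->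
      4 * d < e1 -> `|ip setT f (k c) - f c| <= e / 4.
    move=> fc Hc de; have d4 : 0 < 4 * d by rewrite mulr_gt0.
    have mb : measurable (ball c (4 * d) : set R) by exact: measurable_ball.
    have bE : ball c (4 * d) = `]c - 4 * d, c + 4 * d[%classic by rewrite ball_itv.
    have kE : ip setT f (k c) = \int[mu]_(x in ball c (4 * d)) (f * k c) x.
      rewrite Rint_mkcond; apply: eq_Rintegral => x _; rewrite !fctE indicE.
      by case: (boolP (x \in _)) => [_|/negP nb]; rewrite ?mul1r// kz ?mulr0// => bx; apply: nb; rewrite inE.
    have ki : itg (ball c (4 * d)) (f * k c) by exact: L2_itg.
    have k1 : itg (ball c (4 * d)) (k c).
      rewrite bE; apply: integrableS (L2_locint (k2 c) (c - 4 * d) (c + 4 * d)) => //.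
      by apply: subset_itvW; clear -d4; lra.
    have fi : itg (ball c (4 * d)) (f - cst (f c)).
      have i0 : itg `[c - 4 * d, c + 4 * d] (f - cst (f c)).
        by apply: itgB => //; exact: itg_cst_itv.
      by rewrite bE; apply: integrableS i0 => //; apply: subset_itvW; clear -d4; lra.
    have -> : ip setT f (k c) - f c = \int[mu]_(x in ball c (4 * d)) (f * k c - f c *: k c) x.
      by rewrite RintB// ?(RintZ _ _ k1)// ?kE ?eta1 ?mulr1//; exact: itgZ.
    have fki : itg (ball c (4 * d)) (f * k c - f c *: k c) by apply: itgB => //; exact: itgZ.
    apply: (le_trans (Rint_norm_le mb fki)).
    apply: (@le_trans _ _ (\int[mu]_(x in ball c (4 * d)) ((d^-1 * B) *: (Num.norm \o (f - cst (f c)))) x)).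
      apply: le_Rint => //; [exact: itg_norm|by apply: itgZ => //; exact: itg_norm|].
      move=> x _; have -> : (f * k c - f c *: k c) x = (f x - f c) * k c x.
        by rewrite !fctE /GRing.scale/=; ring.
      have /andP[u0 uB] := ek (x - c) _ erefl.
      rewrite normrM mulrC; change (`|k c x| * `|f x - f c| <= d^-1 * B * `|f x - f c|).
      by rewrite ler_wpM2r// ger0_norm.
    rewrite RintZ//; last exact: itg_norm.
    have /= := Hc (4 * d); rewrite d4 => /(_ de) h.
    have dB : 0 <= d^-1 * B by rewrite mulr_ge0// invr_ge0 ltW.
    apply: (le_trans (ler_wpM2l dB h)).
    have -> : d^-1 * B * (e' * (4 * d)) = e / 4 * (B / (B + 1)).
      by rewrite /e'; field; rewrite !gt_eqF.
    rewrite ler_piMr//; first by rewrite divr_ge0// ltW.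
    by rewrite ler_pdivrMr// mul1r lerDl.
  have -> : \int[mu]_x (f x * derive1 (\1_`[a, b[ + (chi a b d - \1_`[a, b[)) x) =
      ip setT f (k a) - ip setT f (k b).
    rewrite -ipBr//; apply: eq_Rintegral => x _; congr (_ * _).
    by rewrite [X in derive1 X](_ : _ = chi a b d) ?dchi// addrC subrK.
  have := kint a ra fa Ha da; have := kint b rb fb Hb db => hb ha h.
  set I := \int[mu]_(x in _) g x in h *.
  have -> : f b - f a - I = er + (ip setT f (k a) - f a) - (ip setT f (k b) - f b) by lra.
  apply: (le_trans (ler_normB _ _)); have := ler_normD er (ip setT f (k a) - f a); lra.
have aef := lebesgue_differentiation (locint_locally mf lf).
have [a0 fa0] := ae_exists aef.
pose F := G + cst (f a0 - G a0).
have fF : \forall x \ae mu, f x = F x.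
  apply: filterS aef; first exact: (ae_filter_ringOfSetsType mu).
  move=> x fx; rewrite /F fctE; have [xa|/ltW xa] := leP a0 x.
    by have := key _ _ xa fa0 fx; rewrite /cst; lra.
  by have := key _ _ xa fx fa0; rewrite /cst; lra.
have pF : prim F g.
  apply: prim_intro => // a b ab; rewrite /F !fctE -Ge//; ring.
have [cF _ _] := pF.
exists F => //; split=> //.
have mF : measurable_fun setT F := continuous_measurable_fun cF.
split=> //; have -> : (\int[mu]_x ((F x) ^+ 2)%:E = \int[mu]_x ((f x) ^+ 2)%:E)%E.
  apply: ae_eq_integral => //.
  - by apply/measurable_EFinP; apply: measurable_funX.
  - by apply/measurable_EFinP; apply: measurable_funX.
  - apply: filterS fF; first exact: (ae_filter_ringOfSetsType mu).
    by move=> x ->.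
by case: f2.
Qed.

End DuBoisReymond.

(** * Density of test functions in L^2 of the half-line *)

Section Density.
Context {R : realType}.
Local Notation mu := (@lebesgue_measure R).
Local Notation itg D f := (mu.-integrable D (EFin \o f)).
Implicit Types (f g phi psi : R -> R) (a b e x : R).
Local Notation Rp := (@Rplus R).

Lemma measurable_Rplus : measurable (Rp : set R).
Proof.
have -> : Rp = `]0, +oo[%classic by apply/seteqP; split=> x /=; rewrite in_itv/= andbT.
exact: measurable_itv.
Qed.

Definition approximable f := L2 f /\ forall e, 0 < e ->
  exists2 phi, test_fun Rp phi & ip Rp (f - phi) (f - phi) <= e ^+ 2.

Lemma approximable_indic c a b : 0 < a -> a <= b -> approximable (c *: \1_`[a, b[).
Proof.
move=> a0 ab; split; first by apply: L2Z; exact: L2_indic.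
move=> e e0; have [eta [B [chi [_ _ _ _ H]]]] := @smooth_indic_exists R.
have c1 : 0 < 6 * (c ^+ 2 + 1) by rewrite mulr_gt0// ltr_wpDl// sqr_ge0.
pose d := e ^+ 2 / (6 * (c ^+ 2 + 1)).
have d0 : 0 < d by rewrite divr_gt0// exprn_gt0.
have [tchi _ chi2 _] := H a b d ab d0.
have tR : test_fun Rp (chi a b d).
  apply: test_sub tchi => x /=; rewrite in_itv/= => /andP[ax _].
  exact: lt_le_trans ax.
exists (c *: chi a b d); first exact: testZ.
have i2 := @L2_indic R a b; have t2 := H1_L2 (test_H1 tR).
have d2 : L2 (chi a b d - \1_`[a, b[) by exact: L2B.
have -> : c *: \1_`[a, b[ - c *: chi a b d = (- c) *: (chi a b d - \1_`[a, b[).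
  by apply/funext => x; rewrite !fctE /GRing.scale/=; ring.
have d2' := L2Z (- c) d2; have mR := measurable_Rplus.
rewrite ipZl// ipZr// mulrA mulrNN.
have := ip_leT mR d2; have := ip_ge0 Rp (chi a b d - \1_`[a, b[).
set u := ip Rp _ _; set v := ip setT _ _ in chi2 * => u0 uv.
have : d * (6 * (c ^+ 2 + 1)) = e ^+ 2 by rewrite /d divfK// gt_eqF.
have c2 := sqr_ge0 c; rewrite -expr2; nra.
Qed.

Lemma approximableD f g : approximable f -> approximable g -> approximable (f + g).
Proof.
move=> [f2 Hf] [g2 Hg]; split; first exact: L2D.
move=> e e0; have e2 : 0 < e / 2 by rewrite divr_gt0.
have [p tp fp] := Hf _ e2; have [q tq gq] := Hg _ e2.
exists (p + q); first exact: testD.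
have -> : f + g - (p + q) = (f - p) + (g - q) by ring.
have p2 := H1_L2 (test_H1 tp); have q2 := H1_L2 (test_H1 tq).
have := ip_triangle measurable_Rplus (L2B f2 p2) (L2B g2 q2) (ltW e2) (ltW e2) fp gq.
by rewrite -splitr.
Qed.

(** Cut off a neighbourhood of the boundary and of infinity, approximate by a step function in
    between, then smooth each step. Only an L^2 error is measured, so [psi] may have any boundary
    value. *)
Lemma test_dense psi e : continuous psi -> L2 psi -> 0 < e ->
  exists2 phi, test_fun Rp phi & ip Rp (psi - phi) (psi - phi) <= e ^+ 2.
Proof.
move=> cpsi psi2 e0.
(* The squared error of the step function has three parts, near the boundary, on [[A, B[] and at
   infinity, each at most [E]. The other [e / 2] pays for the smoothing. *)
have E0 : 0 < (e / 2) ^+ 2 / 3 by rewrite divr_gt0// exprn_gt0// divr_gt0.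
set E := (e / 2) ^+ 2 / 3 in E0.
have [N N0 HN] := itg_tail (L2_sqr psi2) E0.
have [M M0 HM] := continuous_bounded_itv 0 1 cpsi.
have MM : 0 < M ^+ 2 by rewrite exprn_gt0.
pose A := Num.min 1 (E / M ^+ 2).
have A0 : 0 < A by rewrite lt_min ltr01 divr_gt0.
have A1 : A <= 1 by rewrite ge_min lexx.
have AM : A * M ^+ 2 <= E by rewrite -ler_pdivlMr// ge_min lexx orbT.
pose B := N + 1 + 1.
have AB : A <= B by rewrite /B; lra.
have NB : N < B by rewrite /B; lra.
pose eta := Num.min 1 (E / (B + 1)).
have B1 : 0 < B + 1 by rewrite /B; lra.
have eta0 : 0 < eta by rewrite lt_min ltr01 divr_gt0.
have eta1 : eta <= 1 by rewrite ge_min lexx.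
have etaB : eta * (B + 1) <= E by rewrite -ler_pdivlMr// ge_min lexx orbT.
(* A uniform approximation on [[A, x[], lengthened one step at a time by [real_induction], using
   continuity at a single point for each step. *)
pose Q x := exists s, [/\ approximable s, forall t, A <= t < x -> `|psi t - s t| <= eta &
  forall t, ~ (A <= t < x) -> s t = 0].
have ext x y c : A <= x -> x <= y -> Q x ->
    (forall t, x <= t < y -> `|psi t - c| <= eta) -> Q y.
  move=> Ax xy [s [sa s1 s0]] H; exists (s + c *: \1_`[x, y[); split.
  - by apply: approximableD => //; apply: approximable_indic => //; exact: lt_le_trans Ax.
  - move=> t /andP[At ty]; rewrite !fctE /GRing.scale/= indicE.
    have [tx|xt] := ltP t x.
      rewrite memNset ?mulr0 ?addr0 ?s1 ?At//= in_itv/=; lra.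
    by rewrite s0 ?add0r ?mem_set ?mulr1 ?H ?xt//= ?in_itv/= ?xt//; lra.
  - move=> t nt; rewrite !fctE /GRing.scale/= indicE s0 ?add0r; last lra.
    by rewrite memNset ?mulr0//= in_itv/=; lra.
have near x : exists2 d, 0 < d & forall t, `|x - t| < d -> `|psi t - psi x| <= eta.
  have /cvgrPdist_le /(_ eta eta0) [d /= d0 H] := cpsi x.
  by exists d => // t xt; rewrite distrC; exact: H.
have QA : forall x, A <= x -> Q x.
  apply: real_induction.
  (* The zero function, written as a multiple of an admissible indicator. *)
  - exists (0 *: \1_`[1, 1[); split.
    + exact: approximable_indic.
    + by move=> t; lra.
    + by move=> t _; rewrite fctE /GRing.scale/= mul0r.
  - move=> x Ax IH; have [d d0 H] := near x; exists d => // y /andP[xy yd].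
    apply: (ext x y (psi x)); [exact: Ax|exact: ltW|by apply: IH; rewrite Ax lexx|].
    by move=> t /andP[xt ty]; apply: H; rewrite ler0_norm; clear -xt ty yd; lra.
  - move=> x Ax IH; have [d d0 H] := near x.
    pose y := Num.max A (x - d / 2).
    have yA : A <= y by rewrite le_max lexx.
    have yd : x - d / 2 <= y by rewrite le_max lexx orbT.
    have yx : y < x by rewrite gt_max Ax; clear -d0; lra.
    apply: (ext y x (psi x)); [exact: yA|exact: ltW|by apply: IH; rewrite yA|].
    by move=> t /andP[yt tx]; apply: H; rewrite ger0_norm; clear -d0 yt tx yd; lra.
have [s [[s2 Hs] s1 s0]] := QA B AB.
have e2 : 0 < e / 2 by rewrite divr_gt0.
have [phi tphi sphi] := Hs _ e2; exists phi => //.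
have p2 := H1_L2 (test_H1 tphi); have d2 := L2B psi2 s2.
have -> : psi - phi = (psi - s) + (s - phi) by ring.
have := ip_triangle measurable_Rplus d2 (L2B s2 p2) (ltW e2) (ltW e2) _ sphi.
rewrite -splitr; apply.
have mB : measurable (`[B, +oo[%classic : set R) by exact: measurable_itv.
have i2 : itg setT (\1_`[B, +oo[ * (psi * psi)).
  rewrite mulrA; apply: L2_itgM => //; exact: L2_restr.
pose k := M ^+ 2 *: (\1_`[0, A[ : R -> R) + eta *: (\1_`[A, B[ : R -> R) + \1_`[B, +oo[ * (psi * psi).
have k1 : itg setT (M ^+ 2 *: (\1_`[0, A[ : R -> R)) by apply: itgZ => //; exact: itg_indic.
have k2 : itg setT (eta *: (\1_`[A, B[ : R -> R)) by apply: itgZ => //; exact: itg_indic.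
have ki : itg setT k by apply: itgD => //; exact: itgD.
have k0 x : 0 <= k x.
  rewrite /k !fctE /GRing.scale/= !indicE.
  apply: addr_ge0; last by rewrite mulr_ge0 ?ler0n// -expr2 sqr_ge0.
  by apply: addr_ge0; rewrite mulr_ge0 ?ler0n// ltW.
apply: (@le_trans _ _ (\int[mu]_(x in Rp) k x)).
  apply: le_Rint => //; [exact: measurable_Rplus|exact: (L2_itg measurable_Rplus d2 d2)|
    by apply: itgS => //; exact: measurable_Rplus|].
  move=> x x0; rewrite /k !fctE /GRing.scale/= !indicE !mem_setE !in_itv/=.
  have := sqr_ge0 (psi x); rewrite expr2 => px.
  rewrite (ltW x0)/= andbT; have [xA|Ax] := ltP x A.
    rewrite [B <= x]leNgt (lt_le_trans xA AB)/= s0; last by rewrite leNgt xA.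
    have := HM x; rewrite (ltW x0) (ltW (lt_le_trans xA A1)) => /(_ isT).
    rewrite ler_norml => /andP[? ?]; nra.
  have [xB|Bx] := ltP x B; last first.
    by rewrite s0 ?subr0/=; [nra|rewrite ltNge Bx andbF].
  have := s1 x; rewrite Ax xB => /(_ isT); rewrite ler_norml/= => /andP[? ?]; nra.
apply: (le_trans (Rint_subset measurable_Rplus measurableT (@subsetT _ _) ki k0)).
rewrite RintD//; last exact: itgD.
rewrite RintD// (RintZ _ _ (@itg_indic _ _ _))// (RintZ _ _ (@itg_indic _ _ _))//.
rewrite (Rint_indic (ltW A0)) (Rint_indic AB) -Rint_mkcond subr0.
have h3 : \int[mu]_(x in `[B, +oo[) (psi * psi) x < E.
  have := HN `[B, +oo[%classic mB; rewrite (_ : Rintegral _ _ _ = \int[mu]_(x in `[B, +oo[) (psi * psi) x).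
    by apply=> x /=; rewrite in_itv/= andbT => Bx; apply: lt_le_trans (ler_norm x); exact: lt_le_trans NB Bx.
  by apply: eq_Rintegral => x _; rewrite ger0_norm// fctE -expr2 sqr_ge0.
have : eta * (B - A) <= E by nra.
have -> : (e / 2) ^+ 2 = E + E + E by rewrite /E; field.
by move: h3; set I := Rintegral _ _ _; lra.
Qed.

(** This lets an estimate known on test functions be applied to [u] and to [u_xx + u^2], which are
    not compactly supported in the open half-line. *)
Lemma test_dual_bound Z psi (K : R) : L2 Z -> continuous psi -> L2 psi -> 0 <= K ->
  (forall phi, test_fun Rp phi -> forall A, 0 <= A -> ip Rp phi phi <= A ^+ 2 ->
     `|ip Rp Z phi| <= K * A) ->
  forall A, 0 <= A -> ip Rp psi psi <= A ^+ 2 -> `|ip Rp Z psi| <= K * A.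
Proof.
move=> Z2 cpsi psi2 K0 H A A0 psiA; have mR := measurable_Rplus.
apply/ler_addgt0Pr => eps eps0.
have z0 := ip_ge0 Rp Z.
have L0 : 0 < K + (ip Rp Z Z + 1) by lra.
pose d := eps / (K + (ip Rp Z Z + 1)).
have d0 : 0 < d by rewrite divr_gt0.
have [phi tphi pd] := test_dense cpsi psi2 d0.
have p2 := H1_L2 (test_H1 tphi); have d2 := L2B psi2 p2.
have -> : psi = phi + (psi - phi) by rewrite addrC subrK.
rewrite ipDr// (le_trans (ler_normD _ _))//.
have pA : ip Rp phi phi <= (A + d) ^+ 2.
  have -> : phi = psi + (phi - psi) by rewrite addrC subrK.
  apply: ip_triangle => //; [exact: L2B|exact: ltW|].
  rewrite -opprB ipNl ?ipNr ?opprK//; exact: L2N.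
have h1 : `|ip Rp Z phi| <= K * (A + d) by apply: H => //; rewrite addr_ge0// ltW.
have h2 : `|ip Rp Z (psi - phi)| <= (ip Rp Z Z + 1) * d.
  apply: ip_CS_bd => //; [lra|exact: ltW|].
  by rewrite expr2; nra.
have : d * (K + (ip Rp Z Z + 1)) = eps by rewrite /d divfK// gt_eqF.
lra.
Qed.

End Density.

(** * From restriction norms to pairs of a function and its derivative *)

Section SobolevNorms.
Context {R : realType}.
Local Notation mu := (@lebesgue_measure R).
Implicit Types (f g F G : R -> R) (e x : R).
Local Notation Rp := (@Rplus R).

Lemma L2_ipE f : L2 f -> (\int[mu]_x ((f x) ^+ 2)%:E)%E = (ip setT f f)%:E.
Proof.
move=> f2; rewrite /ip /Rintegral fineK//.
exact: (integrable_fin_num _ (L2_itgM f2 f2)).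
Qed.

Lemma Hk_plus_chain k f e : (Hk_plus_norm k f < e%:E)%E ->
  exists d, [/\ weak_deriv_chain k (d 0%N) d, ae_eq mu Rp (d 0%N) f, 0 < e &
    \sum_(j < k.+1) ip setT (d j) (d j) < e ^+ 2].
Proof.
move=> /ereal_inf_lt[_ [g [mg gf] <-]] /ereal_inf_lt[_ [d chd <-]] dlt.
have [d0 dL2 dw] := chd; exists d; subst g; split => //.
  rewrite -lte_fin; apply: le_lt_trans dlt; exact: sqrte_ge0.
have {}dlt : (\sum_(j < k.+1) \int[mu]_x ((d j x) ^+ 2)%:E < (e ^+ 2)%:E)%E.
  have -> : (e ^+ 2)%:E = ((e%:E) ^+ 2)%E by [].
  have s0 : (0 <= \sum_(j < k.+1) \int[mu]_x ((d j x) ^+ 2)%:E)%E.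
    by apply: sume_ge0 => j _; apply: integral_ge0 => x _; rewrite lee_fin sqr_ge0.
  rewrite -[ltLHS]sqr_sqrte// lte_sqr ?sqrte_ge0//.
  by apply: ltW; apply: le_lt_trans dlt; exact: sqrte_ge0.
move: dlt; rewrite (eq_bigr (fun j : 'I_k.+1 => (ip setT (d j) (d j))%:E)).
  by rewrite sumEFin lte_fin.
by move=> j _; rewrite L2_ipE//; apply: dL2; rewrite -ltnS.
Qed.

(** Needed to link successive derivatives: the continuous representative that [weak_H1] gives for
    one derivative has to serve as the derivative of the preceding function. *)
Lemma H1_aed F G G' : H1 F G -> L2 G' -> (\forall x \ae mu, G x = G' x) -> H1 F G'.
Proof.
move=> FG G2' GG; have [F2 G2 [cF lG Fe]] := FG; split=> //.
have lG' := L2_locint G2'; split=> // a b ab; rewrite Fe// /Rintegral; congr fine.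
apply: ae_eq_integral => //.
- exact: measurable_int (lG a b).
- exact: measurable_int (lG' a b).
- apply: filterS GG; first exact: (ae_filter_ringOfSetsType mu).
  by move=> x -> .
Qed.

Lemma ae_filterS (P Q : R -> Prop) : (forall x, P x -> Q x) ->
  (\forall x \ae mu, P x) -> \forall x \ae mu, Q x.
Proof. by move=> PQ; apply: filterS PQ; exact: (ae_filter_ringOfSetsType mu). Qed.

Lemma ae_filterS2 (P Q S : R -> Prop) : (forall x, P x -> Q x -> S x) ->
  (\forall x \ae mu, P x) -> (\forall x \ae mu, Q x) -> \forall x \ae mu, S x.
Proof. by move=> PQ; apply: filterS2 PQ; exact: (ae_filter_ringOfSetsType mu). Qed.

Lemma ae_eq_ip f g : L2 f -> L2 g -> (\forall x \ae mu, f x = g x) ->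
  ip setT f f = ip setT g g.
Proof.
move=> f2 g2 fg; rewrite /ip /Rintegral; congr fine; apply: ae_eq_integral => //.
- exact: measurable_int (L2_itgM f2 f2).
- exact: measurable_int (L2_itgM g2 g2).
- by apply: ae_filterS fg => x -> .
Qed.

(** A null set contains no interval, and points to the right of [x] suffice for the comparison, so
    that the trace at 0 is recovered too. *)
Lemma ae_eq_right f F : {within `[0, +oo[, continuous f} -> continuous F ->
  (\forall x \ae mu, Rp x -> F x = f x) -> forall x, 0 <= x -> F x = f x.
Proof.
move=> cf cF [N [mN N0 FN]] x x0; apply/eqP; rewrite eq_sym -subr_eq0.
apply/negP => /negP fx; set D := f x - F x in fx.
have D2 : 0 < `|D| / 2 by rewrite divr_gt0// normr_gt0.
have x0' : `[0, +oo[%classic x by rewrite /= in_itv/= x0.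
have := (@subspace_continuousP _ _ _ f).1 cf x x0' => /cvgrPdist_lt /(_ _ D2).
rewrite near_withinE => -[d1 /= d10 H1].
have /cvgrPdist_lt /(_ _ D2) [d2 /= d20 H2] := cF x.
pose d := Num.min d1 d2; have d0 : 0 < d by rewrite lt_min d10.
have sub : `[x + d / 3, x + d / 2] `<=` N.
  move=> y /=; rewrite in_itv/= => /andP[y1 y2]; apply: FN => /= H.
  have y0 : 0 < y by lra.
  have yd1 : `|x - y| < d1.
    have : d <= d1 by rewrite ge_min lexx.
    rewrite ler0_norm; lra.
  have yd2 : `|x - y| < d2.
    have : d <= d2 by rewrite ge_min lexx orbT.
    rewrite ler0_norm; lra.
  have h1 : `|f x - f y| < `|D| / 2 by apply: H1 => //=; rewrite in_itv/= ltW.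
  have h2 : `|F x - F y| < `|D| / 2 by apply: H2.
  have := H y0 => e; have : `|D| <= `|f x - f y| + `|F x - F y|.
    rewrite (_ : D = (f x - f y) - (F x - F y)) ?ler_normB// /D e; ring.
  lra.
have : mu `[x + d / 3, x + d / 2] = 0%E by apply: subset_measure0 N0.
rewrite mu_itv; last lra.
move=> [] ; lra.
Qed.

Lemma Hk_plus1_H1 f e : {within `[0, +oo[, continuous f} ->
  (Hk_plus_norm 1 f < e%:E)%E -> exists F G, [/\ H1 F G, 0 < e,
    forall x, 0 <= x -> F x = f x & ip setT F F + ip setT G G < e ^+ 2].
Proof.
move=> cf /Hk_plus_chain[d [[_ dL2 dw] d0f e0 dsum]].
have [F FG dF] := weak_H1 (dL2 0%N isT) (dL2 1%N isT) (dw 0%N isT).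
exists F, (d 1%N); split=> //.
  apply: ae_eq_right => //; first exact: H1_cont FG.
  by apply: ae_filterS2 d0f dF => x h1 <- /h1.
by move: dsum; rewrite !big_ord_recl big_ord0 addr0 /= -(ae_eq_ip (dL2 0%N isT) (H1_L2 FG)).
Qed.

Lemma Hk_plus3_H1 f e : {within `[0, +oo[, continuous f} ->
  (Hk_plus_norm 3 f < e%:E)%E -> exists F0 F1 F2 F3,
  [/\ [/\ H1 F0 F1, H1 F1 F2 & H1 F2 F3], 0 < e,
    forall x, 0 <= x -> F0 x = f x &
    ip setT F0 F0 + ip setT F1 F1 + ip setT F2 F2 + ip setT F3 F3 < e ^+ 2].
Proof.
move=> cf /Hk_plus_chain[d [[_ dL2 dw] d0f e0 dsum]].
have [F0 FG0 dF0] := weak_H1 (dL2 0%N isT) (dL2 1%N isT) (dw 0%N isT).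
have [F1 FG1 dF1] := weak_H1 (dL2 1%N isT) (dL2 2%N isT) (dw 1%N isT).
have [F2 FG2 dF2] := weak_H1 (dL2 2%N isT) (dL2 3%N isT) (dw 2%N isT).
have F01 := H1_aed FG0 (H1_L2 FG1) dF1.
have F12 := H1_aed FG1 (H1_L2 FG2) dF2.
exists F0, F1, F2, (d 3%N); split=> //.
  apply: ae_eq_right => //; first exact: H1_cont F01.
  by apply: ae_filterS2 d0f dF0 => x h1 <- /h1.
move: dsum; rewrite !big_ord_recl big_ord0 addr0 /= !addrA.
rewrite -(ae_eq_ip (dL2 0%N isT) (H1_L2 F01) dF0) -(ae_eq_ip (dL2 1%N isT) (H1_L2 F12) dF1).
by rewrite -(ae_eq_ip (dL2 2%N isT) (H1_L2 FG2) dF2).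
Qed.

Lemma H1_Hk_plus F G f (A : R) : H1 F G -> (forall x, 0 < x -> F x = f x) -> 0 <= A ->
  ip setT F F + ip setT G G <= A ^+ 2 -> (Hk_plus_norm 1 f <= A%:E)%E.
Proof.
move=> FG Ff A0 HA; have [F2 G2 pF] := FG.
apply: (@le_trans _ _ (Hk_norm 1 F)).
  apply: ereal_inf_lbound; exists F => //; split; first exact: L2_meas.
  by apply: aeW => /= x; exact: Ff.
apply: ereal_inf_le; pose d j := if j is 0%N then F else if j is 1%N then G else 0.
exists (sqrte (\sum_(j < 2) \int[mu]_x ((d j x) ^+ 2)%:E)%E).
  exists d => //; split=> //.
  - by case=> [|[|]].
  - by case=> //= _; exact: H1_weak.
rewrite -[leRHS]gee0_abs ?lee_fin// -sqrte_sqr lee_sqrt; last by rewrite -EFin_expe lee_fin sqr_ge0.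
by rewrite !big_ord_recl big_ord0 adde0 /= !L2_ipE.
Qed.

End SobolevNorms.

(** * Monotonicity of mass and energy *)

Section Functionals.
Context {R : realType}.
Implicit Types (f g F G phi : R -> R) (e x : R).
Local Notation Rp := (@Rplus R).
Local Notation T := [set: R].

Definition nrm2 f g := ip T f f + ip T g g.
(** The Hamiltonian of the equation, [g] standing for the derivative of [f]. *)
Definition energy f g := ip T g g / 2 - ip T (f * f) f / 3.

Lemma nrm2_ge0 f g : 0 <= nrm2 f g.
Proof. by rewrite addr_ge0 ?ip_ge0. Qed.

Lemma ip_cubic_bound D f h (A : R) : measurable D -> measurable_fun setT f -> L2 h -> 0 <= A ->
  (forall x, `|f x| <= A) -> `|ip D (f * h) h| <= A * ip D h h.
Proof.
move=> mD mf h2 A0 fA; have fh := L2_bdM mf fA h2.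
rewrite ler_norml -mulNr -!ipZl//; apply/andP; split; apply: ip_le => //; try exact: L2Z.
- move=> x _; rewrite !fctE /GRing.scale/=; have := fA x; rewrite ler_norml => /andP[].
  by have := sqr_ge0 (h x); rewrite expr2; nra.
- move=> x _; rewrite !fctE /GRing.scale/=; have := fA x; rewrite ler_norml => /andP[].
  by have := sqr_ge0 (h x); rewrite expr2; nra.
Qed.

Lemma ip_sqr_bound D f h (A : R) : measurable D -> measurable_fun setT f -> L2 h -> 0 <= A ->
  (forall x, `|f x| <= A) -> ip D (f * h) (f * h) <= A ^+ 2 * ip D h h.
Proof.
move=> mD mf h2 A0 fA; have fh := L2_bdM mf fA h2.
rewrite -ipZl//; apply: ip_le => //; first exact: L2Z.
move=> x _; rewrite !fctE /GRing.scale/=.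
have h0 := sqr_ge0 (h x); have : f x ^+ 2 <= A ^+ 2.
  by rewrite -real_normK ?num_real// ler_pXn2r ?nnegrE.
move: h0; rewrite !expr2; nra.
Qed.

Lemma cubic_expand D f h : measurable D -> measurable_fun setT f -> measurable_fun setT h ->
  L2 f -> L2 h -> L2 (f * f) -> L2 (f * h) -> L2 (h * h) ->
  ip D ((f + h) * (f + h)) (f + h) =
  ip D (f * f) f + 3 * ip D (f * f) h + 3 * ip D (f * h) h + ip D (h * h) h.
Proof.
move=> mD mf mh f2 h2 ff fh hh.
have -> : (f + h) * (f + h) = f * f + 2 *: (f * h) + h * h.
  by apply/funext => x; rewrite !fctE /GRing.scale/=; ring.
have fh' := L2Z 2 fh; have s1 := L2D ff fh'; have s2 := L2D f2 h2.
rewrite ipDl// ipDl// !ipDr// !ipZl//.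
have -> : ip D (f * h) f = ip D (f * f) h by apply: eq_ip_mul => x _; rewrite !fctE; ring.
have -> : ip D (h * h) f = ip D (f * h) h by apply: eq_ip_mul => x _; rewrite !fctE; ring.
ring.
Qed.

Lemma energy_diff f g : H1 f g -> exists2 C, 0 <= C & forall f' g' e, H1 f' g' ->
  0 <= e <= 1 -> nrm2 (f' - f) (g' - g) <= e ^+ 2 ->
  `|ip T f' f' - ip T f f| <= C * e /\ `|energy f' g' - energy f g| <= C * e.
Proof.
move=> fg; have [f2 g2 _] := fg; pose B := nrm2 f g + 1.
have n0 := nrm2_ge0 f g; have B1 : 1 <= B by rewrite lerDr.
have nB : nrm2 f g <= B ^+ 2 by rewrite /B expr2; nra.
have fB : ip T f f <= B ^+ 2 by apply: le_trans nB; rewrite lerDl ip_ge0.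
have gB : ip T g g <= B ^+ 2 by apply: le_trans nB; rewrite lerDr ip_ge0.
have B0 : 0 <= B by lra.
have fsup x : `|f x| <= B by exact: (H1_sup_bd x fg).
exists (2 * B + B ^+ 2 + B + 3); first by rewrite expr2; nra.
move=> f' g' e fg' /andP[e0 e1] He.
have hk : H1 (f' - f) (g' - g) by exact: H1B.
set h := f' - f in He hk; set k := g' - g in He hk.
have [h2 k2 _] := hk.
have hE : ip T h h <= e ^+ 2 by apply: le_trans He; rewrite lerDl ip_ge0.
have kE : ip T k k <= e ^+ 2 by apply: le_trans He; rewrite lerDr ip_ge0.
have hsup x : `|h x| <= e by exact: (H1_sup_bd x hk).
have -> : f' = f + h by rewrite /h addrC subrK.
have -> : g' = g + k by rewrite /k addrC subrK.
have fh := ip_CS_bd measurableT f2 h2 B0 e0 fB hE.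
have gk := ip_CS_bd measurableT g2 k2 B0 e0 gB kE.
have h0 := ip_ge0 T h; have k0 := ip_ge0 T k.
have ee : e ^+ 2 <= e by rewrite expr2; nra.
have mf := L2_meas f2; have mh := L2_meas h2.
rewrite ip_sqrD//; split.
  move: fh; rewrite !ler_norml => /andP[p1 p2].
  have q1 : 0 <= B ^+ 2 * e by rewrite mulr_ge0// sqr_ge0.
  have q2 : 0 <= B * e by rewrite mulr_ge0.
  by apply/andP; split; lra.
have ff := L2_H1M fg f2; have ffh := L2_H1M fg h2; have hh := L2_H1M hk h2.
rewrite /energy ip_sqrD// cubic_expand//.
have c1 := ip_cubic_bound measurableT mf h2 B0 fsup.
have c2 := ip_cubic_bound measurableT mh h2 e0 hsup.
have c3 : `|ip T (f * f) h| <= B * B * e.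
  apply: ip_CS_bd => //; first by rewrite mulr_ge0.
  apply: (le_trans (ip_sqr_bound measurableT mf f2 B0 fsup)).
  by rewrite exprMn ler_wpM2l// sqr_ge0.
move: gk c1 c2 c3; rewrite !ler_norml.
move=> /andP[g1' g2'] /andP[r1 r2] /andP[r3 r4] /andP[r5 r6].
have q2 : 0 <= B * e by rewrite mulr_ge0.
have he : ip T h h <= e by exact: le_trans ee.
have ke : ip T k k <= e by exact: le_trans ee.
have Be : B * ip T h h <= B * e by rewrite ler_wpM2l.
have Bee : e * ip T h h <= 1 * e by rewrite ler_pM.
have B2 : B ^+ 2 * e = B * B * e by rewrite expr2.
have q3 : 0 <= B * B * e by rewrite -B2 mulr_ge0// sqr_ge0.
by apply/andP; split; lra.
Qed.

Lemma RplusE : Rp = `]0, +oo[%classic.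
Proof. by apply/seteqP; split=> x /=; rewrite in_itv/= andbT. Qed.

Lemma ibp_Rplus F G F' G' : H1 F G -> H1 F' G' ->
  ip Rp G F' + ip Rp F G' = - (F 0 * F' 0).
Proof. by rewrite RplusE; exact: H1_ibp_right. Qed.

Lemma test_Rplus0 phi : test_fun Rp phi -> phi 0 = 0.
Proof. by move=> [_ [K [_ KR z]]]; apply: z => /KR; rewrite /Rplus/= ltxx. Qed.

Lemma ibp_test F G phi : H1 F G -> test_fun Rp phi ->
  ip Rp F (derive1 phi) = - ip Rp G phi.
Proof.
move=> FG tp; have := ibp_Rplus FG (test_H1 tp).
by rewrite (test_Rplus0 tp) mulr0; lra.
Qed.

(** [N = F3 + 2 F0 F1] is minus the velocity of the flow, and also the derivative of
    [P = F2 + F0^2]. Integration by parts leaves only boundary terms: the pairing of [N] with [F0]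
    is [F1(0)^2 / 2], that with [P] is [- P(0)^2 / 2]. *)
Lemma kdv_dissipation F0 F1 F2 F3 : H1 F0 F1 -> H1 F1 F2 -> H1 F2 F3 -> F0 0 = 0 ->
  0 <= ip Rp (F3 + 2 *: (F0 * F1)) F0 /\
  ip Rp (F3 + 2 *: (F0 * F1)) (F2 + F0 * F0) <= 0.
Proof.
move=> F01 F12 F23 z; have mR := measurable_Rplus; split.
- have [a2 b2 _] := F01; have [_ c2 _] := F12; have [_ d2 _] := F23.
  have ab := L2_H1M F01 b2; rewrite ipDl//; last exact: L2Z.
  rewrite ipZl//; have := ibp_Rplus F23 F01; have := ibp_Rplus F12 F12.
  have := ibp_Rplus (H1M F01 F01) F01.
  have ba : L2 (F1 * F0) by rewrite mulrC.
  rewrite ipDl// z !mulr0 !oppr0.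
  have -> : F1 * F0 = F0 * F1 by rewrite mulrC.
  have -> : ip Rp (F0 * F0) F1 = ip Rp (F0 * F1) F0.
    by apply: eq_ip_mul => x _; rewrite !fctE; ring.
  rewrite [ip Rp F1 F2]ipC => h1 h2 h3; have := sqr_ge0 (F1 0); rewrite expr2; lra.
- have H : H1 (F2 + F0 * F0) (F3 + 2 *: (F0 * F1)).
    have -> : 2 *: (F0 * F1) = F1 * F0 + F0 * F1.
      by apply/funext => x; rewrite !fctE /GRing.scale/=; ring.
    by apply: H1D => //; exact: H1M.
  have := ibp_Rplus H H; rewrite [ip Rp (F2 + _) _]ipC.
  by have := sqr_ge0 ((F2 + F0 * F0) 0); rewrite expr2; lra.
Qed.

End Functionals.

(** * Mass and energy over one small time step *)

Section KdVStep.
Context {R : realType}.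
Implicit Types (f g F G phi : R -> R) (e x : R).
Local Notation Rp := (@Rplus R).
Local Notation T := [set: R].

Lemma ip_bdM_CS f h phi (A B M : R) : measurable_fun setT f -> L2 h -> L2 phi ->
  0 <= M -> 0 <= A -> 0 <= B -> (forall x, `|f x| <= M) -> ip Rp h h <= A ^+ 2 ->
  ip Rp phi phi <= B ^+ 2 -> `|ip Rp (f * h) phi| <= M * A * B.
Proof.
move=> mf h2 p2 M0 A0 B0 fM hA pB; have mR := @measurable_Rplus R.
have fh := L2_bdM mf fM h2.
have MA0 : 0 <= M * A by rewrite mulr_ge0.
apply: (ip_CS_bd mR fh p2 MA0 B0 _ pB).
apply: (le_trans (ip_sqr_bound mR mf h2 M0 fM)).
by rewrite exprMn ler_wpM2l// sqr_ge0.
Qed.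

(* [e0] is the increment of the solution over a time [h]; by the mean value theorem
   the weak equation holds at an intermediate time, depending on [phi], where the
   solution is [F0 + k0]. *)
Definition kdv_increment F0 F1 F3 (eta h : R) (e0 : R -> R) :=
  forall phi, test_fun Rp phi -> exists k0 k1 k3,
  [/\ H1 k0 k1, L2 k3, nrm2 k0 k1 + ip T k3 k3 <= eta ^+ 2 &
   ip Rp e0 phi = - h * ip Rp ((F3 + k3) + 2 *: ((F0 + k0) * (F1 + k1))) phi].

(** The intermediate time depends on the test function, but replacing the state there by [F0] costs
    at most [eta (4 C + 3)] in the dual norm whatever that time is: [eta] from [k3], [2 C eta] from
    each mixed product and [2 eta] from [k0 k1]. A bound uniform in [phi] then extends by
    density. *)
Lemma kdv_increment_dual F0 F1 F2 F3 (C eta h : R) (e0 e1 : R -> R) :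
  H1 F0 F1 -> H1 F1 F2 -> H1 F2 F3 -> H1 e0 e1 ->
  0 <= C -> nrm2 F0 F1 <= C ^+ 2 -> 0 <= eta <= 1 -> 0 <= h ->
  kdv_increment F0 F1 F3 eta h e0 ->
  forall psi A, continuous psi -> L2 psi -> 0 <= A -> ip Rp psi psi <= A ^+ 2 ->
  `|ip Rp (e0 + h *: (F3 + 2 *: (F0 * F1))) psi| <= h * (eta * (4 * C + 3)) * A.
Proof.
move=> F01 F12 F23 e01 C0 FC /andP[eta0 eta1] h0 inc psi A cpsi psi2 A0 psiA.
have mR := @measurable_Rplus R.
have [a2 b2 _] := F01; have [_ d2 _] := F23; have [z2 _ _] := e01.
have ab := L2_H1M F01 b2; have N2 := L2D d2 (L2Z 2 ab).
apply: (@test_dual_bound R _ psi) => //; first by apply: L2D => //; exact: L2Z.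
  by rewrite mulr_ge0// mulr_ge0//; lra.
move=> phi tphi B B0 phiB; have [k0 [k1 [k3 [k01 k32 kE eq]]]] := inc phi tphi.
have p2 := H1_L2 (test_H1 tphi).
have [k02 k12 _] := k01.
rewrite ipDl//; last exact: L2Z.
rewrite (ipZl h mR N2 p2) eq.
have kk := L2_H1M k01 k12; have fk := L2_H1M F01 k12; have kf := L2_H1M k01 b2.
have -> : F3 + k3 + 2 *: ((F0 + k0) * (F1 + k1)) =
    (F3 + 2 *: (F0 * F1)) + (k3 + 2 *: (F0 * k1) + 2 *: (k0 * F1) + 2 *: (k0 * k1)).
  by apply/funext => x; rewrite !fctE /GRing.scale/=; ring.
have w1 := L2Z 2 fk; have w2 := L2Z 2 kf; have w3 := L2Z 2 kk.
have w4 := L2D k32 w1; have w5 := L2D w4 w2; have w6 := L2D w5 w3.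
rewrite (ipDl mR N2 w6 p2) (ipDl mR w5 w3 p2) (ipDl mR w4 w2 p2) (ipDl mR k32 w1 p2).
rewrite (ipZl 2 mR fk p2) (ipZl 2 mR kf p2) (ipZl 2 mR kk p2).
have n0 := nrm2_ge0 k0 k1; have n3 := ip_ge0 T k3.
have kE' : nrm2 k0 k1 <= eta ^+ 2 by lra.
have i3 : ip Rp k3 k3 <= eta ^+ 2 by apply: (le_trans (ip_leT mR k32)); lra.
have i1 : ip Rp k1 k1 <= eta ^+ 2.
  by apply: (le_trans (ip_leT mR k12)); have := ip_ge0 T k0; rewrite /nrm2 in kE'; lra.
have j1 : ip Rp F1 F1 <= C ^+ 2.
  by apply: (le_trans (ip_leT mR b2)); have := ip_ge0 T F0; rewrite /nrm2 in FC; lra.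
have ksup x : `|k0 x| <= eta by exact: (H1_sup_bd x k01).
have fsup x : `|F0 x| <= C by exact: (H1_sup_bd x F01).
have t1 := ip_CS_bd mR k32 p2 eta0 B0 i3 phiB.
have t2 := ip_bdM_CS (L2_meas a2) k12 p2 C0 eta0 B0 fsup i1 phiB.
have t3 := ip_bdM_CS (L2_meas k02) b2 p2 eta0 C0 B0 ksup j1 phiB.
have t4 := ip_bdM_CS (L2_meas k02) k12 p2 eta0 eta0 B0 ksup i1 phiB.
have t5 : eta * eta * B <= eta * B by rewrite ler_wpM2r// ler_piMr.
set u := ip Rp _ phi; set u3 := ip Rp k3 phi; set u1 := ip Rp (F0 * k1) phi.
set u4 := ip Rp (k0 * F1) phi; set u5 := ip Rp (k0 * k1) phi.
have -> : - h * (u + (u3 + 2 * u1 + 2 * u4 + 2 * u5)) + h * u =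
  - (h * (u3 + 2 * u1 + 2 * u4 + 2 * u5)) by ring.
rewrite normrN normrM ger0_norm// -!mulrA ler_wpM2l//.
rewrite -/u3 -/u1 -/u4 -/u5 in t1 t2 t3 t4.
move: t1 t2 t3 t4 t5; rewrite !ler_norml; clear.
move=> /andP[? ?] /andP[? ?] /andP[? ?] /andP[? ?] ?.
by apply/andP; split; lra.
Qed.

(** The first-order terms have the right sign by [kdv_dissipation], up to the dual error [O(eta h)].
    The terms quadratic in [e0] are [O(h^2)], hence [O(eta h)] since [h <= eta]. *)
Lemma kdv_step F0 F1 F2 F3 : H1 F0 F1 -> H1 F1 F2 -> H1 F2 F3 -> F0 0 = 0 ->
  exists2 L, 0 <= L & forall (e0 e1 e2 : R -> R) (eta h : R), H1 e0 e1 -> H1 e1 e2 -> e0 0 = 0 ->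
  0 < eta <= 1 -> 0 < h <= eta -> nrm2 e0 e1 + ip T e2 e2 <= eta ^+ 2 ->
  kdv_increment F0 F1 F3 eta h e0 ->
  ip Rp (F0 + e0) (F0 + e0) - ip Rp F0 F0 <= L * eta * h /\
  ip Rp (F1 + e1) (F1 + e1) / 2 - ip Rp ((F0 + e0) * (F0 + e0)) (F0 + e0) / 3
   - (ip Rp F1 F1 / 2 - ip Rp (F0 * F0) F0 / 3) <= L * eta * h.
Proof.
move=> F01 F12 F23 F00; have mR := @measurable_Rplus R.
have [a2 b2 _] := F01; have [_ c2 _] := F12; have [_ d2 _] := F23.
have ab := L2_H1M F01 b2; have ab' := L2Z 2 ab; have aa := L2_H1M F01 a2.
pose N := F3 + 2 *: (F0 * F1); have N2 : L2 N by exact: L2D.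
pose P := F2 + F0 * F0; have P2 : L2 P by exact: L2D.
have cP : continuous P.
  have := H1D F23 (H1M F01 F01); exact: H1_cont.
pose C := nrm2 F0 F1 + ip T N N + ip T P P + 1.
have n0 := nrm2_ge0 F0 F1; have n1 := ip_ge0 T N; have n2 := ip_ge0 T P.
have C1 : 1 <= C by rewrite /C; lra.
have C0 : 0 <= C by lra.
have CC : C <= C ^+ 2 by rewrite expr2; nra.
have FC : nrm2 F0 F1 <= C ^+ 2 by apply: le_trans CC; rewrite /C; lra.
have NC : ip Rp N N <= C ^+ 2.
  by apply: (le_trans (ip_leT mR N2)); apply: le_trans CC; rewrite /C; lra.
have PC : ip Rp P P <= C ^+ 2.
  by apply: (le_trans (ip_leT mR P2)); apply: le_trans CC; rewrite /C; lra.
have F0C : ip Rp F0 F0 <= C ^+ 2.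
  by apply: (le_trans (ip_leT mR a2)); have := ip_ge0 T F1; rewrite /nrm2 in FC; lra.
have fsup x : `|F0 x| <= C by exact: (H1_sup_bd x F01).
pose w := 4 * C + 3; pose K := w + C.
have w0 : 0 <= w by rewrite /w; lra.
have K0 : 0 <= K by rewrite /K; lra.
exists (2 * w * C + w * C + K + (C + 2) * K ^+ 2).
  have h1 : 0 <= w * C by rewrite mulr_ge0.
  have h2 : 0 <= (C + 2) * K ^+ 2 by rewrite mulr_ge0 ?sqr_ge0//; lra.
  by move: h1 h2 K0; clear; lra.
move=> e0 e1 e2 eta h e01 e12 e00 /andP[eta0 eta1] /andP[h0 heta] He inc.
have [z2 z2' _] := e01; have [_ y2 _] := e12.
have m0 := nrm2_ge0 e0 e1; have m2 := ip_ge0 T e2.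
have He' : nrm2 e0 e1 <= eta ^+ 2 by lra.
have esup x : `|e0 x| <= eta by exact: (H1_sup_bd x e01 (ltW eta0)).
have e2E : ip Rp e2 e2 <= eta ^+ 2 by apply: (le_trans (ip_leT mR y2)); lra.
have eta01 : 0 <= eta <= 1 by rewrite ltW.
have dual := kdv_increment_dual F01 F12 F23 e01 C0 FC eta01 (ltW h0) inc.
have hN := L2Z h N2.
have Zsplit psi : L2 psi -> ip Rp e0 psi = ip Rp (e0 + h *: N) psi - h * ip Rp N psi.
  by move=> p2; rewrite ipDl// ipZl//; ring.
(* |e0| = O(h) in L2, by testing the increment against e0 itself *)
have eK : ip Rp e0 e0 <= (h * K) ^+ 2.
  pose A := Num.sqrt (ip Rp e0 e0); have A0 : 0 <= A := sqrtr_ge0 _.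
  have AE : ip Rp e0 e0 = A ^+ 2 by rewrite sqr_sqrtr// ip_ge0.
  have AA : ip Rp e0 e0 <= A ^+ 2 by rewrite AE.
  have := dual e0 A (H1_cont e01) z2 A0 AA; have := ip_CS_bd mR N2 z2 C0 A0 NC AA.
  rewrite !ler_norml => /andP[q1 q2] /andP[q3 q4].
  have q5 := Zsplit e0 z2; rewrite -/N in q4 q5.
  have hh : h * (eta * w) * A <= h * w * A.
    by rewrite ler_wpM2r// ler_wpM2l ?(ltW h0)// ler_piMl.
  have hq : - h * ip Rp N e0 <= h * (C * A).
    by rewrite mulNr -mulrN ler_wpM2l ?(ltW h0)//; move: q1; clear; lra.
  have : A * A <= A * (h * K).
    rewrite -expr2 -AE q5 /K; rewrite -/w in q4; move: q4 hh hq; clear; lra.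
  have [A1|A1] := ltP 0 A.
    by rewrite ler_pM2l// => ?; rewrite AE ler_pXn2r ?nnegrE ?mulr_ge0// (ltW h0).
  by move=> _; rewrite AE (_ : A = 0) ?expr0n ?sqr_ge0//; move: A0 A1; clear; lra.
have hK2 : (h * K) ^+ 2 <= K ^+ 2 * eta * h.
  by rewrite exprMn mulrC -mulrA ler_wpM2l ?sqr_ge0// expr2 ler_wpM2r// ltW.
have [dis1 dis2] := kdv_dissipation F01 F12 F23 F00.
rewrite -/N -/P in dis1 dis2.
have eta0' := ltW eta0; have h0' := ltW h0.
have heta0 : 0 <= eta * h by rewrite mulr_ge0.
have D1 := dual F0 C (H1_cont F01) a2 C0 F0C.
have D2 := dual P C cP P2 C0 PC.
have := Zsplit F0 a2; have := Zsplit P P2 => ZP ZF.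
rewrite -/N -/w in D1 D2 ZP ZF.
move: D1 D2; rewrite !ler_norml => /andP[_ D1] /andP[D2 _].
have hN1 : 0 <= h * ip Rp N F0 by rewrite mulr_ge0// ltW.
have hN2 : h * ip Rp N P <= 0 by rewrite mulr_ge0_le0// ltW.
have E1 : h * (eta * w) * C = w * C * (eta * h) by ring.
have wC : 0 <= w * C * (eta * h) by rewrite !mulr_ge0.
have KK : 0 <= K * (eta * h) by rewrite mulr_ge0.
have K2 : 0 <= K ^+ 2 * (eta * h) by rewrite mulr_ge0// sqr_ge0.
have CK2 : 0 <= C * K ^+ 2 * (eta * h) by rewrite !mulr_ge0// sqr_ge0.
split.
  rewrite ip_sqrD// [ip Rp F0 e0]ipC.
  move: ZF D1 hN1 hK2 eK E1 wC KK K2 CK2; clear; lra.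
have ea := L2_H1M F01 z2; have ee := L2_H1M e01 z2.
rewrite ip_sqrD// cubic_expand//; try exact: L2_meas.
(* Both integrations by parts are free of boundary terms as [e0 0 = 0]. The first turns the linear
   part of the energy into minus the pairing of [e0] with [P]. The second writes the squared norm of
   [e1] as minus the pairing of [e0] with [e2], at most [h K eta]: smallness in [h], known for [e0]
   only, is thus passed on to [e1]. *)
have i1 := ibp_Rplus F12 e01; rewrite e00 mulr0 oppr0 in i1.
have i2 := ibp_Rplus e01 e12; rewrite e00 mul0r oppr0 in i2.
have c1 := ip_cubic_bound mR (L2_meas a2) z2 C0 fsup.
have c2' := ip_cubic_bound mR (L2_meas z2) z2 (ltW eta0) esup.
have PE : ip Rp e0 P = ip Rp F2 e0 + ip Rp (F0 * F0) e0.
  by rewrite ipC ipDl.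
have ze : `|ip Rp e0 e2| <= h * K * eta.
  by apply: ip_CS_bd => //; rewrite mulr_ge0.
have z0 := ip_ge0 Rp e0.
have eK' := le_trans eK hK2.
have c3 : C * ip Rp e0 e0 <= C * (K ^+ 2 * eta * h) by rewrite ler_wpM2l.
have c4 : eta * ip Rp e0 e0 <= 1 * (K ^+ 2 * eta * h) by rewrite ler_pM.
move: c1 c2' ze; rewrite !ler_norml => /andP[p1 p2] /andP[p3 p4] /andP[p5 p6].
move: p1 p2 p3 p4 p5 p6 c3 c4 PE ZP D2 hN2 E1 wC KK K2 CK2 i1 i2 z0.
set X1 := ip Rp F1 e1; set X2 := ip Rp e1 e1; set X3 := ip Rp F2 e0.
set X4 := ip Rp (F0 * F0) e0; set X5 := ip Rp (F0 * e0) e0; set X6 := ip Rp (e0 * e0) e0.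
set X7 := ip Rp e0 P; set X8 := ip Rp (_ + _) P; set X9 := ip Rp N P; set X10 := ip Rp e0 e2.
set X11 := ip Rp e0 e0; set X12 := ip Rp F1 F1; set X13 := ip Rp (F0 * F0) F0; clear; lra.
Qed.

End KdVStep.

(** * Dini derivatives in time and the increments of smoother solutions *)

Section Monotone.
Context {R : realType}.
Local Notation mu := (@lebesgue_measure R).
Implicit Types (f g F G phi : R -> R).
Local Notation Rp := (@Rplus R).
Local Notation T := [set: R].

(** Continuity and a nonpositive upper right Dini derivative suffice: [m x <= m a + e (x - a)]
    propagates for every [e > 0]. *)
Lemma dini_nonincreasing (m : R -> R) (a b : R) : a <= b ->
  (forall s, a <= s <= b -> forall e, 0 < e -> exists2 d, 0 < d & forall t, a <= t <= b ->
     `|t - s| < d -> `|m t - m s| <= e) ->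
  (forall s, a <= s < b -> forall e, 0 < e -> exists2 d, 0 < d & forall t, s < t < s + d ->
     t <= b -> m t - m s <= e * (t - s)) ->
  m b <= m a.
Proof.
move=> ab cm dm.
have key e : 0 < e -> forall x, a <= x -> x <= b -> m x <= m a + e * (x - a).
  move=> e0; apply: (@real_induction R a (fun x => x <= b -> m x <= m a + e * (x - a))).
  - by move=> _; rewrite subrr mulr0 addr0.
  - move=> x ax IH; have [xb|bx] := ltP x b; last first.
      by exists 1 => // y /andP[xy _] yb; move: bx xy yb; clear; lra.
    have axb : a <= x < b by rewrite ax.
    have [d d0 H] := dm x axb e e0.
    exists d => // y xyd yb; have := H y xyd yb; have := IH x; rewrite ax lexx => /(_ isT (ltW xb)).
    clear; lra.
  - move=> x ax IH xb; apply/ler_addgt0Pr => eta eta0.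
    have axb : a <= x <= b by rewrite (ltW ax).
    have [d d0 H] := cm x axb eta eta0.
    pose y := Num.max a (x - d / 2).
    have ya : a <= y by rewrite le_max lexx.
    have yd : x - d / 2 <= y by rewrite le_max lexx orbT.
    have yx : y < x by rewrite gt_max ax; move: d0; clear; lra.
    have yb : y <= b by rewrite (le_trans (ltW yx)).
    have ayx : a <= y < x by rewrite ya.
    have ayb : a <= y <= b by rewrite ya.
    have ydd : `|y - x| < d by rewrite ltr0_norm; move: d0 yd yx; clear; lra.
    have := IH y ayx yb; have := H y ayb ydd.
    have : e * (y - a) <= e * (x - a) by rewrite ler_wpM2l ?(ltW e0)//; move: yx; clear; lra.
    rewrite ler_norml; move=> h1 /andP[h2 h3] h4; move: h1 h2 h3 h4; clear; lra.
apply/ler_addgt0Pr => e e0; have b1 : 0 < b - a + 1 by move: ab; clear; lra.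
have := key (e / (b - a + 1)) (divr_gt0 e0 b1) b ab (lexx b).
have : e / (b - a + 1) * (b - a) <= e.
  by rewrite mulrAC ler_pdivrMr// ler_wpM2l ?(ltW e0)// lerDl.
clear; lra.
Qed.

Lemma cvge0_lt (U : Type) (h : U -> \bar R) (Fi : set_system U) e : Filter Fi ->
  h @ Fi --> 0%E -> 0 < e -> \forall t \near Fi, (h t < e%:E)%E.
Proof.
move=> FF hc e0; have /hc// : nbhs 0%E [set x : \bar R | (x < e%:E)%E].
apply: open_nbhs_nbhs; split; last by rewrite /= lte_fin.
exact: open_ereal_lt_ereal.
Qed.

Lemma cont_into_small (I : set R) (N : (R -> R) -> \bar R) (u : R -> R -> R) (s e : R) :
  cont_into I N u -> I s -> 0 < e ->
  exists2 d, 0 < d & forall t, I t -> `|t - s| < d -> (N (u t \- u s)%R < e%:E)%E.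
Proof.
move=> cu Is e0; have [_ /cvge0_lt /(_ e0)] := cu s Is.
rewrite near_withinE => -[d /= d0 H]; exists d => // t It ts; apply: H => //=.
by rewrite distrC.
Qed.

Lemma Hk_plus_finite k f : (Hk_plus_norm k f < +oo)%E -> exists e, (Hk_plus_norm k f < e%:E)%E.
Proof.
case: (Hk_plus_norm k f) => [r _|//|_]; last by exists 0; rewrite ltNyr.
by exists (r + 1); rewrite lte_fin ltrDl.
Qed.

Lemma within_continuousB_fun f g : {within `[0, +oo[, continuous f} ->
  {within `[0, +oo[, continuous g} -> {within `[0, +oo[, continuous (f \- g)}.
Proof. by move=> cf cg; exact: within_continuousB. Qed.

Lemma zero_ext_eq F f : (forall x, 0 <= x -> F x = f x) -> \1_Rp * F = \1_Rp * f.
Proof.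
move=> Ff; apply/funext => x; rewrite !fctE indicE; case: (boolP (x \in Rp)) => h.
  by rewrite Ff//; move: h; rewrite inE /Rplus/= => /ltW.
by rewrite !mul0r.
Qed.

Lemma zero_ext_functionals F G f g : H1 F G -> F 0 = 0 -> H1 f g -> f = \1_Rp * F ->
  ip T f f = ip Rp F F /\ energy f g = ip Rp G G / 2 - ip Rp (F * F) F / 3.
Proof.
move=> FG F0 fg fE; have mR := @measurable_Rplus R.
have ext := H1_zero_ext FG F0; have g2 := H1_L2d fg; have G2 := H1_L2d ext.
have sq D (h : R -> R) : measurable D -> ip T (\1_D * h) (\1_D * h) = ip D h h.
  move=> mD; rewrite -(ip_restr h h mD); apply: eq_ip_mul => x _; rewrite !fctE indicE.
  by case: (_ \in _); rewrite ?mul1r ?mul0r.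
split; first by rewrite fE sq.
rewrite /energy; subst f; congr (_ / 2 - _ / 3).
  by rewrite (H1_ip_uniq measurableT fg ext g2) ipC (H1_ip_uniq measurableT fg ext G2) sq.
rewrite -(ip_restr _ _ mR); apply: eq_ip_mul => x _; rewrite !fctE indicE.
by case: (_ \in _); rewrite ?mul1r ?mul0r.
Qed.

Section Smoother.
Variables (T0 : R) (v : R -> R -> R).
Hypothesis sol : smoother_kdv_solution T0 v.

Lemma smoother_cont t : 0 <= t <= T0 -> {within `[0, +oo[, continuous (v t)}.
Proof. by case: sol => -[[_ H _] _ _ _] _ /H[]. Qed.

Lemma smoother_chain t : 0 <= t <= T0 -> exists F0 F1 F2 F3,
  [/\ H1 F0 F1, H1 F1 F2, H1 F2 F3 & forall x, 0 <= x -> F0 x = v t x].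
Proof.
move=> t0; case: sol => _ /(_ t); rewrite /= in_itv/= => /(_ t0)[/Hk_plus_finite[e He] _].
have [F0 [F1 [F2 [F3 [[]]]]]] := Hk_plus3_H1 (smoother_cont t0) He.
by move=> *; exists F0, F1, F2, F3.
Qed.

Lemma smoother_diff s e : 0 < s < T0 -> 0 < e -> exists2 d, 0 < d &
  forall t, 0 < t < T0 -> `|t - s| < d -> exists e0 e1 e2 e3,
  [/\ H1 e0 e1, H1 e1 e2, H1 e2 e3, forall x, 0 <= x -> e0 x = v t x - v s x &
    nrm2 e0 e1 + ip T e2 e2 + ip T e3 e3 <= e ^+ 2].
Proof.
move=> /andP[s0 sT] ep; have [_ cv] := sol.
have sI : `[0, T0]%classic s by rewrite /= in_itv/= !ltW.
have [d d0 H] := cont_into_small cv sI ep; exists d => // t /andP[t0 tT] ts.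
have tI : `[0, T0]%classic t by rewrite /= in_itv/= !ltW.
have cts : {within `[0, +oo[, continuous (v t \- v s)}.
  by apply: within_continuousB_fun; apply: smoother_cont; rewrite !ltW.
have [e0 [e1 [e2 [e3 [[h1 h2 h3] _ h4 h5]]]]] := Hk_plus3_H1 cts (H t tI ts).
by exists e0, e1, e2, e3; split=> //; rewrite /nrm2 ltW.
Qed.

(** The mean value theorem is applied to the scalar function of time obtained by pairing with [phi];
    the regularity H^3 then takes all derivatives off [phi]. *)
Lemma smoother_increment s t F0 F1 F2 F3 e0 e1 eta : 0 < s -> s < t -> t < T0 ->
  H1 F0 F1 -> H1 F1 F2 -> H1 F2 F3 -> (forall x, 0 <= x -> F0 x = v s x) ->
  H1 e0 e1 -> (forall x, 0 <= x -> e0 x = v t x - v s x) ->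
  (forall r, s < r < t -> exists e0 e1 e2 e3,
  [/\ H1 e0 e1, H1 e1 e2, H1 e2 e3, forall x, 0 <= x -> e0 x = v r x - v s x &
    nrm2 e0 e1 + ip T e2 e2 + ip T e3 e3 <= eta ^+ 2]) ->
  kdv_increment F0 F1 F3 eta (t - s) e0.
Proof.
move=> s0 st tT F01 F12 F23 F0E e01 e0E near phi tphi; have mR := @measurable_Rplus R.
have p2 := H1_L2 (test_H1 tphi).
have [[_ eqv _ _] _] := sol.
pose h r := \int[mu]_(x in Rp) (v r x * phi x).
pose D r := \int[mu]_(x in Rp) (v r x * derive1n 3 phi x + (v r x) ^+ 2 * derive1 phi x).
have dh r : 0 < r < T0 -> is_derive r (1 : R) h (D r) by exact: eqv.
have ch : {within `[s, t], continuous h}.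
  apply: derivable_within_continuous => r; rewrite in_itv/= => /andP[sr rt].
  have r0 : 0 < r < T0 by rewrite (lt_le_trans s0 sr) (le_lt_trans rt tT).
  by have [] := dh r r0.
have dh' r : r \in `]s, t[ -> is_derive r (1 : R) h (D r).
  by rewrite in_itv/= => /andP[sr rt]; apply: dh; rewrite (lt_trans s0 sr) (lt_trans rt tT).
have [r rst hr] := MVT st dh' ch.
have [k0 [k1 [k2 [k3 [k01 k12 k23 k0E kn]]]]] := near r rst.
have [k02 _ _] := k01; have k22 := ip_ge0 T k2; have k32 := H1_L2d k23.
exists k0, k1, k3; split => //; first by move: kn k22; clear; lra.
have F02 := H1_L2 F01; have e02 := H1_L2 e01.
have hs : h s = ip Rp F0 phi.
  by apply: eq_ip_mul => x x0; rewrite F0E// ltW.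
have ht : h t = ip Rp F0 phi + ip Rp e0 phi.
  rewrite -ipDl//; apply: eq_ip_mul => x /ltW x0; rewrite fctE F0E// e0E//; ring.
have FK : H1 (F0 + k0) (F1 + k1) by exact: H1D.
have FKK := H1M FK FK.
have Dr : D r = - ip Rp (F3 + k3) phi - ip Rp (2 *: ((F0 + k0) * (F1 + k1))) phi.
  have t1 := test_derive tphi; have t2 := test_derive t1; have t3 := test_derive t2.
  have -> : D r = ip Rp (F0 + k0) (derive1n 3 phi) + ip Rp ((F0 + k0) * (F0 + k0)) (derive1 phi).
    rewrite /ip -RintD//.
    - apply: eq_Rintegral => x; rewrite inE => /ltW x0; rewrite !fctE F0E// k0E//.
      by have -> : v s x + (v r x - v s x) = v r x by ring.
    - exact: (L2_itg mR (H1_L2 FK) (H1_L2 (test_H1 t3))).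
    - exact: (L2_itg mR (H1_L2 FKK) (H1_L2 (test_H1 t1))).
  rewrite (ibp_test FK t2) (ibp_test (H1D F12 k12) t1) (ibp_test (H1D F23 k23) tphi) opprK.
  rewrite (ibp_test FKK tphi); congr (- _ - ip Rp _ phi).
  by apply/funext => x; rewrite !fctE /GRing.scale/=; ring.
rewrite ipDl//; first by move: hr; rewrite hs ht Dr => hr; move: hr; clear; lra.
- by apply: L2D; [exact: H1_L2d F23|].
- by apply: L2Z; exact: L2_H1M FK (H1_L2d FK).
Qed.

End Smoother.

End Monotone.

(** * Monotonicity for smoother solutions and passage to the limit *)

Section Conservation.
Context {R : realType}.
Local Notation mu := (@lebesgue_measure R).
Implicit Types (f g F G phi : R -> R).
Local Notation Rp := (@Rplus R).
Local Notation T := [set: R].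

Lemma zero_ext_nrm F G f g : H1 F G -> F 0 = 0 -> H1 f g -> f = \1_Rp * F ->
  nrm2 f g <= nrm2 F G.
Proof.
move=> FG F0 fg fE; have mR := @measurable_Rplus R.
have ext := H1_zero_ext FG F0; have g2 := H1_L2d fg; have G2 := H1_L2d ext.
have sq (h : R -> R) : L2 h -> ip T (\1_Rp * h) (\1_Rp * h) <= ip T h h.
  move=> h2; apply: ip_le => //; try exact: L2_restr.
  move=> x _; rewrite !fctE indicE; case: (_ \in _); rewrite ?mul1r// !mul0r.
  by rewrite -expr2 sqr_ge0.
subst f; have gE : ip T g g = ip T (\1_Rp * G) (\1_Rp * G).
  by rewrite (H1_ip_uniq measurableT fg ext g2) ipC (H1_ip_uniq measurableT fg ext G2).
by rewrite /nrm2 gE; apply: lerD; apply: sq; [exact: H1_L2 FG|exact: H1_L2d FG].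
Qed.

Lemma smoother_rep T0 (v : R -> R -> R) : smoother_kdv_solution T0 v ->
  exists f g : R -> R -> R, forall t, 0 < t < T0 -> H1 (f t) (g t) /\ f t = \1_Rp * v t.
Proof.
move=> sol; have H t : exists p : (R -> R) * (R -> R), 0 < t < T0 ->
    H1 p.1 p.2 /\ p.1 = \1_Rp * v t.
  have [tI|nt] := boolP (0 < t < T0); last by exists (0, 0).
  have tI' : 0 <= t <= T0 by move: tI => /andP[? ?]; rewrite !ltW.
  have [F0 [F1 [F2 [F3 [F01 _ _ FE]]]]] := smoother_chain sol tI'.
  have F00 : F0 0 = 0 by rewrite FE//; case: sol => -[_ _ _ z] _; exact: z.
  exists (\1_Rp * F0, \1_Rp * F1) => _ /=; split; first exact: H1_zero_ext.
  exact: zero_ext_eq.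
have [p Hp] := choice H.
by exists (fun t => (p t).1), (fun t => (p t).2).
Qed.

(** Continuity in H^3 makes [eta] in [kdv_step] as small as desired just after each time, so the
    Dini derivatives of mass and energy are at most any [e > 0]. *)
Lemma smoother_mono T0 (v : R -> R -> R) (a b : R) f g f' g' :
  smoother_kdv_solution T0 v -> 0 < a -> a <= b -> b < T0 ->
  H1 f g -> f = \1_Rp * v a -> H1 f' g' -> f' = \1_Rp * v b ->
  ip T f' f' <= ip T f f /\ energy f' g' <= energy f g.
Proof.
move=> sol a0 ab bT fg fE fg' fE'.
have [fr [gr Hr]] := smoother_rep sol.
have inI s : a <= s <= b -> 0 < s < T0.
  by move=> /andP[as_ sb]; rewrite (lt_le_trans a0 as_) (le_lt_trans sb bT).
have v0 s : 0 < s < T0 -> v s 0 = 0 by case: sol => -[_ _ _ z] _; exact: z.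
have cont s e : a <= s <= b -> 0 < e -> exists2 d, 0 < d & forall t, a <= t <= b ->
    `|t - s| < d -> `|ip T (fr t) (fr t) - ip T (fr s) (fr s)| <= e /\
      `|energy (fr t) (gr t) - energy (fr s) (gr s)| <= e.
  move=> sI e0; have [fs fsE] := Hr s (inI s sI).
  have [C C0 HC] := energy_diff fs.
  pose eta := Num.min 1 (e / (C + 1)).
  have C1 : 0 < C + 1 by move: C0; clear; lra.
  have eta0 : 0 < eta by rewrite lt_min ltr01 divr_gt0.
  have eta1 : 0 <= eta <= 1 by rewrite (ltW eta0) ge_min lexx.
  have Ce : C * eta <= e.
    have : eta * (C + 1) <= e by rewrite -ler_pdivlMr// ge_min lexx orbT.
    by move: eta0; clear; lra.
  have [d d0 Hd] := smoother_diff sol (inI s sI) eta0.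
  exists d => // t tI ts; have [e0' [e1 [e2 [e3 [e01 e12 e23 eE en]]]]] := Hd t (inI t tI) ts.
  have [ft ftE] := Hr t (inI t tI).
  have e00 : e0' 0 = 0 by rewrite eE// !v0 ?subrr//; exact: inI.
  have dfE : fr t - fr s = \1_Rp * e0'.
    rewrite (zero_ext_eq eE) ftE fsE -mulrBr//.
  have nn : nrm2 (fr t - fr s) (gr t - gr s) <= eta ^+ 2.
    apply: le_trans (zero_ext_nrm e01 e00 (H1B ft fs) dfE) _.
    by have := ip_ge0 T e2; have := ip_ge0 T e3; move: en; clear; lra.
  have [h1 h2] := HC _ _ _ ft eta1 nn.
  by split; [exact: le_trans h1 Ce|exact: le_trans h2 Ce].
have dini s e : a <= s < b -> 0 < e -> exists2 d, 0 < d & forall t, s < t < s + d -> t <= b ->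
    ip T (fr t) (fr t) - ip T (fr s) (fr s) <= e * (t - s) /\
    energy (fr t) (gr t) - energy (fr s) (gr s) <= e * (t - s).
  move=> /andP[as_ sb] e0; have sI : a <= s <= b by rewrite as_ ltW.
  have sT := inI s sI; have sT' : 0 <= s <= T0 by move: sT => /andP[? ?]; rewrite !ltW.
  have [fs fsE] := Hr s sT.
  have [F0 [F1 [F2 [F3 [F01 F12 F23 FE]]]]] := smoother_chain sol sT'.
  have F00 : F0 0 = 0 by rewrite FE// v0.
  have [L L0 HL] := kdv_step F01 F12 F23 F00.
  pose eta := Num.min 1 (e / (L + 1)).
  have L1 : 0 < L + 1 by move: L0; clear; lra.
  have eta0 : 0 < eta by rewrite lt_min ltr01 divr_gt0.
  have eta1 : 0 < eta <= 1 by rewrite eta0 ge_min lexx.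
  have Le : L * eta <= e.
    have : eta * (L + 1) <= e by rewrite -ler_pdivlMr// ge_min lexx orbT.
    by move: eta0; clear; lra.
  have [d d0 Hd] := smoother_diff sol sT eta0.
  exists (Num.min d eta); first by rewrite lt_min d0.
  move=> t /andP[st]; rewrite -ltrBlDl lt_min => /andP[td teta] tb.
  have tI : a <= t <= b by rewrite tb (le_trans as_ (ltW st)).
  have [ft ftE] := Hr t (inI t tI).
  have h0 : 0 < t - s <= eta by rewrite subr_gt0 st ltW.
  have tsd : `|t - s| < d by rewrite gtr0_norm// subr_gt0.
  have [e0' [e1 [e2 [e3 [e01 e12 e23 eE en]]]]] := Hd t (inI t tI) tsd.
  have e00 : e0' 0 = 0 by rewrite eE// !v0 ?subrr//; exact: inI.
  have en' : nrm2 e0' e1 + ip T e2 e2 <= eta ^+ 2.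
    by have := ip_ge0 T e3; move: en; clear; lra.
  have tT : t < T0 := le_lt_trans tb bT.
  have inc : kdv_increment F0 F1 F3 eta (t - s) e0'.
    apply: (smoother_increment sol _ st tT F01 F12 F23 FE e01 eE); first by case/andP: sT.
    move=> r /andP[sr rt]; apply: Hd.
      by rewrite (lt_trans _ sr) ?(lt_trans rt tT)//; case/andP: sT.
    by rewrite gtr0_norm ?subr_gt0// (lt_trans _ td)// ltrD2r.
  have [h1 h2] := HL _ _ _ _ _ e01 e12 e00 eta1 h0 en' inc.
  have [m1 m2] := zero_ext_functionals F01 F00 fs (etrans fsE (esym (zero_ext_eq FE))).
  have FeE x : 0 <= x -> (F0 + e0') x = v t x.
    by move=> x0; rewrite fctE FE// eE// addrC subrK.
  have Fe0 : (F0 + e0') 0 = 0 by rewrite fctE F00 e00 addr0.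
  have [m3 m4] := zero_ext_functionals (H1D F01 e01) Fe0 ft (etrans ftE (esym (zero_ext_eq FeE))).
  have Lt : L * eta * (t - s) <= e * (t - s) by rewrite ler_wpM2r// subr_ge0 ltW.
  rewrite m1 m2 m3 m4; split; [exact: le_trans h1 Lt|exact: le_trans h2 Lt].
have aI : a <= a <= b by rewrite lexx.
have bI : a <= b <= b by rewrite ab lexx.
have [fa faE] := Hr a (inI a aI); have [fb fbE] := Hr b (inI b bI).
have f1 : f = fr a by rewrite fE faE.
have f2 : f' = fr b by rewrite fE' fbE.
(* The given derivatives and those selected by [smoother_rep] may differ on a null set, which the
   energy ignores. *)
have same (p q r : R -> R) : H1 p q -> H1 p r -> energy p q = energy p r.
  move=> pq pr; rewrite /energy; congr (_ / 2 - _).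
  by rewrite (H1_ip_uniq measurableT pq pr (H1_L2d pq)) ipC (H1_ip_uniq measurableT pq pr (H1_L2d pr)).
rewrite f1 in fg *; rewrite f2 in fg' *.
rewrite (same _ _ _ fg fa) (same _ _ _ fg' fb); split.
- apply: (dini_nonincreasing (m := fun r => ip T (fr r) (fr r)) ab) => s sI e e0.
    have [d d0 H] := cont s e sI e0; exists d => // t tI ts; exact: (H t tI ts).1.
  have [d d0 H] := dini s e sI e0; exists d => // t tI ts; exact: (H t tI ts).1.
- apply: (dini_nonincreasing (m := fun r => energy (fr r) (gr r)) ab) => s sI e e0.
    have [d d0 H] := cont s e sI e0; exists d => // t tI ts; exact: (H t tI ts).2.
  have [d d0 H] := dini s e sI e0; exists d => // t tI ts; exact: (H t tI ts).2.
Qed.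

Lemma restr_norm_ge0 (Om : set R) (N : (R -> R) -> \bar R) f :
  (forall g, (0 <= N g)%E) -> (0 <= restr_norm Om N f)%E.
Proof. by move=> N0; apply: le_ereal_inf_tmp => _ [g _ <-]. Qed.

Lemma Z1_norm_lt T0 (w : R -> R -> R) (e : R) : (Z1_norm T0 w < e%:E)%E ->
  forall t, 0 <= t <= T0 -> (Hk_plus_norm 1 (w t) < e%:E)%E.
Proof.
move=> /ereal_inf_lt[_ [d _ <-]] dlt t tT; apply: le_lt_trans dlt.
apply: (@le_trans _ _ (ereal_sup [set Hk_plus_norm 1 (w t) | t in `[0%R, T0]])).
  by apply: ereal_sup_ubound; exists t => //=; rewrite in_itv.
apply: leeDl; apply: sume_ge0 => l _.
apply: (@le_trans _ _ (Hs_time_norm T0 ((2 - l%:R) / 3) (d l 1))).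
  by apply: restr_norm_ge0 => g; exact: sqrte_ge0.
by apply: ereal_sup_ubound; exists 1 => //; exact: ltr01.
Qed.

Section Global.
Variables (u0 : R -> R) (u : R -> R -> R).
Hypotheses (hu0 : H1_plus u0) (u00 : u0 0 = 0) (sol : global_kdv_solution u0 u).

Lemma global_cont t : 0 <= t -> {within `[0, +oo[, continuous (u t)}.
Proof.
move=> t0; have t1 : 0 < t + 1 by move: t0; lra.
have [[[_ H _] _ _ _] _] := sol t1.
have tI : 0 <= t <= t + 1 by rewrite t0 lerDl ler01.
by case: (H t tI).
Qed.

(** The boundary condition of the problem concerns positive times. At time 0 the value is inherited
    from [u0], both functions being continuous up to the boundary. *)
Lemma global_at0 t : 0 <= t -> u t 0 = 0.
Proof.
rewrite le_eqVlt => /orP[/eqP <-|t0]; last first.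
  have t1 : 0 < t + 1 by move: t0; lra.
  by have [[_ _ _ H] _] := sol t1; apply: H; rewrite t0 ltrDl ltr01.
have [[_ _ H _] _] := sol (@ltr01 R).
have [/Hk_plus_finite[e He] c0] := hu0.
have [F [G [FG _ FE _]]] := Hk_plus1_H1 c0 He.
have E : \forall x \ae mu, Rp x -> F x = u 0 x.
  by apply: aeW => /= x x0; rewrite H// FE// ltW.
by rewrite -(ae_eq_right (global_cont (lexx 0)) (H1_cont FG) E (lexx 0)) FE.
Qed.

Lemma global_rep : exists f g : R -> R -> R, forall t, 0 <= t ->
  H1 (f t) (g t) /\ f t = \1_Rp * u t.
Proof.
have H t : exists p : (R -> R) * (R -> R), 0 <= t -> H1 p.1 p.2 /\ p.1 = \1_Rp * u t.
  have [t0|nt] := boolP (0 <= t); last by exists (0, 0).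
  have t1 : 0 < t + 1 by move: t0; lra.
  have [[[_ H _] _ _ _] _] := sol t1.
  have tI : 0 <= t <= t + 1 by rewrite t0 lerDl ler01.
  have [/Hk_plus_finite[e He] _] := H t tI.
  have [F [G [FG _ FE _]]] := Hk_plus1_H1 (global_cont t0) He.
  have F0 : F 0 = 0 by rewrite FE// global_at0.
  exists (\1_Rp * F, \1_Rp * G) => _ /=; split; first exact: H1_zero_ext.
  exact: zero_ext_eq.
have [p Hp] := choice H.
by exists (fun t => (p t).1), (fun t => (p t).2).
Qed.

Lemma rep_diff (a b : R -> R) f g f' g' (e : R) : {within `[0, +oo[, continuous a} ->
  {within `[0, +oo[, continuous b} -> a 0 = 0 -> b 0 = 0 ->
  H1 f g -> f = \1_Rp * a -> H1 f' g' -> f' = \1_Rp * b ->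
  (Hk_plus_norm 1 (a \- b)%R < e%:E)%E -> nrm2 (f - f') (g - g') <= e ^+ 2.
Proof.
move=> ca cb a0 b0 fg fE fg' fE' abe.
have [F [G [FG _ FE FGe]]] := Hk_plus1_H1 (within_continuousB_fun ca cb) abe.
have F0 : F 0 = 0 by rewrite FE//= a0 b0 subrr.
apply: le_trans (ltW FGe); apply: (zero_ext_nrm FG F0 (H1B fg fg')).
by rewrite (zero_ext_eq FE) fE fE' -mulrBr.
Qed.

Variables (f g : R -> R -> R).
Hypothesis rep : forall t, 0 <= t -> H1 (f t) (g t) /\ f t = \1_Rp * u t.

Lemma global_small s e : 0 <= s -> 0 < e -> exists2 d, 0 < d & forall t, 0 <= t ->
  `|t - s| < d -> nrm2 (f t - f s) (g t - g s) <= e ^+ 2.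
Proof.
move=> s0 e0; have s1 : 0 < s + 1 by move: s0; lra.
have [[[cu _ _] _ _ _] _] := sol s1.
have sI : `[0, s + 1]%classic s by rewrite /= in_itv/= s0 lerDl ler01.
have [d d0 H] := cont_into_small cu sI e0.
exists (Num.min d 1); first by rewrite lt_min d0 ltr01.
move=> t t0; rewrite lt_min => /andP[td t1].
have [fs fsE] := rep s0; have [ft ftE] := rep t0.
apply: (rep_diff (global_cont t0) (global_cont s0) _ _ ft ftE fs fsE);
  try exact: global_at0.
apply: H => //; rewrite /= in_itv/= t0/=.
by move: t1; rewrite ltr_norml; lra.
Qed.

(** The approximating solutions are known to vanish at the boundary at positive times, hence
    [0 < s]; time 0 is reached afterwards by continuity of [u] in H^1. *)
Lemma global_mono_pos s t : 0 < s -> s <= t ->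
  ip T (f t) (f t) <= ip T (f s) (f s) /\ energy (f t) (g t) <= energy (f s) (g s).
Proof.
move=> s0 st; have t0 := lt_le_trans s0 st.
have [fs fsE] := rep (ltW s0); have [ft ftE] := rep (ltW t0).
have [Cs Cs0 Hs] := energy_diff fs; have [Ct Ct0 Ht] := energy_diff ft.
suff key e : 0 < e -> ip T (f t) (f t) <= ip T (f s) (f s) + e /\
    energy (f t) (g t) <= energy (f s) (g s) + e.
  by split; apply/ler_addgt0Pr => e e0; have [] := key e e0.
move=> e0; pose C := Cs + Ct + 1.
have C1 : 0 < C by rewrite /C; move: Cs0 Ct0; lra.
pose eta := Num.min 1 (e / C).
have eta0 : 0 < eta by rewrite lt_min ltr01 divr_gt0.
have eta1 : 0 <= eta <= 1 by rewrite (ltW eta0) ge_min lexx.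
have Ce : Cs * eta + Ct * eta <= e.
  have : eta * C <= e by rewrite -ler_pdivlMr// ge_min lexx orbT.
  by move: eta0; rewrite /C; lra.
have t1 : 0 < t + 1 by move: t0; lra.
have [_ [v [vsol vcv]]] := sol t1.
have [n _ /(_ n (leqnn n)) /= Hn] := cvge0_lt _ vcv eta0.
have sI : 0 < s < t + 1 by rewrite s0 (le_lt_trans st)// ltrDl ltr01.
have tI : 0 < t < t + 1 by rewrite t0 ltrDl ltr01.
have [fv [gv Hv]] := smoother_rep (vsol n).
have [fvs fvsE] := Hv s sI; have [fvt fvtE] := Hv t tI.
have inI r : 0 < r < t + 1 -> 0 <= r <= t + 1 by move=> /andP[? ?]; rewrite !ltW.
have v0 r : 0 < r < t + 1 -> v n r 0 = 0 by have [[_ _ _ z] _] := vsol n; exact: z.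
have close r (rI : 0 < r < t + 1) : H1 (fv r) (gv r) -> fv r = \1_Rp * v n r ->
    H1 (f r) (g r) -> f r = \1_Rp * u r -> nrm2 (fv r - f r) (gv r - g r) <= eta ^+ 2.
  move=> p1 p2 p3 p4; have /andP[r0 _] := inI r rI.
  apply: (rep_diff (smoother_cont (vsol n) (inI r rI)) (global_cont r0) _ _ p1 p2 p3 p4).
  - exact: v0.
  - exact: global_at0.
  - exact: (Z1_norm_lt Hn (inI r rI)).
have [q1 q2] := Hs _ _ _ fvs eta1 (close s sI fvs fvsE fs fsE).
have [q3 q4] := Ht _ _ _ fvt eta1 (close t tI fvt fvtE ft ftE).
have tlt : t < t + 1 by rewrite ltrDl ltr01.
have [q5 q6] := smoother_mono (vsol n) s0 st tlt fvs fvsE fvt fvtE.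
move: q1 q2 q3 q4; rewrite !ler_norml.
move=> /andP[a1 a2] /andP[a3 a4] /andP[a5 a6] /andP[a7 a8].
by split; [move: q5 a1 a2 a5 a6 Ce|move: q6 a3 a4 a7 a8 Ce]; lra.
Qed.

Lemma global_mono t : 0 <= t ->
  ip T (f t) (f t) <= ip T (f 0) (f 0) /\ energy (f t) (g t) <= energy (f 0) (g 0).
Proof.
rewrite le_eqVlt => /orP[/eqP <-//|t0].
have [f0 _] := rep (lexx 0); have [C C0 HC] := energy_diff f0.
suff key e : 0 < e -> ip T (f t) (f t) <= ip T (f 0) (f 0) + e /\
    energy (f t) (g t) <= energy (f 0) (g 0) + e.
  by split; apply/ler_addgt0Pr => e e0; have [] := key e e0.
move=> e0; have C1 : 0 < C + 1 by move: C0; lra.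
pose eta := Num.min 1 (e / (C + 1)).
have eta0 : 0 < eta by rewrite lt_min ltr01 divr_gt0.
have eta1 : 0 <= eta <= 1 by rewrite (ltW eta0) ge_min lexx.
have Ce : C * eta <= e.
  have : eta * (C + 1) <= e by rewrite -ler_pdivlMr// ge_min lexx orbT.
  by move: eta0; lra.
have [d d0 Hd] := global_small (lexx 0) eta0.
pose s := Num.min t (d / 2).
have s0 : 0 < s by rewrite lt_min t0 divr_gt0.
have st : s <= t by rewrite ge_min lexx.
have sd : `|s - 0| < d.
  rewrite subr0 gtr0_norm//; have : s <= d / 2 by rewrite ge_min lexx orbT.
  by move: d0; lra.
have [fs _] := rep (ltW s0).
have [q1 q2] := HC _ _ _ fs eta1 (Hd s (ltW s0) sd).
have [q3 q4] := global_mono_pos s0 st.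
move: q1 q2; rewrite !ler_norml => /andP[a1 a2] /andP[a3 a4].
by split; [move: q3 a1 a2 Ce|move: q4 a3 a4 Ce]; lra.
Qed.

End Global.

End Conservation.

(** * The linearized operator about the soliton *)

Section ChangeOfVariables.
Context {R : realType}.
Local Notation mu := (@lebesgue_measure R).
Implicit Types (f g : R -> R) (a b x y : R).
Local Notation T := [set: R].

Lemma integral_measure_preserving (ph : measurableTypeR R -> measurableTypeR R)
    (f : R -> \bar R) :
  measurable_fun setT ph ->
  (forall A, measurable A -> pushforward mu ph A = mu A) ->
  measurable_fun (setT : set (measurableTypeR R)) f ->
  (\int[mu]_x f (ph x) = \int[mu]_x f x)%E.
Proof.
move=> mph inv.
have nn (h : R -> \bar R) : measurable_fun (setT : set (measurableTypeR R)) h ->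
    (forall x, (0 <= h x)%E) -> (\int[mu]_x h (ph x) = \int[mu]_x h x)%E.
  move=> mh h0; transitivity (\int[pushforward mu ph]_x h x)%E.
    by rewrite ge0_integral_pushforward//= preimage_setT.
  by apply: eq_measure_integral => /= A mA _; exact: inv.
move=> mf; rewrite integralE [RHS]integralE.
have P : (\int[mu]_x f^\+ (ph x) = \int[mu]_x f^\+ x)%E.
  by apply: nn => //; exact: measurable_funepos.
have N : (\int[mu]_x f^\- (ph x) = \int[mu]_x f^\- x)%E.
  by apply: nn => //; exact: measurable_funeneg.
rewrite -P -N; congr (_ - _)%E; apply: eq_integral => x _.
  by rewrite !funeposE.
by rewrite !funenegE.
Qed.

Lemma lebesgue_measure_shift (A : set R) y : measurable A ->
  pushforward mu ((fun x => x + y) : R -> measurableTypeR R) A = mu A.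
Proof.
set ph : R -> measurableTypeR R := (fun x => x + y).
have mph : measurable_fun setT ph.
  by apply: measurable_funD => //; exact: measurable_cst.
move=> mA; apply/esym/lebesgue_measure_unique => //= _ [[a b]] _ <-.
rewrite /pushforward; have -> : ph @^-1` `]a, b] = `](a - y)%R, (b - y)%R]%classic.
  by apply/seteqP; split=> x /=; rewrite !in_itv/= /ph ltrBlDr lerBrDr.
by rewrite !lebesgue_measure_itv/= !lte_fin ltrD2r; case: ifP => // _; congr EFin; ring.
Qed.

Lemma Rint_shift f y : measurable_fun setT f ->
  \int[mu]_x f (x + y) = \int[mu]_x f x.
Proof.
move=> mf; congr fine.
apply: (@integral_measure_preserving (fun x => x + y) (EFin \o f)) => //.
- by apply: measurable_funD => //; exact: measurable_cst.
- by move=> A mA; exact: lebesgue_measure_shift.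
- by apply/measurable_EFinP.
Qed.

Lemma Rint_opp f : measurable_fun setT f -> \int[mu]_x f (- x) = \int[mu]_x f x.
Proof.
move=> mf; congr fine.
apply: (@integral_measure_preserving -%R (EFin \o f)) => //.
- by move=> A mA; exact: lebesgue_measureN.
- by apply/measurable_EFinP.
Qed.

(** [shf y] brings the point [y] to the origin: the solution at time [t] seen from a soliton
    centered at [y] is [shf y (u t)]. *)
Definition shf y f : R -> R := fun x => f (x + y).
Definition opf f : R -> R := fun x => f (- x).

Lemma measurable_shf y f : measurable_fun setT f -> measurable_fun setT (shf y f).
Proof.
move=> mf; apply: measurableT_comp => //.
by apply: measurable_funD => //; exact: measurable_cst.
Qed.

Lemma measurable_opf f : measurable_fun setT f -> measurable_fun setT (opf f).
Proof. by move=> mf; apply: measurableT_comp. Qed.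

Lemma ip_shf (D : set R) y f g : measurable D -> measurable_fun setT f -> measurable_fun setT g ->
  ip [set x | D (x + y)] (shf y f) (shf y g) = ip D f g.
Proof.
move=> mD mf mg; rewrite /ip Rint_mkcond [RHS]Rint_mkcond -[RHS](Rint_shift y).
  apply: eq_Rintegral => x _; rewrite !fctE !indicE /shf.
  by have -> : (x \in [set x0 | D (x0 + y)]) = (x + y \in D) by apply/idP/idP; rewrite !inE.
by apply: measurable_funM => //; exact: measurable_funM.
Qed.

Lemma ip_opf (D : set R) f g : measurable D -> measurable_fun setT f -> measurable_fun setT g ->
  ip [set x | D (- x)] (opf f) (opf g) = ip D f g.
Proof.
move=> mD mf mg; rewrite /ip Rint_mkcond [RHS]Rint_mkcond -[RHS]Rint_opp.
  apply: eq_Rintegral => x _; rewrite !fctE !indicE /opf.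
  by have -> : (x \in [set x0 | D (- x0)]) = (- x \in D) by apply/idP/idP; rewrite !inE.
by apply: measurable_funM => //; exact: measurable_funM.
Qed.

Lemma ipT_shf y f g : measurable_fun setT f -> measurable_fun setT g ->
  ip T (shf y f) (shf y g) = ip T f g.
Proof. by move=> mf mg; rewrite -(@ip_shf setT y f g). Qed.

Lemma L2_shf y f : L2 f -> L2 (shf y f).
Proof.
move=> [mf f2]; have ms := measurable_shf y mf; split=> //; move: f2; congr (_ < _)%E.
apply/esym; apply: (@integral_measure_preserving (fun x => x + y) (fun x => (f x ^+ 2)%:E)).
- by apply: measurable_funD => //; exact: measurable_cst.
- by move=> A mA; exact: lebesgue_measure_shift.
- by apply/measurable_EFinP; apply: measurable_funX.
Qed.

Lemma L2_opf f : L2 f -> L2 (opf f).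
Proof.
move=> [mf f2]; have ms := measurable_opf mf; split=> //; move: f2; congr (_ < _)%E.
apply/esym; apply: (@integral_measure_preserving -%R (fun x => (f x ^+ 2)%:E)) => //.
- by move=> A mA; exact: lebesgue_measureN.
- by apply/measurable_EFinP; apply: measurable_funX.
Qed.

Lemma H1_shf y f g : H1 f g -> H1 (shf y f) (shf y g).
Proof.
move=> [f2 g2 [cf lg fe]]; have g2' := L2_shf y g2; split=> //; first exact: L2_shf.
apply: prim_intro; first exact: L2_locint.
move=> a b ab; rewrite fe ?lerD2r// Rint_mkcond [RHS]Rint_mkcond.
rewrite -(Rint_shift y); last by apply: measurable_funM => //; exact: L2_meas.
apply: eq_Rintegral => x _; rewrite !fctE !indicE /shf.
have -> // : (x + y \in `[(a + y)%R, (b + y)%R]%classic) = (x \in `[a, b]%classic).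
by apply/idP/idP; rewrite !inE/= !in_itv/= !lerD2r.
Qed.

Lemma H1_opf f g : H1 f g -> H1 (opf f) (- opf g).
Proof.
move=> [f2 g2 [cf lg fe]]; have g2' := L2_opf g2; split; [exact: L2_opf|exact: L2N|].
apply: prim_intro; first by apply: L2_locint; exact: L2N.
move=> a b ab; have ba : - b <= - a by rewrite lerN2.
have -> : \int[mu]_(x in `[a, b]) (- opf g) x = - \int[mu]_(x in `[a, b]) opf g x.
  by rewrite -[- opf g]scaleN1r (RintZ _ _ (L2_locint g2' a b))// mulN1r.
rewrite -[LHS]opprB fe//; congr (- _).
rewrite Rint_mkcond [RHS]Rint_mkcond.
rewrite -Rint_opp; last by apply: measurable_funM => //; exact: L2_meas.
apply: eq_Rintegral => x _; rewrite !fctE !indicE /opf.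
have -> // : (- x \in `[(- b)%R, (- a)%R]%classic) = (x \in `[a, b]%classic).
by apply/idP/idP; rewrite !inE/= !in_itv/= !lerN2 andbC.
Qed.

End ChangeOfVariables.

(** * The soliton through hyperbolic functions *)

Section Soliton.
Context {R : realType}.
Local Notation mu := (@lebesgue_measure R).
Local Notation itg D f := (mu.-integrable D (EFin \o f)).
Implicit Types (f g : R -> R) (a b x y : R).

Lemma prim_is_derive f g : (forall x, is_derive x (1 : R) f (g x)) -> continuous g -> prim f g.
Proof.
move=> df cg; have E : derive1 f = g.
  by apply/funext => x; rewrite derive1E; have [] := df x.
by rewrite -E; apply: prim_C1; [move=> x; have [] := df x|rewrite E].
Qed.

Lemma is_derive_cont f g : (forall x, is_derive x (1 : R) f (g x)) -> continuous f.
Proof. by move=> df x; apply: derivable_cont; have [] := df x. Qed.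

Lemma is_deriveMf f g (f' g' x : R) : is_derive x (1 : R) f f' -> is_derive x (1 : R) g g' ->
  is_derive x (1 : R) (f * g) (f x * g' + g x * f').
Proof. by move=> df dg; have := is_deriveM df dg. Qed.

Lemma is_deriveDf f g (f' g' x : R) : is_derive x (1 : R) f f' -> is_derive x (1 : R) g g' ->
  is_derive x (1 : R) (f + g) (f' + g').
Proof. by move=> df dg; have := is_deriveD df dg. Qed.

Lemma is_deriveZf (c : R) f (f' x : R) : is_derive x (1 : R) f f' ->
  is_derive x (1 : R) (c *: f) (c * f').
Proof. by move=> df; have := is_deriveZ c df. Qed.

Lemma is_derive_cstf (c : R) x : is_derive x (1 : R) (cst c : R -> R) 0.
Proof. exact: is_derive_cst. Qed.

Lemma is_derive_idf x : is_derive x (1 : R) (@idfun R) 1.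
Proof. exact: is_derive_id. Qed.

Lemma is_derive_ext f (l l' x : R) : is_derive x (1 : R) f l -> l = l' -> is_derive x (1 : R) f l'.
Proof. by move=> ? <-. Qed.

Lemma continuousMf f g : continuous f -> continuous g -> continuous (f * g).
Proof. by move=> cf cg x; apply: continuousM; [exact: cf|exact: cg]. Qed.

Lemma continuousDf f g : continuous f -> continuous g -> continuous (f + g).
Proof. by move=> cf cg x; apply: continuousD; [exact: cf|exact: cg]. Qed.

Lemma continuousZf (c : R) f : continuous f -> continuous (c *: f).
Proof.
move=> cf; change (continuous ((cst c : R -> R) * f)); apply: continuousMf => // x.
exact: cst_continuous.
Qed.

Lemma itg_bounded_primitive F h (B : R) : prim F h -> continuous h -> (forall x, 0 <= h x) ->
  (forall x, `|F x| <= B) -> itg setT h.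
Proof.
move=> [_ lh Fh] ch h0 FB; apply/integrableP.
have mh : measurable_fun setT h := continuous_measurable_fun ch.
split; first exact/measurable_EFinP.
pose A (n : nat) : set (measurableTypeR R) := `[- n%:R, n%:R]%classic.
have me : measurable_fun setT (fun x => `|h x|%:E).
  by apply/measurable_EFinP; apply: measurableT_comp.
have := @ge0_nondecreasing_set_cvg_integral _ (measurableTypeR R) _ A (fun x => `|h x|%:E) mu.
have -> : \bigcup_i A i = setT.
  rewrite -subTset => x _; exists (Num.truncn `|x|).+1 => //.
  by rewrite /A/= in_itv/= -ler_norml ltW// truncnS_gt.
move=> /(_ _ _ _ _) H.
have {}H : (\int[mu]_(x in A i) `|h x|%:E)%E @[i --> \oo] --> (\int[mu]_x `|h x|%:E)%E.
  apply: H => //.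
  - move=> n m nm; apply/subsetPset => x; rewrite /A/= !in_itv/=.
    have : n%:R <= m%:R :> R by rewrite ler_nat.
    lra.
  - by move=> i; exact: measurable_itv.
  - by move=> i; apply: measurable_funS me.
apply: (@le_lt_trans _ _ (2 * B)%:E); last by rewrite ltry.
move/cvg_lim : (H) => <- //; apply: lime_le; first by apply/cvg_ex; eexists; exact: H.
apply: nearW => n.
have n0 : - n%:R <= n%:R :> R by have := ler0n R n; lra.
have -> : (\int[mu]_(x in A n) `|h x|%:E = (\int[mu]_(x in `[- n%:R, n%:R]) h x)%:E)%E.
  rewrite /Rintegral fineK; last by apply: integrable_fin_num => //; exact: lh.
  by apply: eq_integral => x _; rewrite ger0_norm.
rewrite -Fh// lee_fin; have := FB n%:R; have := FB (- n%:R).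
rewrite !ler_norml; lra.
Qed.

Variable k : R.
Hypothesis k0 : 0 < k.

(* [th x] is tanh (k x); [qq], [ss] are sech^2 and tanh sech^2 of [k x], so that
   [ss] is proportional to qq'. [Lam] is, up to scaling, the derivative of the
   soliton with respect to its speed. *)
Definition th x : R := (expR (k * x) - expR (- (k * x))) / (expR (k * x) + expR (- (k * x))).
Definition qq : R -> R := cst 1 + (-1) *: (th * th).
Definition ss : R -> R := th * qq.
Definition ss1 : R -> R := k *: (qq * (cst 1 + (-3) *: (th * th))).
Definition qq1 : R -> R := (-2 * k) *: ss.
Definition xq : R -> R := @idfun R * qq.
Definition Lam : R -> R := qq + (- k) *: (@idfun R * ss).
Definition Lam1 : R -> R := (-3 * k) *: ss + (- k) *: (@idfun R * ss1).

Lemma cosh_gt0 x : 0 < expR (k * x) + expR (- (k * x)).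
Proof. by rewrite addr_gt0// expR_gt0. Qed.

Lemma is_derive_th x : is_derive x (1 : R) th (k * qq x).
Proof.
have dl c : is_derive x (1 : R) (fun y : R => expR (c * y)) (expR (c * x) * c).
  have := @is_derive_affine R expR c 0 x (expR (c * x + 0)) (is_derive_expR _).
  by rewrite addr0; congr (is_derive x 1 _ _); apply/funext => y; rewrite addr0.
have dp := dl k; have dm : is_derive x (1 : R) (fun y : R => expR (- (k * y))) (expR (- (k * x)) * (- k)).
  by have := dl (- k); rewrite mulNr; congr (is_derive x 1 _ _); apply/funext => y; rewrite mulNr.
have ds := is_deriveDf dp dm.
have dd := is_deriveDf dp (is_deriveZf (-1) dm).
have sn : ((fun y : R => expR (k * y)) + (fun y : R => expR (- (k * y)))) x != 0.
  by rewrite fctE gt_eqF// cosh_gt0.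
have dv := is_deriveV sn ds.
have H := is_deriveMf dd dv; set g := (X in is_derive _ _ X _) in H.
have -> : th = g by apply/funext => y; rewrite /g /th !fctE /GRing.scale/= mulN1r.
apply: (is_derive_ext H); rewrite /qq !fctE /GRing.scale/= /th.
have e0 := cosh_gt0 x; move: e0; set u := expR (k * x); set v := expR _ => e0.
by field; rewrite gt_eqF.
Qed.

Lemma th0 : th 0 = 0. Proof. by rewrite /th mulr0 oppr0 subrr mul0r. Qed.

Lemma thN x : th (- x) = - th x.
Proof.
rewrite /th mulrN opprK [X in _ / X]addrC; have := cosh_gt0 x.
by set u := expR (k * x); set v := expR _ => e0; field; rewrite gt_eqF.
Qed.

Lemma qqE x : qq x = 1 - th x ^+ 2.
Proof. by rewrite /qq !fctE /GRing.scale/= mulN1r. Qed.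

Lemma qq_gt0 x : 0 < qq x.
Proof.
rewrite qqE; have e0 := cosh_gt0 x; have u0 := expR_gt0 (k * x); have v0 := expR_gt0 (- (k * x)).
rewrite /th; move: e0 u0 v0; set u := expR (k * x); set v := expR _ => e0 u0 v0.
have -> : 1 - ((u - v) / (u + v)) ^+ 2 = 4 * u * v / (u + v) ^+ 2 by field; rewrite gt_eqF.
by rewrite divr_gt0 ?exprn_gt0// !mulr_gt0.
Qed.

Lemma qq_le1 x : qq x <= 1.
Proof. by rewrite qqE gerBl sqr_ge0. Qed.

Lemma th_sqr x : th x ^+ 2 < 1.
Proof. by have := qq_gt0 x; rewrite qqE subr_gt0. Qed.

Lemma th_le1 x : `|th x| <= 1.
Proof.
rewrite -(@ler_pXn2r _ 2)// ?nnegrE// real_normK ?num_real// expr1n; exact: ltW (th_sqr x).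
Qed.

Lemma qqN x : qq (- x) = qq x.
Proof. by rewrite !qqE thN sqrrN. Qed.

Lemma qq_0 : qq 0 = 1. Proof. by rewrite qqE th0 expr0n subr0. Qed.

Lemma sech_qq x : sech (k * x) ^+ 2 = qq x.
Proof.
rewrite qqE /sech /th; have e0 := cosh_gt0 x.
have : expR (k * x) * expR (- (k * x)) = 1 by rewrite expRN divff// gt_eqF// expR_gt0.
move: e0; set u := expR (k * x); set v := expR _ => e0 uv.
have -> : 1 - ((u - v) / (u + v)) ^+ 2 = 4 * (u * v) / (u + v) ^+ 2 by field; rewrite gt_eqF.
by rewrite uv expr_div_n mulr1; congr (_ / _); rewrite expr2; lra.
Qed.

(** [th x = (E - 1) / (E + 1)] with [E = expR (2 k x)], which increases with [E]. *)
Lemma th_lower x (c : R) : c <= expR (2 * (k * x)) -> 0 < c + 1 ->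
  (c - 1) / (c + 1) <= th x.
Proof.
move=> cE c1; rewrite /th; have e0 := cosh_gt0 x.
have uv : expR (k * x) * expR (- (k * x)) = 1 by rewrite expRN divff// gt_eqF// expR_gt0.
have uu : expR (2 * (k * x)) = expR (k * x) * expR (k * x) by rewrite mulr_natl mulr2n expRD.
have u0 := expR_gt0 (k * x); have v0 := expR_gt0 (- (k * x)).
rewrite uu in cE; move: e0 cE uv u0 v0; set u := expR (k * x); set v := expR _ => e0 cE uv u0 v0.
rewrite ler_pdivrMr// mulrAC ler_pdivlMr// -subr_ge0.
have -> : (u - v) * (c + 1) - (c - 1) * (u + v) = 2 * (u - c * v) by ring.
rewrite mulr_ge0// subr_ge0 -(ler_pM2l u0) mulrCA uv mulr1; exact: cE.
Qed.

Lemma is_derive_qq x : is_derive x (1 : R) qq (qq1 x).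
Proof.
have dt := is_derive_th x; have d2 := is_deriveZf (-1) (is_deriveMf dt dt).
apply: (is_derive_ext (is_deriveDf (is_derive_cstf 1 x) d2)).
by rewrite /qq1 /ss !fctE /GRing.scale/=; ring.
Qed.

Lemma is_derive_ss x : is_derive x (1 : R) ss (ss1 x).
Proof.
apply: (is_derive_ext (is_deriveMf (is_derive_th x) (is_derive_qq x))).
by rewrite /ss1 /qq1 /ss /qq !fctE /GRing.scale/=; ring.
Qed.

(* The linearized operator about the soliton is [- d^2/dx^2 + pot], and [ss] is
   in its kernel. *)
Definition pot : R -> R := (4 * k ^+ 2) *: cst 1 + (- 12 * k ^+ 2) *: qq.

Lemma is_derive_ss1 x : is_derive x (1 : R) ss1 (pot x * ss x).
Proof.
have dt := is_derive_th x; have d2 := is_deriveZf (-3) (is_deriveMf dt dt).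
have d3 := is_deriveMf (is_derive_qq x) (is_deriveDf (is_derive_cstf 1 x) d2).
apply: (is_derive_ext (is_deriveZf k d3)).
by rewrite /pot /qq1 /ss /qq !fctE /GRing.scale/=; ring.
Qed.

Lemma is_derive_Lam x : is_derive x (1 : R) Lam (Lam1 x).
Proof.
have d1 := is_deriveMf (is_derive_idf x) (is_derive_ss x).
apply: (is_derive_ext (is_deriveDf (is_derive_qq x) (is_deriveZf (- k) d1))).
by rewrite /Lam1 /qq1 !fctE /GRing.scale/=; ring.
Qed.

Definition Lam2 : R -> R := pot * Lam + (4 * k ^+ 2) *: qq.

Lemma is_derive_Lam1 x : is_derive x (1 : R) Lam1 (Lam2 x).
Proof.
have d1 := is_deriveMf (is_derive_idf x) (is_derive_ss1 x).
have d2 := is_deriveZf (-3 * k) (is_derive_ss x).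
apply: (is_derive_ext (is_deriveDf d2 (is_deriveZf (- k) d1))).
by rewrite /Lam2 /Lam /pot /ss1 /ss /qq !fctE /GRing.scale/=; ring.
Qed.

Lemma qq_cont : continuous qq. Proof. exact: is_derive_cont is_derive_qq. Qed.
Lemma ss_cont : continuous ss. Proof. exact: is_derive_cont is_derive_ss. Qed.
Lemma ss1_cont : continuous ss1. Proof. exact: is_derive_cont is_derive_ss1. Qed.
Lemma Lam_cont : continuous Lam. Proof. exact: is_derive_cont is_derive_Lam. Qed.
Lemma Lam1_cont : continuous Lam1. Proof. exact: is_derive_cont is_derive_Lam1. Qed.
Lemma pot_cont : continuous pot.
Proof.
apply: continuousDf; apply: continuousZf; [move=> x; exact: cst_continuous|exact: qq_cont].
Qed.
Lemma Lam2_cont : continuous Lam2.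
Proof.
apply: continuousDf; [apply: continuousMf; [exact: pot_cont|exact: Lam_cont]|].
by apply: continuousZf; exact: qq_cont.
Qed.

Lemma cont_meas f : continuous f -> measurable_fun setT f.
Proof. exact: continuous_measurable_fun. Qed.

Lemma itg_qq : itg setT qq.
Proof.
have p : prim th (k *: qq).
  apply: prim_is_derive; first exact: is_derive_th.
  by apply: continuousZf; exact: qq_cont.
have p' := primZ k^-1 p.
have e : k^-1 *: (k *: qq) = qq by rewrite scalerA mulVf ?scale1r// gt_eqF.
rewrite e in p'; apply: (itg_bounded_primitive (B := k^-1) p' qq_cont).
- by move=> x; exact: ltW (qq_gt0 x).
- move=> x; rewrite fctE /GRing.scale/= normrM gtr0_norm ?invr_gt0//.
  by rewrite ler_piMr// ?th_le1// invr_ge0 ltW.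
Qed.

Lemma L2_qq : L2 qq.
Proof.
have mq := cont_meas qq_cont; apply: L2_of_sqr => //.
apply: (itg_le _ _ _ itg_qq) => //; first exact: measurable_funM.
move=> x _; rewrite fctE ger0_norm ?mulr_ge0 ?(ltW (qq_gt0 x))//.
by rewrite ler_piMr ?(ltW (qq_gt0 x))// qq_le1.
Qed.

(** From [|k x| <= 2 cosh (k x)]. It gives the square integrability of [x qq], which dominates the
    terms of [Lam] and [Lam1] with a factor [x]. *)
Lemma x2_qq x : x ^+ 2 * qq x <= 4 / k ^+ 2.
Proof.
rewrite -sech_qq /sech; have e0 := cosh_gt0 x.
have xk : `|k * x| <= expR (k * x) + expR (- (k * x)).
  have h1 := expR_ge1Dx (k * x); have h2 := expR_ge1Dx (- (k * x)).
  have h3 := expR_gt0 (k * x); have h4 := expR_gt0 (- (k * x)).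
  rewrite ler_norml; lra.
move: e0 xk; set S := expR _ + _ => e0 xk.
have h : (k * x) ^+ 2 <= S ^+ 2.
  by rewrite -real_normK ?num_real// ler_pXn2r ?nnegrE// ltW.
rewrite ler_pdivlMr ?exprn_gt0//.
have -> : x ^+ 2 * (2 / S) ^+ 2 * k ^+ 2 = 4 * ((k * x) ^+ 2 / S ^+ 2).
  by field; rewrite gt_eqF.
by rewrite ler_piMr// ler_pdivrMr ?exprn_gt0// mul1r.
Qed.

Lemma L2_xq : L2 xq.
Proof.
have mx : measurable_fun setT xq.
  by apply: cont_meas; apply: continuousMf; [move=> x; exact: id|exact: qq_cont].
apply: L2_of_sqr => //.
apply: (itg_le _ _ _ (itgZ (4 / k ^+ 2) _ itg_qq)) => //; first exact: measurable_funM.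
move=> x _; rewrite /xq !fctE /GRing.scale/= ger0_norm -?expr2 ?sqr_ge0//.
by rewrite exprMn [qq x ^+ 2]expr2 mulrA ler_wpM2r ?(ltW (qq_gt0 x))// x2_qq.
Qed.

Lemma qq1E x : qq1 x = - 2 * k * th x * qq x.
Proof. by rewrite /qq1 /ss !fctE /GRing.scale/=; ring. Qed.

Lemma ss_bd x : `|ss x| <= 1 * `|qq x|.
Proof. by rewrite /ss fctE normrM ler_wpM2r// th_le1. Qed.

Lemma ss1_bd x : `|ss1 x| <= (2 * k) * `|qq x|.
Proof.
have -> : ss1 x = (k * (1 - 3 * th x ^+ 2)) * qq x.
  by rewrite /ss1 !fctE /GRing.scale/=; ring.
rewrite normrM ler_wpM2r// normrM gtr0_norm// mulrC ler_wpM2r ?(ltW k0)//.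
have := th_sqr x; have := sqr_ge0 (th x); rewrite ler_norml; lra.
Qed.

Lemma pot_bd x : `|pot x| <= 8 * k ^+ 2.
Proof.
have k2 : 0 < k ^+ 2 by rewrite exprn_gt0.
rewrite /pot !fctE /GRing.scale/= /cst ler_norml.
have := qq_gt0 x; have := qq_le1 x; nra.
Qed.

Lemma L2_ss : L2 ss.
Proof. by apply: (L2_bd (cont_meas ss_cont) ss_bd L2_qq). Qed.

Lemma L2_ss1 : L2 ss1.
Proof. by apply: (L2_bd (cont_meas ss1_cont) ss1_bd L2_qq). Qed.

Lemma L2_pot f : L2 f -> L2 (pot * f).
Proof. by move=> f2; apply: (L2_bdM (cont_meas pot_cont) pot_bd f2). Qed.

Lemma H1_intro f g : L2 f -> L2 g -> (forall x, is_derive x (1 : R) f (g x)) ->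
  continuous g -> H1 f g.
Proof. by move=> f2 g2 df cg; split=> //; exact: prim_is_derive. Qed.

Lemma H1_ss : H1 ss ss1.
Proof. exact: H1_intro L2_ss L2_ss1 is_derive_ss ss1_cont. Qed.

Lemma H1_qq : H1 qq qq1.
Proof.
apply: H1_intro L2_qq _ is_derive_qq _; first by apply: L2Z; exact: L2_ss.
by apply: continuousZf; exact: ss_cont.
Qed.

Lemma H1_ss1 : H1 ss1 (pot * ss).
Proof.
apply: H1_intro L2_ss1 _ is_derive_ss1 _; first exact: L2_pot L2_ss.
by apply: continuousMf; [exact: pot_cont|exact: ss_cont].
Qed.

Lemma L2_Lam : L2 Lam.
Proof.
apply: L2D; first exact: L2_qq.
apply: L2Z; apply: (L2_bd (K := 1) _ _ L2_xq).
  by apply: cont_meas; apply: continuousMf; [move=> x; exact: id|exact: ss_cont].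
by move=> x; change (`|x * ss x| <= 1 * `|x * qq x|); rewrite [`|x * ss x|]normrM [`|x * qq x|]normrM [leRHS]mulrCA ler_wpM2l// ss_bd.
Qed.

Lemma L2_Lam1 : L2 Lam1.
Proof.
apply: L2D; first by apply: L2Z; exact: L2_ss.
apply: L2Z; apply: (L2_bd (K := 2 * k) _ _ L2_xq).
  by apply: cont_meas; apply: continuousMf; [move=> x; exact: id|exact: ss1_cont].
by move=> x; change (`|x * ss1 x| <= 2 * k * `|x * qq x|); rewrite [`|x * ss1 x|]normrM [`|x * qq x|]normrM [leRHS]mulrCA ler_wpM2l// ss1_bd.
Qed.

Lemma L2_Lam2 : L2 Lam2.
Proof. by apply: L2D; [exact: L2_pot L2_Lam|apply: L2Z; exact: L2_qq]. Qed.

Lemma H1_Lam : H1 Lam Lam1.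
Proof. exact: H1_intro L2_Lam L2_Lam1 is_derive_Lam Lam1_cont. Qed.

Lemma H1_Lam1 : H1 Lam1 Lam2.
Proof. exact: H1_intro L2_Lam1 L2_Lam2 is_derive_Lam1 Lam2_cont. Qed.

End Soliton.

(** * Poincare and Riccati inequalities on a half-line *)

Section HalfLine.
Context {R : realType}.
Local Notation mu := (@lebesgue_measure R).
Local Notation itg D f := (mu.-integrable D (EFin \o f)).
Implicit Types (f g : R -> R) (a b m x y : R).
Local Notation T := [set: R].

Lemma ip_setU (D E : set R) f g : measurable D -> measurable E -> L2 f -> L2 g ->
  (forall x, D x -> E x -> False) -> ip (D `|` E) f g = ip D f g + ip E f g.
Proof. by move=> mD mE f2 g2 DE; apply: Rint_setU => //; exact: L2_itgM. Qed.

Lemma ip_oc_cc a b f g : L2 f -> L2 g -> ip `]a, b] f g = ip `[a, b] f g.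
Proof. by move=> f2 g2; apply: Rintegral_itv_obnd_cbnd; exact: (L2_itg _ f2 g2). Qed.

Lemma ip_oy_cy a f g : L2 f -> L2 g -> ip `]a, +oo[ f g = ip `[a, +oo[ f g.
Proof. by move=> f2 g2; apply: Rintegral_itv_obnd_cbnd; exact: (L2_itg _ f2 g2). Qed.

Lemma ip_splitT f g : L2 f -> L2 g -> ip T f g = ip `]-oo, 0] f g + ip `]0, +oo[ f g.
Proof.
move=> f2 g2; rewrite -ip_setU//; last first.
  by move=> x /=; rewrite !in_itv/= andbT leNgt => /negP.
congr (ip _ f g); apply/seteqP; split=> x //= _; rewrite !in_itv/= andbT.
by have [xa|xa] := leP x 0; [left|right].
Qed.

Lemma ip_split_oy a f g : 0 <= a -> L2 f -> L2 g ->
  ip `]0, +oo[ f g = ip `[0, a] f g + ip `]a, +oo[ f g.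
Proof.
move=> a0 f2 g2; rewrite -ip_oc_cc// -ip_setU//; last first.
  by move=> x /=; rewrite !in_itv/= andbT leNgt => /andP[_ /negP].
congr (ip _ f g); apply/seteqP; split=> x /=; rewrite !in_itv/= andbT.
  by move=> x0; rewrite x0; have [xa|xa] := leP x a; [left|right].
rewrite andbT => -[/andP[]//|]; exact: (le_lt_trans a0).
Qed.

Lemma ip_neg_opf f g : L2 f -> L2 g -> ip `]-oo, 0] f g = ip `]0, +oo[ (opf f) (opf g).
Proof.
move=> f2 g2; have [f2' g2'] := (L2_opf f2, L2_opf g2).
rewrite ip_oy_cy// -(ip_opf (D := `]-oo, 0]%classic))//; try exact: L2_meas.
congr (ip _ _ _); apply/seteqP; split=> x /=; rewrite !in_itv/= andbT; lra.
Qed.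

Lemma FTC_CS a x f f1 (A : R) : a <= x -> H1 f f1 -> ip `[a, x] f1 f1 <= A ->
  (f x - f a) ^+ 2 <= (x - a) * A.
Proof.
move=> ax ff1 fA; have [f2 f12 _] := ff1; rewrite (H1_ftc ff1 ax).
(* The constant 1 is not square integrable on the line; on [[a, x]] this indicator stands for it. *)
have i2 := @L2_indic R a (x + 1).
have ind t : t \in `[a, x]%classic -> \1_`[a, x + 1[ t = 1 :> R.
  rewrite inE/= in_itv/= => /andP[at_ tx]; rewrite indicE mem_set//= in_itv/= at_/=.
  by rewrite (le_lt_trans tx)// ltrDl.
have -> : \int[mu]_(t in `[a, x]) f1 t = ip `[a, x] \1_`[a, x + 1[ f1.
  by apply: eq_Rintegral => t tx; rewrite ind// mul1r.
have md : measurable (`[a, x]%classic : set R) by [].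
apply: (le_trans (ip_CS md i2 f12)).
have -> : ip `[a, x] \1_`[a, x + 1[ \1_`[a, x + 1[ = x - a.
  rewrite -[RHS]mul1r -Rint_cst_itv//; apply: eq_Rintegral => t tx; rewrite ind// mul1r//.
by rewrite ler_wpM2l// subr_ge0.
Qed.

Lemma Rint_affine a m (A : R) : a <= m ->
  \int[mu]_(x in `[a, m]) ((x - a) * A) = (m - a) ^+ 2 / 2 * A /\
  \int[mu]_(x in `[a, m]) ((m - x) * A) = (m - a) ^+ 2 / 2 * A.
Proof.
move=> am; have key (c : R) : prim (fun x => (x - c) ^+ 2 / 2 * A) (fun x => (x - c) * A).
  apply: prim_is_derive => [x|].
    have d := is_deriveDf (is_derive_idf x) (is_derive_cstf (- c) x).
    have := is_deriveZf (2^-1 * A) (is_deriveMf d d).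
    set g := (X in is_derive _ _ X _) => H.
    have -> : (fun x => (x - c) ^+ 2 / 2 * A) = g.
      by apply/funext => y; rewrite /g !fctE /GRing.scale/= /cst; field.
    by apply: (is_derive_ext H); rewrite !fctE /cst /=; field.
  move=> x; apply: (@continuousM _ _ (fun x => x - c) (cst A)); last exact: cst_continuous.
  by apply: (@continuousB _ _ _ id (cst c)); [exact: id|exact: cst_continuous].
split; first by have [_ _ <-] := key a; rewrite // subrr expr0n/= mul0r mul0r subr0.
have [_ li e] := primZ (-1) (key m).
transitivity (\int[mu]_(x in `[a, m]) ((-1) *: (fun x => (x - m) * A)) x).
  by apply: eq_Rintegral => x _; rewrite fctE /GRing.scale/=; ring.
by rewrite -e// !fctE /GRing.scale/= subrr; field.
Qed.

(** Each half is estimated from its own endpoint by [FTC_CS], and integrating the distance to the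
    endpoint gives [(m - a)^2 / 2 = (b - a)^2 / 8]. This constant, elementary and not the sharp one,
    is what limits [x_mid]. *)
Lemma poincare_interval a b f f1 : a < b -> H1 f f1 -> f a = 0 -> f b = 0 ->
  ip `[a, b] f f <= (b - a) ^+ 2 / 8 * ip `[a, b] f1 f1.
Proof.
move=> ab ff1 fa fb; have [f2 f12 _] := ff1; pose m := (a + b) / 2.
have am : a <= m by rewrite /m; lra.
have mb : m <= b by rewrite /m; lra.
have sp g : L2 g -> ip `[a, b] g g = ip `[a, m] g g + ip `[m, b] g g.
  by move=> g2; apply: Rint_split => //; apply: itg_locint; exact: L2_itgM.
rewrite !sp// mulrDr.
have s0 (D : set R) := ip_ge0 D f1.
have md u v : measurable (`[u, v]%classic : set R) by [].
have lin (u v c : R) : itg `[u, v] (fun x => (x - c) * ip `[u, v] f1 f1).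
  have -> : (fun x => (x - c) * ip `[u, v] f1 f1) =
     (@idfun R + cst (- c)) * cst (ip `[u, v] f1 f1) by [].
  apply: continuous_locint; apply: continuousMf; last by move=> x; exact: cst_continuous.
  by apply: continuousDf; [move=> x; exact: id|move=> x; exact: cst_continuous].
apply: lerD.
- have -> : (b - a) ^+ 2 / 8 = (m - a) ^+ 2 / 2 by rewrite /m; field.
  rewrite -(Rint_affine _ am).1; apply: le_Rint => //; first exact: L2_itg.
  move=> x /=; rewrite in_itv/= => /andP[ax xm]; rewrite -expr2 -[f x]subr0 -fa.
  apply: (FTC_CS _ ff1) => //; apply: ip_sub => //.
  by move=> y /=; rewrite !in_itv/= => /andP[-> yx]; exact: le_trans yx xm.
- have -> : (b - a) ^+ 2 / 8 = (b - m) ^+ 2 / 2 by rewrite /m; field.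
  rewrite -(Rint_affine _ mb).2; apply: le_Rint => //; first exact: L2_itg.
    have -> : (fun x => (b - x) * ip `[m, b] f1 f1) = - (fun x => (x - b) * ip `[m, b] f1 f1).
      by apply/funext => x; rewrite !fctE; ring.
    by apply: itgN => //; exact: lin.
  move=> x /=; rewrite in_itv/= => /andP[mx xb]; rewrite -expr2 -sqrrN -[- f x]add0r -fb.
  apply: (FTC_CS _ ff1) => //; apply: ip_sub => //.
  by move=> y /=; rewrite !in_itv/= => /andP[xy ->]; rewrite (le_trans mx).
Qed.

(* Integration of [(f' - tau f)^2 >= 0]. *)
Lemma riccati a f f1 tau tau1 (M : R) : H1 f f1 -> f a = 0 -> prim tau tau1 ->
  (forall x, `|tau x| <= M) -> (forall x, `|tau1 x| <= M) -> measurable_fun setT tau1 ->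
  0 <= ip `]a, +oo[ f1 f1 + ip `]a, +oo[ ((tau1 + tau * tau) * f) f.
Proof.
move=> ff1 fa pt tM t1M mt1; have [f2 f12 pf] := ff1.
have [ct _ _] := pt; have mt : measurable_fun setT tau := continuous_measurable_fun ct.
have md : measurable (`]a, +oo[%classic : set R) by [].
have tf := L2_bdM mt tM f2; have tf1 := L2_bdM mt tM f12; have t1f := L2_bdM mt1 t1M f2.
have ttf := L2_bdM mt tM tf.
have H : H1 (tau * f) (tau1 * f + tau * f1).
  by split=> //; [exact: L2D|exact: primM].
have := H1_ibp_right a H ff1; rewrite fa mulr0 oppr0 ipDl//.
have -> : ip `]a, +oo[ (tau * f1) f = ip `]a, +oo[ (tau * f) f1.
  by apply: eq_ip_mul => x _; rewrite !fctE; ring.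
have := ip_ge0 `]a, +oo[ (f1 - tau * f); rewrite ip_sqrB// [ip _ f1 (tau * f)]ipC.
have -> : (tau1 + tau * tau) * f = tau1 * f + tau * (tau * f).
  by apply/funext => x; rewrite !fctE; ring.
rewrite ipDl//.
have -> : ip `]a, +oo[ (tau * (tau * f)) f = ip `]a, +oo[ (tau * f) (tau * f).
  by apply: eq_ip_mul => x _; rewrite !fctE; ring.
lra.
Qed.

Variable k : R.
Hypothesis k0 : 0 < k.
Local Notation th := (@th R k).
Local Notation qq := (@qq R k).
Local Notation pot := (@pot R k).

(* Any point with [x_mid <= sqrt (8 / 8.1) / k] makes the Poincare inequality beat
   [pot >= - 8 k^2] on [0, x_mid]; it must be far enough for the Riccati argument
   on the right, which needs [7 / 10 <= th]. *)
Definition x_mid : R := 97 / 100 / k.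

Lemma x_mid_gt0 : 0 < x_mid. Proof. by rewrite !divr_gt0. Qed.

Lemma th_gt0 x : 0 < x -> 0 < th x.
Proof.
move=> x0; have kx : 0 < k * x by rewrite mulr_gt0.
have := @th_lower R k x (1 + 2 * (k * x)) (expR_ge1Dx _).
have h : 0 < 1 + 2 * (k * x) + 1 by lra.
by move=> /(_ h); apply: lt_le_trans; rewrite divr_gt0//; lra.
Qed.

Lemma th_x_mid x : x_mid <= x -> 7 / 10 <= th x.
Proof.
move=> xx; have kx : 97 / 100 <= k * x by rewrite [k * x]mulrC -ler_pdivrMr.
(* [(17/3 - 1) / (17/3 + 1) = 7/10]. The exponential of [2 * 97/100 = 16 * 97/800] is reached by
   squaring [expR (97/800) >= 28/25] four times. *)
have E : 17 / 3 <= expR (2 * (k * x)).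
  apply: (@le_trans _ _ (expR (16%:R * (97 / 800)))).
    rewrite expRM_natl; have h1 : 28 / 25 <= expR (97 / 800 : R).
      by apply: le_trans (expR_ge1Dx _); lra.
    have sq (e p q : R) : 0 <= p -> p <= e -> q <= p * p -> q <= e ^+ 2.
      by move=> p0 pe qp; apply: (le_trans qp); rewrite expr2 ler_pM.
    have h2 : 5 / 4 <= expR (97 / 800 : R) ^+ 2 by apply: (sq _ (28 / 25)) => //; lra.
    have h4 : 39 / 25 <= expR (97 / 800 : R) ^+ 4.
      by rewrite (exprM _ 2 2); apply: (sq _ (5 / 4)) => //; lra.
    have h8 : 12 / 5 <= expR (97 / 800 : R) ^+ 8.
      by rewrite (exprM _ 4 2); apply: (sq _ (39 / 25)) => //; lra.
    by rewrite (exprM _ 8 2); apply: (sq _ (12 / 5)) => //; lra.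
  by rewrite ler_expR; lra.
have := @th_lower R k x (17 / 3) E; have h : 0 < 17 / 3 + 1 :> R by lra.
by move=> /(_ h); congr (_ <= _); field.
Qed.

Lemma prim_affine_th (p q : R) : prim (cst p + q *: th) (q *: (k *: qq)).
Proof.
have d x : is_derive x (1 : R) (cst p + q *: th) ((q *: (k *: qq)) x).
  apply: (is_derive_ext (is_deriveDf (is_derive_cstf p x) (is_deriveZf q (is_derive_th k x)))).
  by rewrite add0r.
have c : continuous (q *: (k *: qq)) by apply: continuousZf; apply: continuousZf; exact: qq_cont.
exact: prim_is_derive d c.
Qed.

Lemma half_coercive0 f f1 : H1 f f1 -> f 0 = 0 -> f x_mid = 0 ->
  k ^+ 2 / 10 * ip `]0, +oo[ f f <= ip `]0, +oo[ f1 f1 + ip `]0, +oo[ (pot * f) f.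
Proof.
move=> ff1 f0 fm; have [f2 f12 _] := ff1; have pf := L2_pot k0 f2.
have x0 := x_mid_gt0; rewrite !(ip_split_oy (ltW x0))//.
have k2 : 0 < k ^+ 2 by rewrite exprn_gt0.
have h1 : k ^+ 2 / 10 * ip `[0, x_mid] f f <= ip `[0, x_mid] f1 f1 + ip `[0, x_mid] (pot * f) f.
  have := poincare_interval x0 ff1 f0 fm; rewrite subr0.
  have -> : x_mid ^+ 2 / 8 = (97 / 100) ^+ 2 / 8 / k ^+ 2 by rewrite /x_mid; field; rewrite gt_eqF.
  rewrite mulrAC ler_pdivlMr// => P.
  have V : - (8 * k ^+ 2) * ip `[0, x_mid] f f <= ip `[0, x_mid] (pot * f) f.
    rewrite -ipZl//; apply: ip_le => //; first exact: L2Z.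
    move=> x _; rewrite !fctE /GRing.scale/=.
    have := pot_bd k0 x; rewrite ler_norml => /andP[b _]; have := sqr_ge0 (f x).
    rewrite expr2; nra.
  (* [25/3 >= 8 + 1/10]: the derivative term covers both the depth [8 k^2] of the potential and the
     gain [k^2 / 10]. *)
  have A : (97 / 100) ^+ 2 / 8 <= 3 / 25 :> R by rewrite expr2; lra.
  have P' := le_trans P (ler_wpM2r (ip_ge0 _ f1) A).
  have u0 : 0 <= k ^+ 2 * ip `[0, x_mid] f f by rewrite mulr_ge0 ?ip_ge0// ltW.
  have V' : - 8 * (k ^+ 2 * ip `[0, x_mid] f f) <= ip `[0, x_mid] (pot * f) f.
    by apply: le_trans V; rewrite mulrA mulNr.
  move: P' V'; rewrite [_ * k ^+ 2]mulrC [k ^+ 2 / 10 * _]mulrAC.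
  by move: (ip _ f1 f1) (ip _ (pot * f) f) (k ^+ 2 * _) u0; clear => *; lra.
have h2 : k ^+ 2 / 10 * ip `]x_mid, +oo[ f f <= ip `]x_mid, +oo[ f1 f1 + ip `]x_mid, +oo[ (pot * f) f.
  (* An affine function of tanh solving [tau' + tau^2 + k^2 / 10 <= pot] where
     [7 / 10 <= th]. *)
  pose tau := cst (k * (29 / 10)) + (- (k * (48 / 10))) *: th.
  pose tau1 := (- (k * (48 / 10))) *: (k *: qq).
  have pt : prim tau tau1 by exact: prim_affine_th.
  have tM x : `|tau x| <= 8 * k + 8 * k ^+ 2.
    have kt : `|k * th x| <= k by rewrite normrM gtr0_norm// ler_piMr ?(ltW k0)// th_le1.
    have -> : tau x = 29 / 10 * k - 48 / 10 * (k * th x).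
      by rewrite /tau !fctE /GRing.scale/= /cst; ring.
    have : 0 < k ^+ 2 by rewrite exprn_gt0.
    move: kt k0; rewrite !ler_norml; move: (k * th x) (k ^+ 2) => u v /andP[]; lra.
  have t1M x : `|tau1 x| <= 8 * k + 8 * k ^+ 2.
    have -> : tau1 x = - (48 / 10) * (k ^+ 2 * qq x).
      by rewrite /tau1 !fctE /GRing.scale/=; ring.
    have : 0 < k ^+ 2 * qq x by rewrite mulr_gt0// qq_gt0.
    have : k ^+ 2 * qq x <= k ^+ 2 by rewrite ler_piMr ?(ltW k2)// qq_le1.
    rewrite !ler_norml; move: k0 (k ^+ 2 * qq x) (k ^+ 2) => k_gt0 u v; lra.
  have mt1 : measurable_fun setT tau1.
    by apply: cont_meas; do 2 apply: continuousZf; exact: qq_cont.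
  have := riccati ff1 fm pt tM t1M mt1.
  have [ct _ _] := pt; have mt := cont_meas ct.
  have tf : L2 ((tau1 + tau * tau) * f).
    have -> : (tau1 + tau * tau) * f = tau1 * f + tau * (tau * f).
      by apply/funext => x; rewrite !fctE; ring.
    by apply: L2D; [exact: L2_bdM mt1 t1M f2|apply: (L2_bdM mt tM); exact: L2_bdM mt tM f2].
  suff : k ^+ 2 / 10 * ip `]x_mid, +oo[ f f + ip `]x_mid, +oo[ ((tau1 + tau * tau) * f) f <=
      ip `]x_mid, +oo[ (pot * f) f by lra.
  rewrite -ipZl// -ipDl//; last exact: L2Z.
  apply: ip_le => //; first by apply: L2D => //; exact: L2Z.
  move=> x /=; rewrite in_itv/= andbT => /ltW/th_x_mid t7.
  rewrite /pot /tau /tau1 !fctE /GRing.scale/= /cst qqE.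
  have t1 : th x <= 1 by have := th_le1 k x; rewrite ler_norml => /andP[].
  move: (th x) t7 t1 => t t7 t1.
  have ff : 0 <= f x * f x by rewrite -expr2 sqr_ge0.
  (* This polynomial in [t = th x] is [(pot - k^2 / 10 - tau' - tau^2) / k^2]. It is concave, so the
     interval [[7/10, 1]] is settled by its values at the two ends. *)
  have P : 0 <= - (1584 / 100) * t ^+ 2 + 2784 / 100 * t - 1171 / 100.
    have -> : - (1584 / 100) * t ^+ 2 + 2784 / 100 * t - 1171 / 100 =
      1584 / 100 * ((t - 7 / 10) * (1 - t)) + 41 / 50 / 50 + 114 / 125 * (t - 7 / 10).
      by field.
    have : 0 <= (t - 7 / 10) * (1 - t) by rewrite mulr_ge0 ?subr_ge0.
    by move: t7; move: (_ * (1 - t)) => z; clear => *; lra.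
  rewrite -subr_ge0.
  set u := (X in 0 <= X).
  have -> : u = (f x * f x) * (k ^+ 2 * (- (1584 / 100) * t ^+ 2 + 2784 / 100 * t - 1171 / 100)).
    by rewrite /u; field.
  by apply: mulr_ge0; [exact: ff|apply: mulr_ge0; [exact: ltW k2|exact: P]].
by move: h1 h2; lra.
Qed.

End HalfLine.

(** * Coercivity of the linearized quadratic form *)

Section Coercivity.
Context {R : realType}.
Local Notation mu := (@lebesgue_measure R).
Implicit Types (f g : R -> R) (a b x y : R) (D : set R).
Local Notation T := [set: R].

Variable k : R.
Hypothesis k0 : 0 < k.
Local Notation qq := (@qq R k).
Local Notation qq1 := (@qq1 R k).
Local Notation ss := (@ss R k).
Local Notation ss1 := (@ss1 R k).
Local Notation pot := (@pot R k).
Local Notation Lam := (@Lam R k).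
Local Notation Lam1 := (@Lam1 R k).

Definition quad D f f1 : R := ip D f1 f1 + ip D (pot * f) f.

Lemma quadB D b f f1 g g1 : measurable D -> L2 f -> L2 f1 -> L2 g -> L2 g1 ->
  quad D (f - b *: g) (f1 - b *: g1) =
  quad D f f1 - 2 * b * (ip D g1 f1 + ip D (pot * g) f) + b ^+ 2 * quad D g g1.
Proof.
move=> mD f2 f12 g2 g12; have pf := L2_pot k0 f2; have pg := L2_pot k0 g2.
have Zg := L2Z b g2; have Zg1 := L2Z b g12; have Zpg := L2Z b pg; rewrite /quad.
rewrite ip_sqrB// ipZr// (ipZl b _ g12 Zg1)// ipZr//.
have -> : pot * (f - b *: g) = pot * f - b *: (pot * g).
  by apply/funext => x; rewrite !fctE /GRing.scale/=; ring.
have fg := L2B f2 Zg; rewrite ipBl// ipBr// ipZr// (ipZl b _ pg fg)// ipBr// ipZr//.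
have -> : ip D (pot * f) g = ip D (pot * g) f.
  by apply: eq_ip_mul => x _; rewrite !fctE; ring.
by rewrite [ip D f1 g1]ipC; ring.
Qed.

Lemma ssN x : ss (- x) = - ss x.
Proof. by rewrite /ss !fctE thN qqN mulNr. Qed.

Lemma ss_0 : ss 0 = 0.
Proof. by rewrite /ss fctE th0 mul0r. Qed.

Lemma ss_gt0 x : 0 < x -> 0 < ss x.
Proof. by move=> x0; rewrite /ss fctE mulr_gt0 ?qq_gt0// th_gt0. Qed.

(** [ss] lies in the kernel and vanishes at 0, as does [f], so subtracting [b ss] leaves the form on
    the half-line unchanged. The choice of [b] adds the zero at [x_mid] that [half_coercive0] asks
    for. *)
Lemma half_coercive f f1 : H1 f f1 -> f 0 = 0 -> exists b,
  k ^+ 2 / 10 * ip `]0, +oo[ (f - b *: ss) (f - b *: ss) <= quad `]0, +oo[ f f1.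
Proof.
move=> ff1 f0; have [f2 f12 _] := ff1; have Hs := H1_ss k0; have [s2 s12 _] := Hs.
pose b := f (x_mid k) / ss (x_mid k); exists b.
have r := H1B ff1 (H1Z b Hs).
have r0 : (f - b *: ss) 0 = 0.
  by change (f 0 - b * ss 0 = 0); rewrite ss_0 f0 mulr0 subr0.
have rm : (f - b *: ss) (x_mid k) = 0.
  by change (f (x_mid k) - b * ss (x_mid k) = 0); rewrite /b divfK ?subrr// gt_eqF// ss_gt0// x_mid_gt0.
apply: (le_trans (half_coercive0 k0 r r0 rm)); rewrite -/(quad _ _ _).
have md : measurable (`]0, +oo[%classic : set R) by [].
have := H1_ibp_right 0 (H1_ss1 k0) ff1; have := H1_ibp_right 0 (H1_ss1 k0) Hs.
rewrite f0 ss_0 !mulr0 oppr0 => i1 i2.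
rewrite (quadB b md f2 f12 s2 s12) {2}/quad [ip _ ss1 f1 + _]addrC i2.
by rewrite [ip _ ss1 ss1 + _]addrC i1 !mulr0 subr0 addr0.
Qed.

(** The zero at the center decouples the two half-lines, at the price of two independent multiples
    of [ss]; the left one comes by reflection. *)
Lemma two_sided_coercive f f1 : H1 f f1 -> f 0 = 0 -> exists b b',
  k ^+ 2 / 10 * (ip `]0, +oo[ (f - b *: ss) (f - b *: ss) +
    ip `]-oo, 0] (f - b' *: ss) (f - b' *: ss)) <= quad T f f1.
Proof.
move=> ff1 f0; have [f2 f12 _] := ff1; have [b hb] := half_coercive ff1 f0.
have s2 := L2_ss k0.
have [|b' hb'] := half_coercive (H1_opf ff1); first by rewrite /opf oppr0.
exists b, (- b'); rewrite mulrDr.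
have pf := L2_pot k0 f2.
have -> : quad T f f1 = quad `]0, +oo[ f f1 + quad `]0, +oo[ (opf f) (- opf f1).
  rewrite /quad !ip_splitT// !ip_neg_opf//.
  have -> : ip `]0, +oo[ (- opf f1) (- opf f1) = ip `]0, +oo[ (opf f1) (opf f1).
    by apply: eq_ip_mul => x _; rewrite !fctE mulrNN.
  have -> : opf (pot * f) = pot * opf f.
    by apply/funext => x; rewrite /opf /pot !fctE qqN.
  by ring.
have r2 : L2 (f - (- b') *: ss) by apply: L2B f2 _; exact: L2Z.
rewrite (ip_neg_opf r2 r2).
have -> : opf (f - (- b') *: ss) = opf f - b' *: ss.
  by apply/funext => x; rewrite /opf !fctE /GRing.scale/= ssN; ring.
exact: lerD hb hb'.
Qed.

Lemma ip_ss_qq : ip `]0, +oo[ ss qq = (4 * k)^-1 /\ ip `]-oo, 0] ss qq = - (4 * k)^-1.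
Proof.
have Hq := H1_qq k0; have [q2 q12 _] := Hq; have s2 := L2_ss k0.
have md : measurable (`]0, +oo[%classic : set R) by [].
have md' : measurable (`]-oo, 0]%classic : set R) by [].
have kn : k != 0 by rewrite gt_eqF.
have := H1_ibp_right 0 Hq Hq; have := H1_ibp_left 0 Hq Hq.
rewrite ![ip _ qq qq1]ipC /qq1 !ipZl// qq_0 mulr1.
have k4 : 4 * k != 0 by rewrite mulf_neq0// pnatr_eq0.
by move=> h h'; split; apply: (mulfI k4); rewrite ?mulrN divff//; lra.
Qed.

Lemma ip_qq_qq_gt0 : 0 < ip T qq qq.
Proof.
have q2 := L2_qq k0; have s2 := L2_ss k0.
have md : measurable (`]0, +oo[%classic : set R) by [].
apply: (@lt_le_trans _ _ (ip `]0, +oo[ ss qq)).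
  by rewrite ip_ss_qq.1 invr_gt0 mulr_gt0.
apply: le_trans (ip_leT md q2); apply: ip_le => // x _.
rewrite ler_wpM2r ?(ltW (qq_gt0 k x))//; have := ss_bd k x.
by rewrite mul1r ler_norml gtr0_norm ?qq_gt0// => /andP[].
Qed.

(** The integral of [x qq qq'] is [- 1/2] times the squared norm of [qq], which makes the pairing
    [3/4] of that norm. Its sign is the slope condition for stability: the mass of the soliton
    increases with its speed. *)
Lemma ip_qq_Lam_gt0 : 0 < ip T qq Lam.
Proof.
have Hq := H1_qq k0; have [q2 q12 _] := Hq; have x2 := L2_xq k0.
pose xq1 := qq + @idfun R * qq1.
have xs2 : L2 (@idfun R * ss).
  apply: (L2_bd (K := 1) _ _ x2).
    by apply: cont_meas; apply: continuousMf; [move=> x; exact: id|exact: ss_cont].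
  by move=> x; change (`|x * ss x| <= 1 * `|x * qq x|); rewrite [`|x * ss x|]normrM [`|x * qq x|]normrM [leRHS]mulrCA ler_wpM2l// ss_bd.
have E : @idfun R * qq1 = (-2 * k) *: (@idfun R * ss).
  by apply/funext => x; rewrite /qq1 !fctE /GRing.scale/=; ring.
have xq12 : L2 xq1 by apply: L2D => //; rewrite E; exact: L2Z.
have dx x : is_derive x (1 : R) (xq k) (xq1 x).
  apply: (is_derive_ext (is_deriveMf (is_derive_idf x) (is_derive_qq k x))).
  by rewrite /xq1 !fctE /=; ring.
have cx : continuous xq1.
  apply: continuousDf; first exact: qq_cont.
  apply: continuousMf; first by move=> x; exact: id.
  by apply: continuousZf; exact: ss_cont.
have Hx := H1_intro x2 xq12 dx cx.
have := H1_ibp Hx Hq; rewrite /xq1 ipDl//; last by rewrite E; exact: L2Z.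
have -> : ip T (xq k) qq1 = ip T (@idfun R * qq1) qq.
  by apply: eq_ip_mul => x _; rewrite /xq !fctE; ring.
rewrite E ipZl// => h.
have -> : ip T qq Lam = 3 / 4 * ip T qq qq.
  have zx := L2Z (- k) xs2.
  by rewrite /Lam ipDr// ipZr// [ip T qq (_ * ss)]ipC; move: h; lra.
by rewrite mulr_gt0 ?ip_qq_qq_gt0.
Qed.

Lemma Lam_0 : Lam 0 = 1.
Proof. by rewrite /Lam !fctE /GRing.scale/= mul0r mulr0 addr0 qq_0. Qed.

(* [Lam] solves [- Lam'' + pot * Lam = - 4 k^2 qq]. *)
Lemma ip_Lam g g1 : H1 g g1 -> ip T Lam1 g1 + ip T (pot * Lam) g = - (4 * k ^+ 2) * ip T qq g.
Proof.
move=> gg1; have [g2 _ _] := gg1; have := H1_ibp (H1_Lam1 k0) gg1.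
have q2 := L2_qq k0; have l2 := L2_pot k0 (L2_Lam k0).
rewrite /Lam2 (ipDl _ l2 (L2Z _ q2))// ipZl//; lra.
Qed.

Lemma sqrD2 (x y : R) : (x + y) ^+ 2 <= 2 * (x ^+ 2 + y ^+ 2).
Proof. by have := sqr_ge0 (x - y); rewrite !expr2; lra. Qed.

Lemma sqrD4 (x y z t : R) :
  (x + y + (z + t)) ^+ 2 <= 4 * (x ^+ 2 + y ^+ 2 + z ^+ 2 + t ^+ 2).
Proof.
have := sqrD2 (x + y) (z + t); have := sqrD2 x y; have := sqrD2 z t.
move: ((x + y) ^+ 2) ((z + t) ^+ 2) ((x + y + (z + t)) ^+ 2) (x ^+ 2) (y ^+ 2) (z ^+ 2) (t ^+ 2).
by move=> *; lra.
Qed.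

Lemma ip_sqrD2 D f g : measurable D -> L2 f -> L2 g ->
  ip D (f + g) (f + g) <= 2 * (ip D f f + ip D g g).
Proof.
by move=> mD f2 g2; have := ip_ge0 D (f - g); rewrite ip_sqrB// ip_sqrD//; lra.
Qed.

Section Orthogonal.
Variable phi : R -> R.
Hypothesis phi2 : L2 phi.
Hypothesis phi0 : forall x, x <= 0 -> phi x = 0.
Hypothesis ss_phi : 0 < ip `]0, +oo[ ss phi.
Local Notation P := (`]0, +oo[%classic : set R).
Local Notation N := (`]-oo, 0]%classic : set R).

(* The two half-line multiples of [ss] are controlled by the two orthogonality
   relations, against [phi] (supported on the right) and against [qq]. *)
Lemma coercive_reduced : exists2 K, 0 < K & forall f f1 a M del, H1 f f1 -> f 0 = 0 ->
  ip P f phi = - a * ip P Lam phi -> `|ip T qq f + a * ip T qq Lam| <= M ->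
  a ^+ 2 <= del -> quad T f f1 <= del -> M ^+ 2 <= del ->
  ip T f f <= K * del.
Proof.
have s2 := L2_ss k0; have q2 := L2_qq k0; have l2 := L2_Lam k0.
have mP : measurable P by []. have mN : measurable N by [].
set m := ip P ss phi; set B := ip P phi phi; set l := ip P Lam phi; set n := ip T qq Lam.
set S := ip T ss ss; set G := ip T qq qq.
have B0 : 0 <= B by exact: ip_ge0. have G0 : 0 <= G by exact: ip_ge0.
have S0 : 0 <= S by exact: ip_ge0.
pose K1 := 10 / k ^+ 2.
have k2 : 0 < k ^+ 2 by rewrite exprn_gt0.
have K1_gt0 : 0 < K1 by rewrite divr_gt0.
pose Kb := 2 * (K1 * B + l ^+ 2) / m ^+ 2.
have m2 : 0 < m ^+ 2 by rewrite exprn_gt0.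
have Kb0 : 0 <= Kb by rewrite divr_ge0 ?(ltW m2)// mulr_ge0// addr_ge0 ?sqr_ge0// mulr_ge0// ltW.
pose Kc := 2 * Kb + (4 * k) ^+ 2 * 8 * (2 * K1 * G + n ^+ 2 + 1).
have Kc0 : 0 <= Kc.
  have i0 : 0 <= 2 * K1 * G + n ^+ 2 + 1.
    by rewrite !addr_ge0 ?sqr_ge0// mulr_ge0// mulr_ge0// ltW.
  apply: addr_ge0; first by rewrite mulr_ge0.
  by apply: mulr_ge0 => //; apply: mulr_ge0 => //; exact: sqr_ge0.
exists (2 * (2 * K1 + Kb * S + Kc * S) + 1).
  by have K10 := ltW K1_gt0; rewrite ltr_wpDl// mulr_ge0// !addr_ge0// mulr_ge0.
move=> f f1 a M del ff1 f0 hphi hqq ha hq hM; have [f2 f12 _] := ff1.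
have [b [b' hb]] := two_sided_coercive ff1 f0.
have d0 : 0 <= del by apply: le_trans ha; exact: sqr_ge0.
set r := f - b *: ss in hb; set r' := f - b' *: ss in hb.
have r2 : L2 r by apply: L2B => //; exact: L2Z.
have r2' : L2 r' by apply: L2B => //; exact: L2Z.
have bs := L2Z b s2; have bs' := L2Z b' s2.
have fE : f = r + b *: ss by rewrite /r subrK.
have fE' : f = r' + b' *: ss by rewrite /r' subrK.
clearbody r r'.
have XY : ip P r r + ip N r' r' <= K1 * del.
  have : k ^+ 2 / 10 * (ip P r r + ip N r' r') <= del by apply: le_trans hq.
  have -> : K1 = (k ^+ 2 / 10)^-1 by rewrite invf_div.
  by rewrite (@ler_pdivlMl _ (k ^+ 2 / 10)) ?divr_gt0.
have X0 := ip_ge0 P r; have Y0 := ip_ge0 N r'.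
have X : ip P r r <= K1 * del by lra.
have Y : ip N r' r' <= K1 * del by lra.
(* [phi] sees only the right half-line, so its relation gives [b m] in terms of the remainder [r]
   and of [a]. *)
have hb2 : b ^+ 2 <= Kb * del.
  rewrite /Kb mulrAC ler_pdivlMr// -exprMn.
  have -> : b * m = - (ip P r phi) + (- (a * l)).
    by move: hphi; rewrite {1}fE ipDl// ipZl// -/m -/l; lra.
  apply: (le_trans (sqrD2 _ _)); rewrite !sqrrN -mulrA ler_pM2l// mulrDl lerD//.
    by apply: (le_trans (ip_CS mP r2 phi2)); rewrite mulrAC ler_wpM2r.
  by rewrite exprMn mulrC ler_wpM2l// sqr_ge0.
have hb2' : b' ^+ 2 <= Kc * del.
  have [pq pq'] := ip_ss_qq.
  have i4 : (4 * k)^-1 != 0 :> R by rewrite invr_eq0 mulf_neq0 ?pnatr_eq0// gt_eqF.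
  pose v := ip T qq f + a * n.
  (* Pairing with [qq] gives [b - b'], since the half-line pairings of [ss] with [qq] are [1/(4k)]
     and [-1/(4k)]. *)
  have E : b' = b + (4 * k) * ((ip P r qq + ip N r' qq) + (a * n + - v)).
    rewrite /v ip_splitT// [ip P qq f]ipC [ip N qq f]ipC {1}fE' {1}fE !ipDl// !ipZl// pq pq'.
    by field; rewrite gt_eqF.
  have c1 : ip P r qq ^+ 2 <= K1 * del * G.
    apply: (le_trans (ip_CS mP r2 q2)); rewrite ler_pM ?ip_ge0//; exact: ip_leT.
  have c2 : ip N r' qq ^+ 2 <= K1 * del * G.
    apply: (le_trans (ip_CS mN r2' q2)); rewrite ler_pM ?ip_ge0//; exact: ip_leT.
  have c3 : (a * n) ^+ 2 <= del * n ^+ 2 by rewrite exprMn ler_wpM2r// sqr_ge0.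
  have c4 : (- v) ^+ 2 <= del.
    rewrite sqrrN; apply: le_trans hM; rewrite -real_normK ?num_real//.
    by rewrite lerXn2r// nnegrE (le_trans _ hqq).
  rewrite {1}E; apply: (le_trans (sqrD2 _ _)); rewrite /Kc exprMn.
  have h4 : (ip P r qq + ip N r' qq + (a * n + - v)) ^+ 2 <= 4 * (2 * K1 * G + n ^+ 2 + 1) * del.
    have -> : 4 * (2 * K1 * G + n ^+ 2 + 1) * del =
      4 * (K1 * del * G + K1 * del * G + del * n ^+ 2 + del) by ring.
    by apply: (le_trans (sqrD4 _ _ _ _)); rewrite ler_pM2l// !lerD.
  have h5 := ler_wpM2l (sqr_ge0 (4 * k)) h4; lra.
have hP : ip P f f <= 2 * (K1 * del + Kb * del * S).
  rewrite {1 2}fE; apply: (le_trans (ip_sqrD2 mP r2 bs)).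
  rewrite ler_pM2l// lerD// ipZl// ipZr// mulrA -expr2 ler_pM ?sqr_ge0 ?ip_ge0//.
  exact: ip_leT.
have hN : ip N f f <= 2 * (K1 * del + Kc * del * S).
  rewrite {1 2}fE'; apply: (le_trans (ip_sqrD2 mN r2' bs')).
  rewrite ler_pM2l// lerD// ipZl// ipZr// mulrA -expr2 ler_pM ?sqr_ge0 ?ip_ge0//.
  exact: ip_leT.
rewrite ip_splitT//; apply: (le_trans (lerD hN hP)).
by rewrite -subr_ge0; set u := (X in 0 <= X); have -> : u = del by rewrite /u; ring.
Qed.

(** Subtracting [a Lam] with [a = w 0] creates the zero at the center. By the equation for [Lam],
    the form changes by [8 k^2 a M - 4 k^2 n a^2], where [M] is the pairing of [w] with [qq] and
    [n > 0] that of [Lam]. As the form of the difference is nonnegative, the negative term bounds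
    [a] itself. *)
Lemma coercive : exists2 K, 0 < K & forall w w1 del, H1 w w1 -> 0 <= del ->
  ip T w phi = 0 -> quad T w w1 <= del ->
  nrm2 w w1 <= K * (del + ip T qq w ^+ 2).
Proof.
have [K K0 HK] := coercive_reduced; have HL := H1_Lam k0; have [l2 l12 _] := HL.
have q2 := L2_qq k0; have n0 := ip_qq_Lam_gt0; set n := ip T qq Lam in n0.
set G := ip T Lam Lam; have G0 : 0 <= G by exact: ip_ge0.
have k2 : 0 < k ^+ 2 by rewrite exprn_gt0.
pose K1 := 1 + 8 * k ^+ 2 / n + (2 * k ^+ 2 * n)^-1 * (1 + 8 * k ^+ 2 / n).
have A0 : 0 <= 8 * k ^+ 2 / n by rewrite divr_ge0 ?(ltW n0)// mulr_ge0// ltW.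
have K10 : 0 <= K1.
  by rewrite !addr_ge0// mulr_ge0 ?addr_ge0// invr_ge0 !mulr_ge0 ?(ltW k2)// ltW.
pose K2 := 2 * K * K1 + 2 * K1 * G.
have K20 : 0 <= K2 by rewrite addr_ge0// !mulr_ge0// ltW.
exists (K2 * (1 + 8 * k ^+ 2) + 1).
  by rewrite ltr_wpDl// mulr_ge0// addr_ge0// mulr_ge0// ltW.
move=> w w1 del ww1 d0 wphi hq; have [w2 w12 _] := ww1.
set M := ip T qq w; set E := del + M ^+ 2; pose a := w 0.
have M20 := sqr_ge0 M; have E0 : 0 <= E by rewrite addr_ge0.
pose f := w - a *: Lam; pose f1 := w1 - a *: Lam1.
have ff1 : H1 f f1 by exact: H1B ww1 (H1Z a HL).
have f0 : f 0 = 0 by rewrite /f !fctE /GRing.scale/= Lam_0 mulr1 subrr.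
have qE : quad T f f1 = quad T w w1 + 8 * k ^+ 2 * (a * M) - 4 * k ^+ 2 * n * a ^+ 2.
  have mT : measurable T by []. rewrite (quadB a mT w2 w12 l2 l12) /quad !ip_Lam//.
  by rewrite -/M -/n; ring.
(* Young: [8 k^2 a M <= 2 k^2 n a^2 + 8 k^2 M^2 / n] *)
have Y : 8 * k ^+ 2 * (a * M) <= 2 * k ^+ 2 * n * a ^+ 2 + 8 * k ^+ 2 / n * M ^+ 2.
  rewrite -subr_ge0; set u := (X in 0 <= X).
  have -> : u = 2 * k ^+ 2 / n * (n * a - 2 * M) ^+ 2 by rewrite /u; field; rewrite gt_eqF.
  by rewrite mulr_ge0 ?sqr_ge0// divr_ge0 ?(ltW n0)// mulr_ge0// ltW.
have Lb : quad T f f1 + 2 * k ^+ 2 * n * a ^+ 2 <= (1 + 8 * k ^+ 2 / n) * E.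
  have e : 4 * k ^+ 2 * n * a ^+ 2 = 2 * (2 * k ^+ 2 * n * a ^+ 2) by ring.
  have : 0 <= 8 * k ^+ 2 / n * del by rewrite mulr_ge0.
  rewrite qE /E e; have -> : (1 + 8 * k ^+ 2 / n) * (del + M ^+ 2) =
    del + M ^+ 2 + (8 * k ^+ 2 / n * M ^+ 2 + 8 * k ^+ 2 / n * del) by ring.
  move: (8 * k ^+ 2 * (a * M)) (2 * k ^+ 2 * n * a ^+ 2) Y => u1 u2.
  move: (8 * k ^+ 2 / n * M ^+ 2) (8 * k ^+ 2 / n * del) (M ^+ 2) M20 => u3 u4 u5.
  move: (quad T w w1) hq => u6; lra.
have [b [b' hb]] := two_sided_coercive ff1 f0.
have qf0 : 0 <= quad T f f1.
  by apply: le_trans hb; rewrite mulr_ge0 ?addr_ge0 ?ip_ge0// divr_ge0// ltW.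
have c0 : 0 < 2 * k ^+ 2 * n by rewrite !mulr_gt0.
have ca : 0 <= 2 * k ^+ 2 * n * a ^+ 2 by rewrite mulr_ge0 ?sqr_ge0// ltW.
have K1E : (1 + 8 * k ^+ 2 / n) * E <= K1 * E.
  by rewrite ler_wpM2r// /K1 lerDl mulr_ge0 ?addr_ge0// invr_ge0 ltW.
have ha : a ^+ 2 <= K1 * E.
  apply: (@le_trans _ _ ((2 * k ^+ 2 * n)^-1 * ((1 + 8 * k ^+ 2 / n) * E))).
    by rewrite ler_pdivlMl//; lra.
  by rewrite mulrA ler_wpM2r// /K1 lerDr addr_ge0.
have hqf : quad T f f1 <= K1 * E by lra.
have hM : `|M| ^+ 2 <= K1 * E.
  rewrite real_normK ?num_real//; apply: le_trans K1E.
  have : 0 <= 8 * k ^+ 2 / n * E by rewrite mulr_ge0.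
  by rewrite [(1 + _) * E]mulrDl mul1r => h; apply: (@le_trans _ _ E); rewrite /E ?lerDr ?lerDl.
have wE : w = f + a *: Lam by rewrite /f subrK.
have al := L2Z a l2; have [f2 f12 _] := ff1.
have hf : ip T f f <= K * (K1 * E).
  apply: (HK f f1 a `|M| _ ff1 f0 _ _ ha hqf hM); last first.
    by rewrite /M {1}wE ipDr// ipZr.
  have tot g : L2 g -> ip T g phi = ip P g phi.
    move=> g2; rewrite ip_splitT// (_ : ip N g phi = 0) ?add0r//.
    rewrite (_ : ip N g phi = ip N 0 phi); last first.
      by apply: eq_ip_mul => x /=; rewrite in_itv/= => xn; rewrite phi0// mulr0 mulr0.
    by rewrite -(scale0r (0 : R -> R)) ipZl ?mul0r//; exact: L2_0.
  by move: wphi; rewrite tot// {1}wE ipDl// ipZl//; lra.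
have hw : ip T w w <= K2 * E.
  rewrite {1 2}wE; apply: (le_trans (ip_sqrD2 _ f2 al)) => //.
  have -> : K2 * E = 2 * (K * (K1 * E) + (K1 * E) * G) by rewrite /K2; ring.
  by rewrite ler_pM2l// lerD// ipZl// ipZr// mulrA -expr2 ler_wpM2r.
(* The potential is bounded, so the form returns the derivative once the L^2 norm is known. *)
have hw1 : ip T w1 w1 <= del + 8 * k ^+ 2 * ip T w w.
  have p0 : 0 <= 8 * k ^+ 2 by rewrite mulr_ge0// ltW.
  have := ip_cubic_bound (@measurableT _ _) (cont_meas (@pot_cont R k)) w2 p0 (pot_bd k0).
  by rewrite ler_norml => /andP[h _]; move: hq h; rewrite /quad; lra.
have h8 : (8 * k ^+ 2) * ip T w w <= 8 * k ^+ 2 * (K2 * E) by rewrite ler_wpM2l// mulr_ge0// ltW.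
have -> : (K2 * (1 + 8 * k ^+ 2) + 1) * E = K2 * E + (8 * k ^+ 2 * (K2 * E) + (del + M ^+ 2)).
  by rewrite /E; ring.
by rewrite /nrm2 lerD// (le_trans hw1)// addrC lerD// lerDl.
Qed.

End Orthogonal.
End Coercivity.

(** * The Lyapunov functional at the soliton *)

Section Stability.
Context {R : realType}.
Implicit Types (f g v w : R -> R) (a b x y : R) (D : set R).
Local Notation T := [set: R].

Variable k : R.
Hypothesis k0 : 0 < k.
Local Notation qq := (@qq R k).
Local Notation qq1 := (@qq1 R k).
Local Notation ss := (@ss R k).
Local Notation ss1 := (@ss1 R k).
Local Notation pot := (@pot R k).
Local Notation quad := (@quad R k).

(* The soliton of speed [4 k^2]. *)
Definition sol : R -> R := (6 * k ^+ 2) *: qq.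
Definition sol1 : R -> R := (6 * k ^+ 2) *: qq1.

Lemma H1_sol : H1 sol sol1. Proof. exact: H1Z _ (H1_qq k0). Qed.

(** The profile equation [Q'' = c Q - Q^2], with [c = 4 k^2], in weak form. *)
Lemma ip_sol1 w w1 : H1 w w1 ->
  ip T sol1 w1 = ip T (sol * sol) w - 4 * k ^+ 2 * ip T sol w.
Proof.
move=> ww1; have [w2 w12 _] := ww1; have [s2 s12 _] := H1_ss k0; have q2 := L2_qq k0.
have qq2 : L2 (qq * qq) := L2_H1M (H1_qq k0) q2.
have h := H1_ibp (H1_ss k0) ww1.
have E1 : ip T sol1 w1 = - 12 * k ^+ 3 * ip T ss w1.
  have -> : sol1 = (- 12 * k ^+ 3) *: ss.
    by apply/funext => x; rewrite /sol1 /qq1 !fctE /GRing.scale/=; ring.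
  by rewrite ipZl.
have E2 : ip T ss1 w = k * (3 * ip T (qq * qq) w - 2 * ip T qq w).
  have -> : ss1 = k *: (3 *: (qq * qq) - 2 *: qq).
    by apply/funext => x; rewrite /ss1 /qq !fctE /GRing.scale/= /cst; ring.
  have Z1 := L2Z 3 qq2; have Z2 := L2Z 2 q2; have B := L2B Z1 Z2.
  by rewrite ipZl// ipBl// !ipZl.
have -> : sol * sol = (36 * k ^+ 4) *: (qq * qq).
  by apply/funext => x; rewrite /sol !fctE /GRing.scale/=; ring.
rewrite E1 (ipZl _ measurableT qq2 w2) /sol (ipZl _ measurableT q2 w2).
have -> : ip T ss w1 = - ip T ss1 w by lra.
by rewrite E2; ring.
Qed.

Lemma energy_sol w w1 : H1 w w1 -> energy (sol + w) (sol1 + w1) - energy sol sol1 =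
  - (4 * k ^+ 2) * ip T sol w + ip T w1 w1 / 2 - ip T (sol * w) w - ip T (w * w) w / 3.
Proof.
move=> ww1; have [w2 w12 _] := ww1; have [s2 s12 _] := H1_sol.
have ss2 := L2_H1M H1_sol s2; have sw := L2_H1M H1_sol w2; have w22 := L2_H1M ww1 w2.
rewrite /energy ip_sqrD// (cubic_expand measurableT (L2_meas s2) (L2_meas w2))//.
by rewrite (ip_sol1 ww1); field.
Qed.

Lemma quad_sol w w1 : H1 w w1 ->
  quad T w w1 = ip T w1 w1 + 4 * k ^+ 2 * ip T w w - 2 * ip T (sol * w) w.
Proof.
move=> ww1; have [w2 w12 _] := ww1; have [s2 s12 _] := H1_sol.
have sw := L2_H1M H1_sol w2.
rewrite /quad; have -> : pot * w = (4 * k ^+ 2) *: w - 2 *: (sol * w).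
  by apply/funext => x; rewrite /pot /sol !fctE /GRing.scale/= /cst; ring.
rewrite (ipBl measurableT (L2Z _ w2) (L2Z _ sw) w2) (ipZl _ measurableT w2 w2).
by rewrite (ipZl _ measurableT sw w2); ring.
Qed.

Lemma lyapunov w w1 : H1 w w1 ->
  energy (sol + w) (sol1 + w1) - energy sol sol1 +
    2 * k ^+ 2 * (ip T (sol + w) (sol + w) - ip T sol sol) =
  quad T w w1 / 2 - ip T (w * w) w / 3.
Proof.
move=> ww1; have [w2 w12 _] := ww1; have [s2 s12 _] := H1_sol.
by rewrite (energy_sol ww1) (quad_sol ww1) ip_sqrD//; field.
Qed.

Lemma ip_cube_small w w1 (e : R) : H1 w w1 -> 0 <= e -> nrm2 w w1 <= e ^+ 2 ->
  `|ip T (w * w) w| <= e * nrm2 w w1.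
Proof.
move=> ww1 e0 he; have [w2 w12 _] := ww1.
have wb x : `|w x| <= e := H1_sup_bd x ww1 e0 he.
apply: (le_trans (ip_cubic_bound measurableT (L2_meas w2) w2 e0 wb)).
by rewrite ler_wpM2l// lerDl ip_ge0.
Qed.

Lemma ip_solM_bound w : L2 w -> `|ip T (sol * w) w| <= 6 * k ^+ 2 * ip T w w.
Proof.
move=> w2; have A0 : 0 <= 6 * k ^+ 2 by rewrite mulr_ge0 ?sqr_ge0.
apply: (ip_cubic_bound measurableT (L2_meas (H1_L2 H1_sol)) w2 A0) => x.
rewrite /sol /GRing.scale/= normrM ger0_norm// ler_piMr//.
by rewrite gtr0_norm ?qq_gt0// qq_le1.
Qed.

Section Orthogonal.
Variable phi : R -> R.
Hypothesis phi2 : L2 phi.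
Hypothesis phi0 : forall x, x <= 0 -> phi x = 0.
Hypothesis ss_phi : 0 < ip `]0, +oo[ ss phi.

(* Mass and energy are only non-increasing. The mass inequality bounds [ip T sol w]
   from above, and the energy inequality bounds it from below. *)
Lemma stability_bounds : exists K, 0 < K /\
  forall w w1 v v1 (al e : R), H1 w w1 -> H1 v v1 -> 0 <= al <= 1 -> 0 <= e <= 1 ->
  nrm2 w w1 <= e ^+ 2 -> nrm2 v v1 <= al ^+ 2 ->
  ip T (sol + w) (sol + w) <= ip T (sol + v) (sol + v) ->
  energy (sol + w) (sol1 + w1) <= energy (sol + v) (sol1 + v1) ->
  quad T w w1 <= K * al ^+ 2 + e * nrm2 w w1 /\
  `|ip T sol w| <= K * (al + nrm2 w w1).
Proof.
have k2 : 0 < k ^+ 2 by rewrite exprn_gt0.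
have [G G1 GG] : exists2 G, 1 <= G & ip T sol sol <= G ^+ 2.
  have G0 : 0 <= ip T sol sol by exact: ip_ge0.
  by exists (ip T sol sol + 1); rewrite ?lerDr// expr2; nra.
have G0 : 0 <= G by lra.
pose k4 := (4 * k ^+ 2)^-1.
have k40 : 0 < k4 by rewrite invr_gt0 mulr_gt0.
have D0 : 0 <= k4 * (4 * k ^+ 2 * G + 2 + 6 * k ^+ 2).
  by rewrite mulr_ge0 ?(ltW k40)// addr_ge0 ?addr_ge0 ?mulr_ge0// ltW.
pose K := 2 + 16 * k ^+ 2 + G + k4 * (4 * k ^+ 2 * G + 2 + 6 * k ^+ 2).
have KA : 2 + 16 * k ^+ 2 <= K by rewrite /K; move: (k4 * _) D0 => z; lra.
have KB : G + 1 <= K by rewrite /K; move: (k4 * _) D0 => z; lra.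
have KC : k4 * (4 * k ^+ 2 * G + 2 + 6 * k ^+ 2) <= K.
  by rewrite /K; move: (k4 * _) D0 => z; lra.
have K0 : 0 < K by apply: lt_le_trans KB; rewrite ltr_wpDl.
exists K; split=> //.
move=> w w1 v v1 al e ww1 vv1 /andP[al0 al1] /andP[e0 e1] hw hv hm he.
have [w2 w12 _] := ww1; have [v2 v12 _] := vv1; have [s2 s12 _] := H1_sol.
have lw := lyapunov ww1; have lv := lyapunov vv1.
have ew := energy_sol ww1; have ev := energy_sol vv1.
have cw := ip_cube_small ww1 e0 hw; have cv := ip_cube_small vv1 al0 hv.
have sw := ip_solM_bound w2; have sv := ip_solM_bound v2.
have qv := quad_sol vv1.
have sq : `|ip T sol v| <= G * al.
  by apply: ip_CS_bd => //; apply: le_trans hv; rewrite lerDl ip_ge0.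
rewrite !ip_sqrD// in hm lw lv.
have w0 := ip_ge0 T w; have w10 := ip_ge0 T w1; have v00 := ip_ge0 T v; have v10 := ip_ge0 T v1.
have nw : nrm2 w w1 = ip T w w + ip T w1 w1 by []. have nv : nrm2 v v1 = ip T v v + ip T v1 v1 by [].
have al2 : al ^+ 2 <= al by rewrite expr2 ler_piMl.
have al20 := sqr_ge0 al.
move: cw cv sw sv sq; rewrite !ler_norml => /andP[cw cw'] /andP[cv cv'] /andP[sw sw'] /andP[sv sv'] /andP[sq sq'].
have n0 : 0 <= nrm2 w w1 := nrm2_ge0 w w1. have n0' : 0 <= nrm2 v v1 := nrm2_ge0 v v1.
have ca : al * nrm2 v v1 <= al ^+ 2 by apply: (@le_trans _ _ (nrm2 v v1)); rewrite // ler_piMl.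
have ce : e * nrm2 w w1 <= nrm2 w w1 by rewrite ler_piMl.
have ce0 : 0 <= e * nrm2 w w1 by rewrite mulr_ge0.
have kv : k ^+ 2 * ip T v v <= k ^+ 2 * al ^+ 2 by rewrite ler_wpM2l ?(ltW k2)// (le_trans _ hv)// nv lerDl.
have kw : k ^+ 2 * ip T w w <= k ^+ 2 * nrm2 w w1 by rewrite ler_wpM2l ?(ltW k2)// nw lerDl.
have kal : k ^+ 2 * al ^+ 2 <= k ^+ 2 * al by rewrite ler_wpM2l ?(ltW k2).
have ks : k ^+ 2 * ip T sol v <= k ^+ 2 * (G * al) by rewrite ler_wpM2l ?(ltW k2).
have ks' : k ^+ 2 * (- (G * al)) <= k ^+ 2 * ip T sol v by rewrite ler_wpM2l ?(ltW k2).
have km := ler_wpM2l (ltW k2) hm.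
split.
- apply: (@le_trans _ _ ((2 + 16 * k ^+ 2) * al ^+ 2 + e * nrm2 w w1)).
    move: lw lv he hm km qv kv sv sv' cw' cw cv cv' ca nv v00 v10 hv ce0.
    move: (energy (sol + w) _) (energy (sol + v) _) (energy sol _) (quad T w w1) (quad T v v1).
    move: (ip T sol w) (ip T sol v) (ip T sol sol) (ip T (w * w) w) (ip T (v * v) v).
    move: (ip T (sol * v) v) (ip T w w) (ip T v v) (ip T v1 v1) (al ^+ 2) (al * nrm2 v v1) (nrm2 v v1) (e * nrm2 w w1).
    by clear => *; lra.
  by rewrite lerD2r ler_wpM2r.
- apply/andP; split; last first.
    apply: (@le_trans _ _ ((G + 1) * al)).
      by move: hm sq' w0 hv nv v10 al2 al0; clear => *; lra.
    by rewrite ler_pM ?addr_ge0// lerDl.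
  rewrite lerNl.
  have h : 4 * k ^+ 2 * (- ip T sol w) <= (4 * k ^+ 2 * G + 2 + 6 * k ^+ 2) * (al + nrm2 w w1).
    have gal : 0 <= 4 * k ^+ 2 * G * nrm2 w w1.
      by rewrite !mulr_ge0// ltW.
    have kal2 : 0 <= 6 * k ^+ 2 * al by rewrite !mulr_ge0// ltW.
    have kal3 : k ^+ 2 * ip T v v <= k ^+ 2 * al by apply: le_trans kal.
    have -> : (4 * k ^+ 2 * G + 2 + 6 * k ^+ 2) * (al + nrm2 w w1) =
      4 * (k ^+ 2 * (G * al)) + 4 * k ^+ 2 * G * nrm2 w w1 + 2 * al + 2 * nrm2 w w1 +
      6 * k ^+ 2 * al + 6 * (k ^+ 2 * nrm2 w w1) by ring.
    move: ew ev he ks' ks sv sw' cw' cv cv' ca al2 kal2 nv v00 v10 hv ce gal kv kw kal3 w0 w10 n0 al0 nw.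
    move: (energy (sol + w) _) (energy (sol + v) _) (energy sol _).
    rewrite -!mulrA; move: (k ^+ 2 * ip T sol w) (k ^+ 2 * ip T sol v) (k ^+ 2 * (G * al)).
    move: (ip T (sol * v) v) (ip T (sol * w) w) (ip T (w * w) w) (ip T (v * v) v).
    move: (k ^+ 2 * ip T v v) (k ^+ 2 * ip T w w) (k ^+ 2 * nrm2 w w1) (k ^+ 2 * al).
    move: (ip T v v) (ip T v1 v1) (ip T w w) (ip T w1 w1) (al * nrm2 v v1) (e * nrm2 w w1) (al ^+ 2).
    move: (k ^+ 2 * (G * nrm2 w w1)) (nrm2 v v1) (nrm2 w w1); clear => *; lra.
  apply: (@le_trans _ _ (k4 * ((4 * k ^+ 2 * G + 2 + 6 * k ^+ 2) * (al + nrm2 w w1)))).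
    by rewrite /k4 ler_pdivlMl// mulr_gt0.
  by rewrite mulrA ler_wpM2r ?addr_ge0.
Qed.

Lemma soliton_stability : exists eps K, [/\ 0 < eps <= 1, 0 < K &
  forall w w1 v v1 (al : R), H1 w w1 -> H1 v v1 -> 0 <= al <= 1 ->
  ip T w phi = 0 -> nrm2 w w1 <= eps ^+ 2 -> nrm2 v v1 <= al ^+ 2 ->
  ip T (sol + w) (sol + w) <= ip T (sol + v) (sol + v) ->
  energy (sol + w) (sol1 + w1) <= energy (sol + v) (sol1 + v1) ->
  nrm2 w w1 <= (K * al) ^+ 2].
Proof.
have [K1 [K10 H]] := stability_bounds; have [K2 K20 C] := coercive k0 phi2 phi0 ss_phi.
have k2 : 0 < k ^+ 2 by rewrite exprn_gt0.
pose d := (6 * k ^+ 2)^-1 ^+ 2 * (K1 ^+ 2 * 2).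
have d0 : 0 < d by rewrite mulr_gt0 ?exprn_gt0 ?invr_gt0 ?mulr_gt0// exprn_gt0.
pose M := K2 * (1 + d).
have M0 : 0 < M by rewrite mulr_gt0// addr_gt0.
have M1 : 0 < 2 * M + 1 by rewrite addr_gt0// mulr_gt0.
pose L := 2 * (K2 * (K1 + d)).
have L0 : 0 < L by rewrite !mulr_gt0// addr_gt0.
(* With this radius the cubic term and the square of the pairing with [qq] contribute at most
   [n / 2] beyond the terms in [al], and that half is absorbed. *)
exists (2 * M + 1)^-1, (L + 1); split.
- by rewrite invr_gt0 M1 invf_le1// lerDr mulr_ge0// ltW.
- by rewrite addr_gt0.
set e := (2 * M + 1)^-1.
have e0 : 0 <= e by rewrite invr_ge0 ltW.
have e1 : e <= 1 by rewrite invf_le1// lerDr mulr_ge0// ltW.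
have eM : 2 * (M * e) <= 1 by rewrite mulrA ler_pdivrMr// mul1r lerDl.
move=> w w1 v v1 al ww1 vv1 al01 wphi hw hv hm he.
have e01 : 0 <= e <= 1 by rewrite e0.
have [hq hs] := H w w1 v v1 al e ww1 vv1 al01 e01 hw hv hm he.
have n0 := nrm2_ge0 w w1; have [w2 w12 _] := ww1.
set n := nrm2 w w1 in hw hq hs n0 *.
have a2 := sqr_ge0 al.
have del0 : 0 <= K1 * al ^+ 2 + e * n by rewrite addr_ge0// mulr_ge0// ltW.
have := C w w1 _ ww1 del0 wphi hq; rewrite -/n => h.
have sE : ip T qq w ^+ 2 <= d * (al ^+ 2 + e * n).
  have -> : ip T qq w = (6 * k ^+ 2)^-1 * ip T sol w.
    by rewrite /sol (ipZl _ measurableT (L2_qq k0) w2) mulKf// mulf_neq0 ?gt_eqF.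
  rewrite /d exprMn -[_ * (K1 ^+ 2 * 2) * _]mulrA ler_wpM2l ?sqr_ge0//.
  have hs2 : ip T sol w ^+ 2 <= (K1 * (al + n)) ^+ 2.
    have /andP[al0 _] := al01.
    rewrite -[leLHS]real_normK ?num_real// lerXn2r ?nnegrE//.
    by apply: mulr_ge0; [exact: ltW|exact: addr_ge0].
  apply: (le_trans hs2); rewrite exprMn -[K1 ^+ 2 * 2 * _]mulrA ler_wpM2l ?sqr_ge0//.
  apply: (le_trans (sqrD2 al n)); rewrite ler_pM2l// lerD2l expr2 ler_wpM2r//.
  by apply: (le_trans hw); rewrite expr2 ler_piMl.
have h2 : n <= K2 * (K1 + d) * al ^+ 2 + M * e * n.
  apply: (le_trans h); rewrite -subr_ge0; set u := (X in 0 <= X).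
  have -> : u = K2 * (d * (al ^+ 2 + e * n) - ip T qq w ^+ 2) by rewrite /u /M; ring.
  by rewrite mulr_ge0 ?subr_ge0// ltW.
have h3 : 2 * (M * e) * n <= n by rewrite ler_piMl.
have h4 : n <= L * al ^+ 2 by rewrite /L -!mulrA in h2 h3 *; lra.
apply: (le_trans h4); rewrite exprMn ler_wpM2r// expr2 mulrDr mulr1.
by rewrite mulrDl mul1r; have := sqr_ge0 L; rewrite expr2; lra.
Qed.

End Orthogonal.
End Stability.

(** * Modulation *)

Section Translation.
Context {R : realType}.
Local Notation mu := (@lebesgue_measure R).
Implicit Types (f g v w psi : R -> R) (a b x y z : R) (D : set R).
Local Notation T := [set: R].
Local Notation bump psi := (test_fun `[1, 3]%classic psi).
Local Notation J := (\1_`[0, 5[ : R -> R).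

Lemma mean_value f f1 x z : (forall x, is_derive x (1 : R) f (f1 x)) ->
  exists2 t, `|t - x| <= `|z| & f (x + z) - f x = f1 t * z.
Proof.
move=> df; have cf a b : {within `[a, b], continuous f}.
  by apply: continuous_subspaceT; exact: is_derive_cont df.
have [z0|z0] := leP 0 z.
  have xz : x <= x + z by rewrite lerDl.
  have [t /itvP ti ->] := MVT_segment xz (fun t _ => df t) (cf _ _).
  exists t; last by rewrite addrC addKr.
  have h1 : x <= t by rewrite ti. have h2 : t <= x + z by rewrite ti.
  by rewrite (ger0_norm z0) ger0_norm; lra.
have xz : x + z <= x by lra.
have [t /itvP ti e] := MVT_segment xz (fun t _ => df t) (cf _ _).
exists t; last by rewrite -opprB e; ring.
have h1 : x + z <= t by rewrite ti. have h2 : t <= x by rewrite ti.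
by rewrite (ltr0_norm z0) ler0_norm; lra.
Qed.

Lemma bump0 psi x : bump psi -> ~ (1 <= x <= 3) -> psi x = 0.
Proof.
move=> [_ [K [_ KI z]]] nx; apply: z => /KI /=; rewrite in_itv/=; exact: nx.
Qed.

(** Taylor estimates of orders one and two with a common compact envelope: [psi] and its translates
    by [|z| <= 1] are supported in [[0, 4]], where [J] is 1. *)
Lemma bump_translation psi : bump psi -> exists2 M, 0 < M & forall x z, `|z| <= 1 ->
  `|psi (x + z) - psi x| <= M * `|z| * J x /\
  `|psi (x + z) - psi x - z * derive1 psi x| <= M * z ^+ 2 * J x.
Proof.
move=> bp; have bp1 := test_derive bp; have bp2 := test_derive bp1.
have [A A0 hA] := H1_bounded (test_H1 bp1); have [B B0 hB] := H1_bounded (test_H1 bp2).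
exists (A + B); first exact: addr_gt0.
move=> x z z1; have J01 : J x = 1 \/ J x = 0 by rewrite indicE; case: (_ \in _); [left|right].
have [Jx|Jx] : J x = 1 \/ J x = 0 by []; last first.
  have : ~ (0 <= x < 5).
    by move: Jx; rewrite indicE mem_setE/= in_itv/=; case: (_ && _) => // /eqP; rewrite oner_eq0.
  move=> nx; have n1 : ~ (1 <= x <= 3) by move=> h; apply: nx; move: h; lra.
  have n2 : ~ (1 <= x + z <= 3).
    by move=> h; apply: nx; move: h z1; rewrite ler_norml => /andP[? ?] /andP[? ?]; lra.
  by rewrite !(bump0 bp)// (bump0 bp1)// Jx !mulr0 !subrr normr0.
have [t tx e] := mean_value x z (fun x => smooth_is_derive x (test_smooth bp)).
have [t' _ e'] := mean_value x (t - x) (fun x => smooth_is_derive x (test_smooth bp1)).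
rewrite Jx !mulr1 e; split.
  by rewrite normrM ler_wpM2r// (le_trans (hA t))// lerDl ltW.
have -> : derive1 psi t * z - z * derive1 psi x = derive1 (derive1 psi) t' * (t - x) * z.
  by rewrite -e' addrCA subrr addr0; ring.
rewrite !normrM -mulrA ler_pM//.
  by rewrite (le_trans (hB t'))// lerDr ltW.
by rewrite -[leRHS]real_normK ?num_real// expr2 ler_wpM2r.
Qed.

(** The factor 3 bounds [sqrt 5], the L^2 norm of [J]. *)
Lemma ip_J_bound f (h : R -> R) (m A : R) : measurable_fun setT h -> 0 <= m -> 0 <= A -> L2 f ->
  ip T f f <= A ^+ 2 -> (forall x, `|h x| <= m * J x) ->
  `|ip T f h| <= A * (3 * m) /\ (L2 (f * f) -> `|ip T (f * f) h| <= m * A ^+ 2).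
Proof.
move=> mh m0 A0 f2 fA hJ; have J2 := @L2_indic R 0 5.
have J0 x : 0 <= J x by rewrite indicE.
have h2 : L2 h.
  by apply: (L2_bd mh _ J2) => x; rewrite (ger0_norm (J0 x)); exact: hJ.
split.
  apply: ip_CS_bd => //; first by rewrite mulr_ge0.
  have mJ := L2Z m J2.
  apply: (@le_trans _ _ (ip T (m *: J) (m *: J))).
    apply: ip_le => // x _; rewrite -!expr2 -[leLHS]real_normK ?num_real//.
    by rewrite lerXn2r// nnegrE mulr_ge0.
  rewrite ipZl// ipZr// mulrA -expr2 exprMn mulrC ler_wpM2r ?sqr_ge0//.
  have -> : ip T J J = \int[mu]_x J x.
    by apply: eq_Rintegral => x _; rewrite indicE; case: (_ \in _); rewrite ?mulr1 ?mulr0.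
  by rewrite Rint_indic//; lra.
move=> ff2; have -> : ip T (f * f) h = ip T (h * f) f.
  by apply: eq_ip_mul => x _; rewrite !fctE; ring.
have hm x : `|h x| <= m.
  by apply: (le_trans (hJ x)); rewrite ler_piMr.
apply: (le_trans (ip_cubic_bound measurableT mh f2 m0 hm)); exact: ler_wpM2l.
Qed.

Lemma shf0 f : shf 0 f = f.
Proof. by apply/funext => x; rewrite /shf addr0. Qed.

Lemma shfD y z f : shf y (shf z f) = shf (y + z) f.
Proof. by apply/funext => x; rewrite /shf addrA. Qed.

Lemma shfB y f g : shf y (f - g) = shf y f - shf y g. Proof. by []. Qed.

Lemma ip_shf_swap z f psi : measurable_fun setT f -> measurable_fun setT psi ->
  ip T (shf z f) psi = ip T f (shf (- z) psi).
Proof.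
by move=> mf mp; rewrite -(ipT_shf z mf (measurable_shf (- z) mp)) shfD subrr shf0.
Qed.

(** The translation is moved from the rough [f] to the smooth [psi]. Pairings thus become
    differentiable in the shift, with derivative minus the pairing with [psi'], uniformly over
    bounded sets of L^2. *)
Lemma ip_bump_translation psi : bump psi -> exists2 M, 0 < M & forall f (A z : R),
  L2 f -> 0 <= A -> ip T f f <= A ^+ 2 -> `|z| <= 1 ->
  [/\ `|ip T (shf z f) psi - ip T f psi| <= M * A * `|z|,
      `|ip T (shf z f) psi - ip T f psi + z * ip T f (derive1 psi)| <= M * A * z ^+ 2 &
      L2 (f * f) -> `|ip T (shf z (f * f)) psi - ip T (f * f) psi| <= M * A ^+ 2 * `|z| ].
Proof.
move=> bp; have [M M0 HM] := bump_translation bp; exists (3 * M); first by rewrite mulr_gt0.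
move=> f A z f2 A0 fA z1; have [p2 d2 _] := test_H1 bp.
have s2 := L2_shf (- z) p2; have B2 := L2B s2 p2; have Z2 := L2Z z d2.
have zN1 : `|- z| <= 1 by rewrite normrN.
have m1 : 0 <= M * `|z| by rewrite mulr_ge0// ltW.
have m2 : 0 <= M * z ^+ 2 by rewrite mulr_ge0 ?sqr_ge0// ltW.
have b1 x : `|(shf (- z) psi - psi) x| <= M * `|z| * J x.
  by have [h _] := HM x _ zN1; move: h; rewrite normrN.
have b2 x : `|(shf (- z) psi - psi + z *: derive1 psi) x| <= M * z ^+ 2 * J x.
  by have [_ h] := HM x _ zN1; move: h; rewrite mulNr opprK sqrrN.
have [h1 h3] := ip_J_bound (L2_meas B2) m1 A0 f2 fA b1.
have [h2 _] := ip_J_bound (L2_meas (L2D B2 Z2)) m2 A0 f2 fA b2.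
have sw (F : R -> R) : L2 F -> ip T (shf z F) psi - ip T F psi = ip T F (shf (- z) psi - psi).
  by move=> F2; rewrite (ip_shf_swap z (L2_meas F2) (L2_meas p2)) ipBr.
split.
- by rewrite sw//; apply: (le_trans h1); rewrite le_eqVlt; apply/orP; left; apply/eqP; ring.
- rewrite sw// -(ipZr z measurableT d2 f2) -(ipDr measurableT B2 Z2 f2).
  by apply: (le_trans h2); rewrite le_eqVlt; apply/orP; left; apply/eqP; ring.
- move=> ff2; rewrite sw//; apply: (le_trans (h3 ff2)).
  have -> : 3 * M * A ^+ 2 * `|z| = 3 * (M * `|z| * A ^+ 2) by ring.
  by rewrite ler_peMl// ?ler1n// mulr_ge0 ?sqr_ge0.
Qed.

End Translation.

Section Modulation.
Context {R : realType}.
Local Notation mu := (@lebesgue_measure R).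
Implicit Types (f g v w psi : R -> R) (a b x y z : R) (D : set R).
Local Notation T := [set: R].

Lemma nrm2_ler_sum f f1 g g1 : L2 f -> L2 f1 -> L2 g -> L2 g1 ->
  nrm2 (f + g) (f1 + g1) <= 2 * (nrm2 f f1 + nrm2 g g1).
Proof.
move=> f2 f12 g2 g12; have h1 := ip_sqrD2 measurableT f2 g2.
by have h2 := ip_sqrD2 measurableT f12 g12; move: (lerD h1 h2); rewrite /nrm2; lra.
Qed.

Lemma nrm2_shf y f g : measurable_fun setT f -> measurable_fun setT g ->
  nrm2 (shf y f) (shf y g) = nrm2 f g.
Proof. by move=> mf mg; rewrite /nrm2 !ipT_shf. Qed.

Variable k : R.
Hypothesis k0 : 0 < k.
Local Notation qq := (@qq R k).
Local Notation qq1 := (@qq1 R k).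
Local Notation th := (@th R k).
Local Notation ss := (@ss R k).
Local Notation sol := (@sol R k).
Local Notation sol1 := (@sol1 R k).

(** A Harnack inequality: it dominates the difference quotients of the soliton by a multiple of
    [qq]. *)
Lemma qq_harnack x z : `|z| <= 1 -> qq (x + z) <= expR (2 * k) * qq x.
Proof.
move=> z1; rewrite -!sech_qq /sech.
have -> : expR (2 * k) = expR k ^+ 2 by rewrite -expRM_natl.
rewrite -exprMn mulrA lerXn2r ?nnegrE ?divr_ge0 ?mulr_ge0 ?addr_ge0 ?expR_ge0//.
rewrite ler_pdivrMr ?addr_gt0 ?expR_gt0// [leRHS]mulrAC ler_pdivlMr ?addr_gt0 ?expR_gt0//.
rewrite [expR k * 2]mulrC -[leRHS]mulrA ler_pM2l// mulrDr -!expRD.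
move: z1; rewrite ler_norml => /andP[z1 z2].
have h1 : 0 <= k * (1 + z) by rewrite mulr_ge0 ?(ltW k0)//; lra.
have h2 : 0 <= k * (1 - z) by rewrite mulr_ge0 ?(ltW k0)//; lra.
by apply: lerD; rewrite ler_expR; lra.
Qed.

Lemma sol_translation : exists2 C, 0 < C & forall z, `|z| <= 1 ->
  nrm2 (shf z sol - sol) (shf z sol1 - sol1) <= (C * z) ^+ 2.
Proof.
have q2 := L2_qq k0; have k2 : 0 < k ^+ 2 by rewrite exprn_gt0.
pose H := expR (2 * k); have H0 : 0 < H by exact: expR_gt0.
have near0 x t z : `|z| <= 1 -> `|t - x| <= `|z| -> qq t <= H * qq x.
  move=> z1 tx; have := @qq_harnack x (t - x) (le_trans tx z1).
  by rewrite addrC subrK.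
pose P := 6 * k ^+ 2 * (2 * k * H); pose P1 := 6 * k ^+ 2 * (4 * k ^+ 2 * H).
have P0 : 0 < P by rewrite !mulr_gt0. have P10 : 0 < P1 by rewrite !mulr_gt0.
have G0 := ip_ge0 T qq.
exists ((P + P1) * (ip T qq qq + 1)); first by apply: mulr_gt0; [exact: addr_gt0|exact: ltr_wpDl].
move=> z z1.
have key (F : R -> R) (A : R) : 0 <= A -> L2 F -> (forall x, `|F x| <= A * `|z| * qq x) ->
    ip T F F <= A ^+ 2 * z ^+ 2 * ip T qq qq.
  move=> A0 F2 hF; have Z2 := L2Z (A * `|z|) q2.
  apply: (@le_trans _ _ (ip T ((A * `|z|) *: qq) ((A * `|z|) *: qq))).
    apply: ip_le => // x _; rewrite -!expr2 -[leLHS]real_normK ?num_real//.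
    by rewrite lerXn2r// nnegrE mulr_ge0 ?mulr_ge0// ltW// qq_gt0.
  by rewrite ipZl// ipZr// mulrA -expr2 exprMn real_normK ?num_real.
have Hs := H1_sol k0; have [s2 s12 _] := Hs.
have B1 := L2B (L2_shf z s2) s2; have B2 := L2B (L2_shf z s12) s12.
have h1 := key _ P (ltW P0) B1; have h2 := key _ P1 (ltW P10) B2.
have {}h1 : ip T (shf z sol - sol) (shf z sol - sol) <= P ^+ 2 * z ^+ 2 * ip T qq qq.
  apply: h1 => x; have [t tx e] := mean_value x z (is_derive_qq k).
  have -> : (shf z sol - sol) x = 6 * k ^+ 2 * (qq1 t * z).
    by rewrite -e /shf /sol !fctE /GRing.scale/=; ring.
  have b : `|qq1 t| <= 2 * k * H * qq x.
    have -> : qq1 t = - (2 * k * (th t * qq t)) by rewrite qq1E; ring.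
    rewrite normrN normrM gtr0_norm ?mulr_gt0// -[leRHS]mulrA ler_pM2l ?mulr_gt0//.
    rewrite normrM (gtr0_norm (qq_gt0 k t)).
    apply: (le_trans _ (near0 x t z z1 tx)).
    by rewrite ler_piMl ?(ltW (qq_gt0 k t)) ?th_le1.
  have -> : P * `|z| * qq x = 6 * k ^+ 2 * (2 * k * H * qq x * `|z|) by rewrite /P; ring.
  by rewrite normrM gtr0_norm ?mulr_gt0// ler_pM2l ?mulr_gt0// normrM ler_wpM2r.
have {}h2 : ip T (shf z sol1 - sol1) (shf z sol1 - sol1) <= P1 ^+ 2 * z ^+ 2 * ip T qq qq.
  apply: h2 => x; have [t tx e] := mean_value x z (is_derive_ss k).
  have -> : (shf z sol1 - sol1) x = - (6 * k ^+ 2 * (2 * k)) * (ss1 k t * z).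
    by rewrite -e /shf /sol1 /qq1 !fctE /GRing.scale/=; ring.
  have b : `|ss1 k t| <= 2 * k * H * qq x.
    apply: (le_trans (ss1_bd k0 t)); rewrite -[leRHS]mulrA ler_pM2l ?mulr_gt0//.
    by rewrite (gtr0_norm (qq_gt0 k t)) (near0 x t z z1 tx).
  have -> : P1 * `|z| * qq x = 6 * k ^+ 2 * (2 * k) * (2 * k * H * qq x * `|z|) by rewrite /P1; ring.
  have : 0 < 6 * k ^+ 2 * (2 * k) by rewrite !mulr_gt0.
  move: (6 * k ^+ 2 * (2 * k)) => c c0.
  by rewrite mulNr normrN normrM gtr0_norm// ler_pM2l// normrM ler_wpM2r.
apply: (le_trans (lerD h1 h2)); move: (ip T qq qq) G0 => G G0.
have -> : P ^+ 2 * z ^+ 2 * G + P1 ^+ 2 * z ^+ 2 * G = (P ^+ 2 + P1 ^+ 2) * G * z ^+ 2 by ring.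
have -> : ((P + P1) * (G + 1) * z) ^+ 2 = (P + P1) ^+ 2 * (G + 1) ^+ 2 * z ^+ 2 by ring.
rewrite ler_wpM2r ?sqr_ge0//.
have PP : P ^+ 2 + P1 ^+ 2 <= (P + P1) ^+ 2 by rewrite sqrrD; have := mulr_gt0 P0 P10; lra.
apply: ler_pM => //; first by rewrite addr_ge0 ?sqr_ge0.
by rewrite expr2; nra.
Qed.

Variable phi : R -> R.
Hypothesis bphi : test_fun `[1, 3]%classic phi.
Hypothesis phi_ge0 : forall x, 0 <= phi x.
Hypothesis phi_gt0 : forall x, 1 < x < 3 -> 0 < phi x.

Lemma bump_phi0 x : x <= 0 -> phi x = 0.
Proof. by move=> x0; apply: (bump0 bphi) => /andP[]; lra. Qed.

Lemma ip_ss_phi_gt0 : 0 < ip `]0, +oo[ ss phi.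
Proof.
have [p2 _ _] := test_H1 bphi; have s2 := L2_ss k0; have cs := @ss_cont R k.
have cp : continuous phi := smooth_cont (test_smooth bphi).
have sub : `[3 / 2, 5 / 2] `<=` (`]0, +oo[%classic : set R).
  by move=> x /=; rewrite !in_itv/= => /andP[h _]; rewrite andbT; move: h; lra.
have ab : 3 / 2 <= 5 / 2 :> R by lra.
have ch : {within `[3 / 2, 5 / 2], continuous (ss * phi)}.
  by apply: continuous_subspaceT; exact: continuousMf.
have [m /[!in_itv]/= /andP[m1 m2] mh] := EVT_min ab ch.
have hm : 0 < ss m * phi m by rewrite mulr_gt0 ?ss_gt0 ?phi_gt0//; lra.
apply: (@lt_le_trans _ _ (ss m * phi m)) => //.
have -> : ss m * phi m = \int[mu]_(x in `[3 / 2, 5 / 2]) (cst (ss m * phi m) x).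
  by rewrite /cst Rint_cst_itv//; lra.
apply: (@le_trans _ _ (ip `[3 / 2, 5 / 2] ss phi)).
  apply: le_Rint; [by []|exact: itg_cst_itv|exact: (L2_itg _ s2 p2)|].
  by move=> x xI; apply: mh; exact: xI.
rewrite -ip_restr// -[leRHS]ip_restr//; apply: ip_le => //; try exact: L2_restr.
move=> x _; rewrite !fctE !indicE; have [x0|x0] := leP x 0.
  by rewrite (bump_phi0 x0) !mulr0.
rewrite ler_wpM2r// ler_wpM2r ?(ltW (ss_gt0 k0 x0))//.
have -> : x \in `]0, +oo[%classic by rewrite inE/= in_itv/= x0.
by case: (_ \in _).
Qed.

Local Notation dphi := (derive1 phi).

(** Transversality of the modulation: this number is minus the derivative in [y], at the soliton, of
    the condition that fixes the position. It is minus the pairing of [Q'] with [phi], and [Q'] is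
    negative on the support of [phi]. *)
Lemma ip_sol_dphi : 0 < ip T sol dphi.
Proof.
have := H1_ibp (H1_sol k0) (test_H1 bphi).
have -> : ip T sol1 phi = - (12 * k ^+ 3) * ip `]0, +oo[ ss phi.
  have [p2 _ _] := test_H1 bphi; have s2 := L2_ss k0.
  rewrite -[ip `]0, +oo[ ss phi]ip_restr// -(ipZl _ measurableT _ p2); last exact: L2_restr.
  apply: eq_ip_mul => x _; rewrite /sol1 /qq1 !fctE /GRing.scale/= indicE.
  have [x0|x0] := leP x 0; first by rewrite (bump_phi0 x0) !mulr0.
  have -> : x \in `]0, +oo[%classic by rewrite inE/= in_itv/= x0.
  by rewrite mul1r; ring.
have : 0 < 12 * k ^+ 3 * ip `]0, +oo[ ss phi by rewrite !mulr_gt0 ?exprn_gt0 ?ip_ss_phi_gt0.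
by rewrite mulNr; lra.
Qed.

End Modulation.

(** * Existence and rigidity of the position *)

Section ModulationStatic.
Context {R : realType}.
Implicit Types (f g v w psi : R -> R) (a b x y z : R) (D : set R).
Local Notation T := [set: R].

Lemma lipschitz_cont (h : R -> R) (L : R) : 0 < L ->
  (forall y z, `|z| <= 1 -> `|h (y + z) - h y| <= L * `|z|) -> continuous h.
Proof.
move=> L0 H y; apply/cvgrPdist_le => e e0; near=> x.
have xy : `|x - y| <= Num.min 1 (e / L).
  near: x; apply/nbhs_ballP; exists (Num.min 1 (e / L)) => /=.
    by rewrite lt_min ltr01 divr_gt0.
  by move=> x /=; rewrite /ball/= distrC => /ltW.
move: xy; rewrite le_min => /andP[xy1 xy2].
have := H y _ xy1; rewrite subrKC distrC => /le_trans; apply.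
by rewrite mulrC -ler_pdivlMr.
Unshelve. all: by end_near. Qed.

Lemma ge1_sqr_bound f : exists2 A, 1 <= A & ip T f f <= A ^+ 2.
Proof.
have := ip_ge0 T f => h; exists (ip T f f + 1); first by rewrite lerDr.
by rewrite expr2; nra.
Qed.

Lemma nrm2_l f g (e : R) : nrm2 f g <= e -> ip T f f <= e.
Proof. by apply: le_trans; rewrite lerDl ip_ge0. Qed.

Variable k : R.
Hypothesis k0 : 0 < k.
Local Notation qq := (@qq R k).
Local Notation sol := (@sol R k).
Local Notation sol1 := (@sol1 R k).
Variable phi : R -> R.
Hypothesis bphi : test_fun `[1, 3]%classic phi.
Hypothesis phi_ge0 : forall x, 0 <= phi x.
Hypothesis phi_gt0 : forall x, 1 < x < 3 -> 0 < phi x.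
Local Notation dphi := (derive1 phi).
Local Notation gam := (ip T sol dphi).
Local Notation near f g e := (nrm2 (f - sol) (g - sol1) <= e ^+ 2).

Lemma shf_near C f g z (e : R) : 0 < C -> (forall z, `|z| <= 1 ->
    nrm2 (shf z sol - sol) (shf z sol1 - sol1) <= (C * z) ^+ 2) ->
  H1 f g -> `|z| <= 1 -> near f g e -> nrm2 (shf z f - sol) (shf z g - sol1) <= 2 * (e ^+ 2 + (C * z) ^+ 2).
Proof.
move=> C0 HC fg z1 h; have Hs := H1_sol k0; have [s2 s12 _] := Hs; have [f2 g2 _] := fg.
have B1 := L2B f2 s2; have B2 := L2B g2 s12; have sB1 := L2_shf z B1; have sB2 := L2_shf z B2.
have D1 := L2B (L2_shf z s2) s2; have D2 := L2B (L2_shf z s12) s12.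
have -> : shf z f - sol = shf z (f - sol) + (shf z sol - sol).
  by apply/funext => x; rewrite /shf !fctE; ring.
have -> : shf z g - sol1 = shf z (g - sol1) + (shf z sol1 - sol1).
  by apply/funext => x; rewrite /shf !fctE; ring.
apply: (le_trans (nrm2_ler_sum sB1 sB2 D1 D2)).
rewrite (nrm2_shf z (L2_meas B1) (L2_meas B2)) ler_pM2l ?ltr0n//.
by apply: lerD; [exact: h|exact: HC].
Qed.

(** Intermediate value theorem for [H], which equals [- gam y] up to [e B + M S y^2]. At [y = K0 e]
    and [y = - K0 e] the linear part has size [2 e B] and each error term is at most [e B], so the
    signs are opposite. *)
Lemma modulation_exists : exists e0 K, [/\ 0 < e0, 1 <= K &
  forall f g (e : R), H1 f g -> 0 <= e <= e0 -> near f g e ->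
  exists y, [/\ `|y| <= K * e, ip T (shf y f - sol) phi = 0 &
    nrm2 (shf y f - sol) (shf y g - sol1) <= (K * e) ^+ 2]].
Proof.
have Hs := H1_sol k0; have [s2 s12 _] := Hs; have [p2 _ _] := test_H1 bphi.
have [M M0 HM] := ip_bump_translation bphi; have [C C0 HC] := sol_translation k0.
have [B B1 HB] := ge1_sqr_bound phi; have [S S1 HS] := ge1_sqr_bound sol.
have g0 := ip_sol_dphi k0 bphi phi_ge0 phi_gt0.
have B0 : 0 < B by lra. have S0 : 0 < S by lra.
pose K0 := 2 * B / gam; have K00 : 0 < K0 by rewrite divr_gt0// mulr_gt0.
have MS0 : 0 < M * S * K0 ^+ 2 by apply: mulr_gt0; [exact: mulr_gt0|exact: exprn_gt0].
exists (Num.min (K0^-1) (B / (M * S * K0 ^+ 2))), (2 * (1 + C * K0) + K0).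
have CK : 0 < C * K0 by rewrite mulr_gt0.
split; [by rewrite lt_min invr_gt0 K00 divr_gt0|by move: CK K00; lra|].
move=> f g e fg /andP[e0]; rewrite le_min => /andP[e1 e2] h; have [f2 g2 _] := fg.
have Ke : K0 * e <= 1 by rewrite -ler_pdivlMl// mulr1.
have Ke0 : 0 <= K0 * e by rewrite mulr_ge0// ltW.
have sf y := L2_shf y f2.
pose H y := ip T (shf y f) phi - ip T sol phi.
have fs2 := L2B f2 s2.
have HE y : `|y| <= 1 -> `|H y + y * gam| <= e * B + M * S * y ^+ 2.
  move=> y1; have [_ t _] := HM sol S y s2 (ltW S0) HS y1.
  have -> : H y + y * gam = ip T (shf y (f - sol)) phi +
      (ip T (shf y sol) phi - ip T sol phi + y * gam).
    have -> : ip T (shf y (f - sol)) phi = ip T (shf y f) phi - ip T (shf y sol) phi.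
      exact: ipBl measurableT (sf y) (L2_shf y s2) p2.
    rewrite /H; move: (ip T (shf y f) phi) (ip T (shf y sol) phi) (ip T sol phi) (y * gam).
    by clear => *; ring.
  apply: (le_trans (ler_normD _ _)); apply: lerD => //.
  have sw : ip T (shf y (f - sol)) (shf y (f - sol)) <= e ^+ 2.
    by rewrite (ipT_shf y (L2_meas fs2) (L2_meas fs2)); exact: nrm2_l h.
  exact: (ip_CS_bd measurableT (L2_shf y fs2) p2 e0 (ltW B0) sw HB).
have small : M * S * (K0 * e) ^+ 2 <= e * B.
  have : M * S * K0 ^+ 2 * e <= B by rewrite -ler_pdivlMl// mulrC.
  by move=> /(ler_wpM2l e0); congr (_ <= _); ring.
have K0g : K0 * e * gam = 2 * (e * B) by rewrite /K0; field; rewrite gt_eqF.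
have [y /itvP yI Hy] : exists2 y, y \in `[- (K0 * e), K0 * e] & H y = 0.
  apply: IVT; first lra.
    apply: continuous_subspaceT; have [A A1 HA] := ge1_sqr_bound f.
    have A0 : 0 < A by lra.
    apply: (@lipschitz_cont _ (M * A)); first by rewrite mulr_gt0.
    move=> y z z1; have hA : ip T (shf y f) (shf y f) <= A ^+ 2.
      by rewrite (ipT_shf y (L2_meas f2) (L2_meas f2)).
    have [t _ _] := HM (shf y f) A z (sf y) (ltW A0) hA z1.
    by rewrite /H opprB addrA subrK addrC [y + z]addrC -shfD addrC.
  have h1 := HE (K0 * e); have h2 := HE (- (K0 * e)).
  rewrite normrN ger0_norm// in h1 h2; move: (h1 Ke) (h2 Ke); rewrite sqrrN mulNr K0g.
  rewrite !ler_norml => /andP[_ a1] /andP[a2 _].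
  have n1 : H (K0 * e) <= 0 by lra.
  have n2 : 0 <= H (- (K0 * e)) by lra.
  by rewrite ge_min n1 orbT/= le_max n2.
have yK : `|y| <= K0 * e by rewrite ler_norml !yI.
exists y; split.
- by apply: (le_trans yK); rewrite ler_wpM2r// lerDr mulr_ge0// addr_ge0// ltW.
- by rewrite (ipBl measurableT (sf y) s2 p2).
apply: (le_trans (shf_near C0 HC fg (le_trans yK Ke) h)).
have y2 : y ^+ 2 <= (K0 * e) ^+ 2.
  by rewrite -[leLHS]real_normK ?num_real// lerXn2r ?nnegrE.
rewrite [(C * y) ^+ 2]exprMn.
apply: (@le_trans _ _ ((2 * (1 + C * K0)) ^+ 2 * e ^+ 2)); last first.
  rewrite [leRHS]exprMn ler_wpM2r ?sqr_ge0// lerXn2r ?nnegrE ?lerDl ?(ltW K00)//.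
    by rewrite mulr_ge0// addr_ge0// ltW.
  by rewrite addr_ge0 ?(ltW K00)// mulr_ge0// addr_ge0// ltW.
apply: (@le_trans _ _ (2 * (e ^+ 2 + C ^+ 2 * (K0 * e) ^+ 2))).
  by rewrite ler_pM2l// lerD2l ler_wpM2l ?sqr_ge0.
have -> : 2 * (e ^+ 2 + C ^+ 2 * (K0 * e) ^+ 2) = 2 * (1 + (C * K0) ^+ 2) * e ^+ 2 by ring.
rewrite ler_wpM2r ?sqr_ge0//.
by have := sqr_ge0 (C * K0); move: CK; rewrite !expr2; move: (C * K0) => c; nra.
Qed.

(** If [f] and its translate by [z] both resemble the soliton, then [f z] is close both to [Q z] and
    to the peak [Q 0]; their gap [6 k^2 th(z)^2] is at most [2 e2], and [m <= th r] converts this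
    into a bound on [z]. It replaces continuity for positions chosen one time at a time. *)
Lemma shift_close (r : R) : 0 < r -> exists2 e2, 0 < e2 & forall f g z, H1 f g ->
  near f g e2 -> nrm2 (shf z f - sol) (shf z g - sol1) <= e2 ^+ 2 -> `|z| <= r.
Proof.
move=> r0; have Hs := H1_sol k0.
pose m := k * r / (1 + k * r).
have kr : 0 < k * r by rewrite mulr_gt0.
have m0 : 0 < m by rewrite divr_gt0// addr_gt0.
have k2 : 0 < k ^+ 2 by rewrite exprn_gt0.
have m2 : 0 < m ^+ 2 by rewrite exprn_gt0.
exists (2 * k ^+ 2 * m ^+ 2); first by rewrite mulr_gt0// mulr_gt0.
set e := 2 * k ^+ 2 * m ^+ 2.
have e0 : 0 <= e by rewrite /e mulr_ge0 ?sqr_ge0// mulr_ge0 ?sqr_ge0.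
move=> f g z fg h h'; rewrite leNgt; apply/negP => rz.
have a1 : `|f z - 6 * k ^+ 2 * qq z| <= e := H1_sup_bd z (H1B fg Hs) e0 h.
have q := H1_sup_bd 0 (H1B (H1_shf z fg) Hs) e0 h'.
have a2 : `|f (0 + z) - 6 * k ^+ 2 * qq 0| <= e := q.
rewrite add0r qq_0 mulr1 in a2.
have tz : m <= `|th k z|.
  have key x : r <= x -> m <= th k x.
    move=> rx; have e1 : 1 + 2 * (k * r) <= expR (2 * (k * x)).
      apply: (le_trans (expR_ge1Dx _)); rewrite ler_expR ler_pM2l// ler_pM2l//.
    have e2 : 0 < 1 + 2 * (k * r) + 1 by lra.
    apply: le_trans (th_lower e1 e2); rewrite /m le_eqVlt; apply/orP; left; apply/eqP.
    by field; rewrite !gt_eqF//; lra.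
  have [z0|z0] := leP 0 z.
    by rewrite (ger0_norm z0) in rz; apply: (le_trans (key z (ltW rz))); exact: ler_norm.
  rewrite (ltr0_norm z0) in rz; apply: (le_trans (key (- z) (ltW rz))).
  by rewrite thN -normrN; exact: ler_norm.
have t2 : m ^+ 2 <= th k z ^+ 2.
  by rewrite -[leRHS]real_normK ?num_real// lerXn2r ?nnegrE// ltW.
have : k ^+ 2 * m ^+ 2 <= k ^+ 2 * th k z ^+ 2 by rewrite ler_pM2l.
have : 0 < k ^+ 2 * m ^+ 2 by rewrite mulr_gt0.
move: a1 a2; rewrite qqE /e !ler_norml => /andP[a1 a1'] /andP[a2 a2'].
by move: a1 a1' a2 a2'; rewrite mulrBr mulr1 -!mulrA; lra.
Qed.

(** For the solution in the moving frame, [arate] is the time derivative of the pairing with [phi]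
    at a frozen shift, and minus [brate] its derivative in the shift. Keeping the pairing constant
    makes the position move with velocity [arate / brate]. *)
Definition arate f : R := ip T f (derive1n 3 phi) + ip T (f * f) dphi.
Definition brate f : R := ip T f dphi.

(** The profile equation tested against [phi']: for the exact soliton the velocity is [c]. *)
Lemma arate_sol : arate sol = 4 * k ^+ 2 * brate sol.
Proof.
have key p p1 p2 : H1 p p1 -> H1 p1 p2 ->
    ip T sol p2 + ip T (sol * sol) p = 4 * k ^+ 2 * ip T sol p.
  move=> h1 h2; have := ip_sol1 k0 h1; have := H1_ibp (H1_sol k0) h2.
  move: (ip T sol p2) (ip T sol1 p1) (ip T (sol * sol) p) (ip T sol p).
  by clear => *; lra.
exact: key (test_H1 (test_derive bphi)) (test_H1 (test_derive (test_derive bphi))).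
Qed.

Lemma rate_near : exists e3 K, [/\ 0 < e3, 0 < K & forall f g (e : R), H1 f g ->
  0 <= e <= e3 -> near f g e ->
  gam / 2 <= brate f /\ `|arate f - 4 * k ^+ 2 * brate f| <= K * e].
Proof.
have Hs := H1_sol k0; have [s2 s12 _] := Hs; have Hd := test_H1 (test_derive bphi).
have [t2 _ _] := test_H1 (test_deriven 3 bphi).
have as_ := arate_sol; rewrite /arate /brate in as_ *; move: t2 as_.
move: (derive1n 3 phi) => d3 t2 as_; have [d2 _ _] := Hd.
have sd2 := L2_H1M Hs d2.
have [B B1 HB] := ge1_sqr_bound dphi; have [E E1 HE] := ge1_sqr_bound d3.
have [F F1 HF] := ge1_sqr_bound (sol * dphi); have [A A0 HA] := H1_bounded Hd.
have g0 := ip_sol_dphi k0 bphi phi_ge0 phi_gt0.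
have B0 : 0 < B := lt_le_trans ltr01 B1.
have E0 : 0 <= E := le_trans ler01 E1. have F0 : 0 <= F := le_trans ler01 F1.
 have k2 : 0 < 4 * k ^+ 2 by rewrite mulr_gt0// exprn_gt0.
have kB : 0 < 4 * k ^+ 2 * B by rewrite mulr_gt0.
exists (Num.min 1 (gam / (2 * B))), (E + 2 * F + A + 4 * k ^+ 2 * B); split.
- by rewrite lt_min ltr01 divr_gt0// mulr_gt0.
- by move: kB A0 E0 F0; clear; lra.
move=> f g e fg /andP[e0]; rewrite le_min => /andP[e1 e2] h; have [f2 g2 _] := fg.
pose w := f - sol; have Hw := H1B fg Hs; have [w2 _ _] := Hw.
have fE : f = sol + w by rewrite /w addrC subrK.
have nw : ip T w w <= e ^+ 2 := nrm2_l h.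
have b1 : `|ip T w dphi| <= e * B := ip_CS_bd measurableT w2 d2 e0 (ltW B0) nw HB.
have b2 : `|ip T w d3| <= e * E := ip_CS_bd measurableT w2 t2 e0 E0 nw HE.
have b3 : `|ip T w (sol * dphi)| <= e * F := ip_CS_bd measurableT w2 sd2 e0 F0 nw HF.
have b4 : `|ip T (w * w) dphi| <= e * A.
  have -> : ip T (w * w) dphi = ip T (dphi * w) w.
    by apply: eq_ip_mul => x _; rewrite !fctE; ring.
  apply: (le_trans (ip_cubic_bound measurableT (L2_meas d2) w2 (ltW A0) HA)).
  by rewrite mulrC ler_wpM2r ?(ltW A0)// (le_trans nw)// expr2 ler_piMl.
have eB : e * B <= gam / 2.
  by move: e2; rewrite ler_pdivlMr ?mulr_gt0//; lra.
have bE : ip T f dphi = gam + ip T w dphi by rewrite {1}fE ipDl.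
split; first by move: b1 eB; rewrite bE ler_norml => /andP[+ _]; clear; lra.
have aE : ip T f d3 + ip T (f * f) dphi = ip T sol d3 + ip T (sol * sol) dphi +
    ip T w d3 + 2 * ip T w (sol * dphi) + ip T (w * w) dphi.
  rewrite {1}fE (ipDl measurableT s2 w2 t2).
  have -> : ip T (f * f) dphi = ip T (sol * sol) dphi + 2 * ip T w (sol * dphi) + ip T (w * w) dphi.
    have -> : f * f = sol * sol + 2 *: (sol * w) + w * w.
      by rewrite fE; apply/funext => x; rewrite !fctE /GRing.scale/=; ring.
    have sw := L2_H1M Hs w2; have ssl := L2_H1M Hs s2; have ww := L2_H1M Hw w2.
    have Zsw := L2Z 2 sw; have S2 := L2D ssl Zsw.
    rewrite ipDl// ipDl// ipZl//; congr (_ + 2 * _ + _).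
    by apply: eq_ip_mul => x _; rewrite !fctE; ring.
  by ring.
have -> : ip T f d3 + ip T (f * f) dphi - 4 * k ^+ 2 * ip T f dphi = ip T w d3 +
    2 * ip T w (sol * dphi) + ip T (w * w) dphi - 4 * k ^+ 2 * ip T w dphi.
  by rewrite aE bE as_; ring.
have b5 : `|4 * k ^+ 2 * ip T w dphi| <= 4 * k ^+ 2 * (e * B).
  by rewrite normrM gtr0_norm// ler_pM2l.
have -> : (E + 2 * F + A + 4 * k ^+ 2 * B) * e = e * E + 2 * (e * F) + e * A + 4 * k ^+ 2 * (e * B) by ring.
move: b2 b3 b4 b5.
move: (ip T w d3) (ip T w (sol * dphi)) (ip T (w * w) dphi) (4 * k ^+ 2 * ip T w dphi).
move: (e * E) (e * F) (e * A) (4 * k ^+ 2 * (e * B)) => u1 u2 u3 u4 v1 v2 v3 v4.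
by rewrite !ler_norml => /andP[? ?] /andP[? ?] /andP[? ?] /andP[? ?]; lra.
Qed.

End ModulationStatic.

(** * Continuation of the orbital bound in time *)

Section Orbit.
Context {R : realType}.
Implicit Types (y z s t : R).
Local Notation T := [set: R].

Lemma energy_shf y (f g : R -> R) : measurable_fun setT f -> measurable_fun setT g ->
  energy (shf y f) (shf y g) = energy f g.
Proof.
move=> mf mg; have mff : measurable_fun setT (f * f) by exact: measurable_funM.
by rewrite /energy (ipT_shf y mg mg) -(ipT_shf y mff mf).
Qed.

Variable k : R.
Hypothesis k0 : 0 < k.
Local Notation sol := (@sol R k).
Local Notation sol1 := (@sol1 R k).
Variable phi : R -> R.
Hypothesis bphi : test_fun `[1, 3]%classic phi.
Hypothesis phi_ge0 : forall x, 0 <= phi x.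
Hypothesis phi_gt0 : forall x, 1 < x < 3 -> 0 < phi x.

(* A curve of pairs (function, derivative) with the properties of the KdV flow
   that the stability argument uses. *)
Definition flow (f g : R -> R -> R) : Prop :=
  [/\ forall t, 0 <= t -> H1 (f t) (g t),
      forall t x, 0 <= t -> x <= 0 -> f t x = 0,
      forall s (e : R), 0 <= s -> 0 < e -> exists2 d, 0 < d & forall t, 0 <= t ->
        `|t - s| < d -> nrm2 (f t - f s) (g t - g s) <= e ^+ 2 &
      forall t, 0 <= t -> ip T (f t) (f t) <= ip T (f 0) (f 0) /\
        energy (f t) (g t) <= energy (f 0) (g 0)].

Lemma near_perturb (f g f' g' : R -> R) y (a b : R) : H1 f g -> H1 f' g' ->
  nrm2 (shf y f - sol) (shf y g - sol1) <= a ->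
  nrm2 (f' - f) (g' - g) <= b -> nrm2 (shf y f' - sol) (shf y g' - sol1) <= 2 * (b + a).
Proof.
move=> fg fg' ha hb; have [s2 s12 _] := H1_sol k0.
have [f2 g2 _] := fg; have [f2' g2' _] := fg'.
have B1 := L2B f2' f2; have B2 := L2B g2' g2.
have C1 := L2B (L2_shf y f2) s2; have C2 := L2B (L2_shf y g2) s12.
have -> : shf y f' - sol = shf y (f' - f) + (shf y f - sol).
  by apply/funext => x; rewrite /shf !fctE; ring.
have -> : shf y g' - sol1 = shf y (g' - g) + (shf y g - sol1).
  by apply/funext => x; rewrite /shf !fctE; ring.
apply: (le_trans (nrm2_ler_sum (L2_shf y B1) (L2_shf y B2) C1 C2)).
rewrite (nrm2_shf y (L2_meas B1) (L2_meas B2)) ler_pM2l ?ltr0n//.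
exact: lerD hb ha.
Qed.

(** Closeness [d] improves itself to [Ks al <= d / 2], and a short time loses no more than returns
    to [d]; good times therefore form an open and closed set. Mass and energy are always compared
    with time 0, so the constant does not deteriorate. *)
Lemma orbital_stability : exists eb K, [/\ 0 < eb, 0 < K &
  forall f g L (al : R), flow f g -> 0 <= al <= eb ->
  nrm2 (shf L (f 0) - sol) (shf L (g 0) - sol1) <= al ^+ 2 ->
  forall t, 0 <= t -> exists y, [/\ 0 < y, ip T (shf y (f t) - sol) phi = 0 &
    nrm2 (shf y (f t) - sol) (shf y (g t) - sol1) <= (K * al) ^+ 2]].
Proof.
have Hs := H1_sol k0; have [p2 _ _] := test_H1 bphi.
have [eps [Ks [/andP[eps0 eps1] Ks0 stab]]] := soliton_stability k0 p2 (bump_phi0 bphi)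
  (ip_ss_phi_gt0 k0 bphi phi_ge0 phi_gt0).
have [e0 [Km [e00 Km1 modul]]] := modulation_exists k0 bphi phi_ge0 phi_gt0.
have Km0 : 0 < Km := lt_le_trans ltr01 Km1.
have k2 : 0 < 6 * k ^+ 2 by rewrite mulr_gt0// exprn_gt0.
(* The three bounds serve, in order, to find a position, to enter the range of [soliton_stability]
   once it is found, and to make the position positive. *)
pose d := Num.min (Num.min e0 (eps / Km)) (3 * k ^+ 2).
have d0 : 0 < d.
  by rewrite !lt_min e00 divr_gt0//= mulr_gt0// exprn_gt0.
have de : d <= e0 by rewrite /d !ge_min lexx.
have dk : 2 * d <= 6 * k ^+ 2.
  have : d <= 3 * k ^+ 2 by rewrite /d ge_min lexx orbT.
  by clear; lra.
have dm : Km * d <= eps by rewrite -ler_pdivlMl// mulrC /d !ge_min lexx orbT.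
clearbody d; exists (Num.min (Num.min 1 d) (d / 2 / Ks)), Ks; split => //.
  by rewrite !lt_min ltr01 d0 !divr_gt0.
move=> f g L al [rep zer small mono] /andP[al0]; rewrite !le_min => /andP[/andP[al1 ald] alK] h0.
have {}alK : Ks * al <= d / 2 by rewrite -ler_pdivlMl// mulrC.
pose good t := exists y, [/\ 0 < y, ip T (shf y (f t) - sol) phi = 0 &
    nrm2 (shf y (f t) - sol) (shf y (g t) - sol1) <= (Ks * al) ^+ 2].
have Ka0 : 0 <= Ks * al by rewrite mulr_ge0// ltW.
have fg0 := rep 0 (lexx 0).
have improve t y : 0 <= t -> nrm2 (shf y (f t) - sol) (shf y (g t) - sol1) <= d ^+ 2 -> good t.
  move=> t0 h; have fg := rep t t0.
  have d0e : 0 <= d <= e0 by rewrite (ltW d0).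
  have [z [_ hz nz]] := modul _ _ d (H1_shf y fg) d0e h.
  rewrite !shfD in hz nz; exists (z + y).
  have W := H1B (H1_shf (z + y) fg) Hs; have V := H1B (H1_shf L fg0) Hs.
  have hw : nrm2 (shf (z + y) (f t) - sol) (shf (z + y) (g t) - sol1) <= eps ^+ 2.
    have Kd0 : 0 <= Km * d by rewrite mulr_ge0// ltW.
    by apply: (le_trans nz); rewrite lerXn2r ?nnegrE// ltW.
  have al01 : 0 <= al <= 1 by rewrite al0.
  have [mt et] := mono t t0; have [ft gt _] := fg; have [f0 g0 _] := fg0.
  have nr := stab _ _ _ _ al W V al01 hz hw h0.
  have cancel (a b : R -> R) : a + (b - a) = b by rewrite addrC subrK.
  rewrite !cancel in nr.
  have {}nr : nrm2 (shf (z + y) (f t) - sol) (shf (z + y) (g t) - sol1) <= (Ks * al) ^+ 2.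
    apply: nr.
      by rewrite (ipT_shf _ (L2_meas ft) (L2_meas ft)) (ipT_shf _ (L2_meas f0) (L2_meas f0)).
    by rewrite (energy_shf _ (L2_meas ft) (L2_meas gt)) (energy_shf _ (L2_meas f0) (L2_meas g0)).
  split=> //; rewrite ltNge; apply/negP => zy.
  have q := H1_sup_bd 0 W Ka0 nr.
  have : `|f t (0 + (z + y)) - 6 * k ^+ 2 * qq k 0| <= Ks * al := q.
  rewrite add0r (zer t _ t0 zy) sub0r normrN qq_0 mulr1 gtr0_norm//.
  by move: (6 * k ^+ 2) (Ks * al) dk alK d0; clear => *; lra.
have step s : 0 <= s -> exists2 e, 0 < e & forall t, 0 <= t -> `|t - s| < e ->
    (good s -> good t) /\ (good t -> good s).
  move=> s0; have d2 : 0 < d / 2 by rewrite divr_gt0.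
  have [e e0' he] := small s (d / 2) s0 d2; exists e => // t t0 ts.
  have ht := he t t0 ts; have fs := rep s s0; have ft := rep t t0.
  have ht' : nrm2 (f s - f t) (g s - g t) <= (d / 2) ^+ 2.
    have [B1 B2 _] := H1B ft fs.
    have -> : f s - f t = - 1 *: (f t - f s) by rewrite scaleN1r opprB.
    have -> : g s - g t = - 1 *: (g t - g s) by rewrite scaleN1r opprB.
    rewrite /nrm2 (ipZl _ _ B1 (L2Z _ B1))// (ipZr _ _ B1 B1)// (ipZl _ _ B2 (L2Z _ B2))// (ipZr _ _ B2 B2)//.
    by rewrite !mulN1r !opprK.
  have fin (a : R) : a <= (Ks * al) ^+ 2 -> 2 * ((d / 2) ^+ 2 + a) <= d ^+ 2.
    move=> ha; have : (Ks * al) ^+ 2 <= (d / 2) ^+ 2 by rewrite lerXn2r ?nnegrE// ltW.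
    have -> : d ^+ 2 = 4 * (d / 2) ^+ 2 by field.
    by move: ((d / 2) ^+ 2) ((Ks * al) ^+ 2) ha; clear => *; lra.
  split=> -[y [_ _ hy]]; [apply: (improve t y t0)|apply: (improve s y s0)].
    by apply: le_trans (near_perturb fs ft hy ht) (fin _ _); rewrite ?lexx.
  by apply: le_trans (near_perturb ft fs hy ht') (fin _ _); rewrite ?lexx.
apply: real_induction.
- by apply: (improve 0 L) => //; apply: (le_trans h0); rewrite lerXn2r ?nnegrE// ltW.
- move=> s s0 hs; have [e e1 he] := step s s0; exists e => // t /andP[st te].
  have t0 : 0 <= t by exact: le_trans (ltW st).
  have d1 : `|t - s| < e by rewrite gtr0_norm ?subr_gt0// ltrBlDl.
  by have [H _] := he t t0 d1; apply: H; apply: hs; rewrite s0 lexx.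
- move=> s s0 hs; have [e e1 he] := step s (ltW s0).
  pose t := Num.max 0 (s - e / 2).
  have t0 : 0 <= t by rewrite le_max lexx.
  have ts : t < s by rewrite gt_max s0 ltrBlDr ltrDl divr_gt0.
  have d1 : `|t - s| < e.
    rewrite distrC gtr0_norm ?subr_gt0//.
    have : s - e / 2 <= t by rewrite le_max lexx orbT.
    by move: e1; clear => *; lra.
  by have [_ H] := he t t0 d1; apply: H; apply: hs; rewrite t0.
Qed.

End Orbit.

(** * Dependence of the rates on the function and on the shift *)

Section Rates.
Context {R : realType}.
Implicit Types (y z s t : R).
Local Notation T := [set: R].
Local Notation Rp := (@Rplus R).

Lemma within_cvg (A : set R) (P : R -> R) t (l : R) :
  (forall e : R, 0 < e -> exists2 d, 0 < d & forall s, A s -> `|s - t| < d -> `|P s - l| <= e) ->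
  P s @[s --> within A (nbhs t)] --> l.
Proof.
move=> H; apply/cvgrPdist_le => e e0; have [d d0 h] := H e e0.
near_simpl; rewrite near_withinE; exists d => // s /= ts As.
by rewrite distrC; apply: h => //; rewrite distrC.
Qed.

(** Continuity alone is required at time 0. The intermediate time is no farther from [t] than [s]
    is, so that estimates valid near [t] apply to it. *)
Lemma mean_value_time (P P' : R -> R) : (forall t, 0 < t -> is_derive t (1 : R) P (P' t)) ->
  (forall s (e : R), 0 <= s -> 0 < e -> exists2 d, 0 < d & forall t, 0 <= t ->
     `|t - s| < d -> `|P t - P s| <= e) ->
  forall s t, 0 <= s -> 0 <= t -> exists r, [/\ 0 <= r, `|r - t| <= `|s - t| &
    P s - P t = (s - t) * P' r].
Proof.
move=> dP cP; suff key a b : 0 <= a -> a <= b -> exists r, [/\ a <= r, r <= b &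
    P b - P a = (b - a) * P' r].
  move=> s t s0 t0; have [st|ts] := leP t s.
    have [r [tr rs e]] := key t s t0 st; exists r; split=> //; first exact: le_trans tr.
    by rewrite !ger0_norm ?subr_ge0// lerD2r.
  have [r [sr rt e]] := key s t s0 (ltW ts); exists r; split; first exact: le_trans sr.
    by rewrite ler0_norm ?subr_le0// ler0_norm ?subr_le0 ?(ltW ts)// !opprB lerD2l lerN2.
  by rewrite -[LHS]opprB e -mulNr opprB.
move=> a0 ab; have dI x : x \in `]a, b[%R -> is_derive x (1 : R) P (P' x).
  by rewrite in_itv/= => /andP[ax _]; apply: dP; exact: le_lt_trans ax.
have cI : {within `[a, b], continuous P}.
  apply/subspace_continuousP => x /=; rewrite in_itv/= => /andP[ax _].
  apply: within_cvg => e e0; have [d d0 h] := cP x e (le_trans a0 ax) e0.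
  exists d => // y /=; rewrite in_itv/= => /andP[ay _]; exact: h (le_trans a0 ay).
have [r /itvP rI e] := MVT_segment ab dI cI.
by exists r; split; rewrite ?rI// mulrC.
Qed.

Variable phi : R -> R.
Hypothesis bphi : test_fun `[1, 3]%classic phi.
Local Notation dphi := (derive1 phi).
Local Notation arate := (@arate R phi).
Local Notation brate := (@brate R phi).

Lemma derive1_shf y (psi : R -> R) : smooth psi -> derive1 (shf y psi) = shf y (derive1 psi).
Proof.
move=> sp; apply/funext => x; rewrite derive1E.
have h : is_derive (1 * x + y) (1 : R) psi (derive1 psi (1 * x + y)) by exact: smooth_is_derive.
have := is_derive_affine h; rewrite mul1r mulr1.
rewrite (_ : (fun z => psi (1 * z + y)) = shf y psi); first by case.
by apply/funext => z; rewrite mul1r.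
Qed.

Lemma derive1n_shf n y (psi : R -> R) : smooth psi -> derive1n n (shf y psi) = shf y (derive1n n psi).
Proof.
move=> sp; elim: n => [//|n IH]; rewrite !derive1nS IH.
by apply: (@derive1_shf y (derive1n n psi)); exact: smooth_deriven sp.
Qed.

Lemma test_shf y : 0 < y -> test_fun Rp (shf (- y) phi).
Proof.
move=> y0; have sp := test_smooth bphi.
apply: (@test_intro _ _ _ (1 + y) (3 + y)).
- have := @smooth_affine R 1 (- y) phi sp; congr (smooth _).
  by apply/funext => x; rewrite mul1r.
- move=> x nx; rewrite /shf; apply: (bump0 bphi) => /andP[h1 h2]; apply: nx.
  by apply/andP; move: h1 h2; clear => h1 h2; split; lra.
- by move=> x /=; rewrite in_itv/= /Rplus/= => /andP[h _]; move: h y0; clear => *; lra.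
Qed.

Lemma arate_shf y (f : R -> R) : L2 f -> L2 (f * f) -> arate (shf y f) =
  ip T f (derive1n 3 (shf (- y) phi)) + ip T (f * f) (derive1 (shf (- y) phi)).
Proof.
move=> f2 ff2; have sp := test_smooth bphi.
have m3 : measurable_fun setT (derive1n 3 phi).
  by have [h _ _] := test_H1 (test_deriven 3 bphi); exact: L2_meas h.
have m1 : measurable_fun setT dphi.
  by have [h _ _] := test_H1 (test_derive bphi); exact: L2_meas h.
rewrite (derive1n_shf 3 _ sp) (derive1_shf _ sp) /arate.
by rewrite (ip_shf_swap y (L2_meas f2) m3) -(ip_shf_swap y (L2_meas ff2) m1).
Qed.

Lemma rate_lipschitz : exists2 K, 0 < K & forall (F F' : R -> R) (A e : R),
  L2 F -> L2 F' -> L2 (F * F) -> L2 (F' * F') -> 0 <= A -> 0 <= e -> ip T F F <= A ^+ 2 ->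
  ip T F' F' <= A ^+ 2 -> ip T (F - F') (F - F') <= e ^+ 2 ->
  `|brate F - brate F'| <= K * (1 + A) * e /\ `|arate F - arate F'| <= K * (1 + A) * e.
Proof.
have [d2 _ _] := test_H1 (test_derive bphi).
have [M M0 HM] := H1_bounded (test_H1 (test_derive bphi)).
have [t2 _ _] := test_H1 (test_deriven 3 bphi); rewrite /arate /brate.
move: (derive1n 3 phi) t2 => d3 t2.
have [B B1 HB] := ge1_sqr_bound dphi; have [E E1 HE] := ge1_sqr_bound d3.
have B0 := le_trans ler01 B1; have E0 := le_trans ler01 E1; have M00 := ltW M0.
exists (B + E + 2 * M); first by rewrite !addr_gt0 ?mulr_gt0// (lt_le_trans ltr01).
move=> F F' A e F2 F2' FF FF' A0 e0 hF hF' h; have D2 := L2B F2 F2'.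
have b1 : `|ip T (F - F') dphi| <= e * B := ip_CS_bd measurableT D2 d2 e0 B0 h HB.
have b2 : `|ip T (F - F') d3| <= e * E := ip_CS_bd measurableT D2 t2 e0 E0 h HE.
have S2 := L2D F2 F2'; have P2 := L2_bdM (L2_meas d2) HM D2.
have b3 : `|ip T (dphi * (F - F')) (F + F')| <= M * e * (A + A).
  apply: (ip_CS_bd measurableT P2 S2); [exact: mulr_ge0|exact: addr_ge0| |].
    apply: (le_trans (ip_sqr_bound measurableT (L2_meas d2) D2 M00 HM)).
    by rewrite exprMn ler_wpM2l ?sqr_ge0.
  exact: ip_triangle.
have e1 : ip T F dphi - ip T F' dphi = ip T (F - F') dphi by rewrite (ipBl measurableT F2 F2' d2).
have e2 : ip T F d3 - ip T F' d3 = ip T (F - F') d3 by rewrite (ipBl measurableT F2 F2' t2).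
have e3 : ip T (F * F) dphi - ip T (F' * F') dphi = ip T (dphi * (F - F')) (F + F').
  rewrite -(ipBl measurableT FF FF' d2); apply: eq_ip_mul => x _.
  by rewrite !fctE; ring.
have eA : 0 <= e * A by rewrite mulr_ge0.
have u1 : 0 <= e * B * A by rewrite mulr_ge0// mulr_ge0.
have u2 : 0 <= e * E * A by rewrite mulr_ge0// mulr_ge0.
have u3 : 0 <= M * e by rewrite mulr_ge0.
have u4 : 0 <= M * e * A by rewrite mulr_ge0.
have u5 : 0 <= e * E by rewrite mulr_ge0.
have u6 : 0 <= e * B by rewrite mulr_ge0.
have -> : (B + E + 2 * M) * (1 + A) * e =
  e * B + e * E + 2 * (M * e) + e * B * A + e * E * A + 2 * (M * e * A) by ring.
split; first by rewrite e1; apply: (le_trans b1); move: u1 u2 u3 u4 u5; move: (e * B) (e * E * A) (e * B * A) (e * E) (M * e * A) (M * e); clear => *; lra.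
have -> : ip T F d3 + ip T (F * F) dphi - (ip T F' d3 + ip T (F' * F') dphi) =
  ip T (F - F') d3 + ip T (dphi * (F - F')) (F + F') by rewrite -e2 -e3; ring.
apply: (le_trans (ler_normD _ _)); apply: (le_trans (lerD b2 b3)).
rewrite mulrDr; move: u1 u2 u3 u6.
by move: (e * E * A) (e * B * A) (e * B) (e * E) (M * e * A) (M * e); clear => *; lra.
Qed.

Lemma rate_translation : exists2 K, 0 < K & forall (F : R -> R) (A z : R),
  L2 F -> L2 (F * F) -> 0 <= A -> ip T F F <= A ^+ 2 -> `|z| <= 1 ->
  `|brate (shf z F) - brate F| <= K * (A + A ^+ 2) * `|z| /\
  `|arate (shf z F) - arate F| <= K * (A + A ^+ 2) * `|z|.
Proof.
have [M M0 HM] := ip_bump_translation (test_derive bphi).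
have [N N0 HN] := ip_bump_translation (test_deriven 3 bphi); rewrite /arate /brate.
exists (M + N); first exact: addr_gt0.
move=> F A z F2 FF A0 hF z1; have [m1 _ /(_ FF) m2] := HM F A z F2 A0 hF z1.
have [n1 _ _] := HN F A z F2 A0 hF z1.
have AA := sqr_ge0 A; have z0 := normr_ge0 z.
have u1 : 0 <= M * A * `|z| by rewrite !mulr_ge0// ltW.
have u2 : 0 <= N * A * `|z| by rewrite !mulr_ge0// ltW.
have u3 : 0 <= M * A ^+ 2 * `|z| by rewrite mulr_ge0// mulr_ge0// ltW.
have u4 : 0 <= N * A ^+ 2 * `|z| by rewrite mulr_ge0// mulr_ge0// ltW.
have -> : (M + N) * (A + A ^+ 2) * `|z| =
  M * A * `|z| + N * A * `|z| + M * A ^+ 2 * `|z| + N * A ^+ 2 * `|z| by ring.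
split.
  apply: (le_trans m1); move: u2 u3 u4.
  by move: (M * A * `|z|) (N * A * `|z|) (M * A ^+ 2 * `|z|) (N * A ^+ 2 * `|z|); clear => *; lra.
move: n1 m2; rewrite -[shf z (F * F)]/(shf z F * shf z F).
move: (derive1n 3 phi) => d3 n1 m2; rewrite opprD addrACA.
apply: (le_trans (ler_normD _ _)); apply: (le_trans (lerD n1 m2)).
move: u1 u4; move: (M * A * `|z|) (N * A * `|z|) (M * A ^+ 2 * `|z|) (N * A ^+ 2 * `|z|).
by clear => *; lra.
Qed.

End Rates.

(** * The equation of motion of the position *)

Section ModulationDynamics.
Context {R : realType}.
Implicit Types (y z s t : R).
Local Notation T := [set: R].
Local Notation Rp := (@Rplus R).

Variable k : R.
Hypothesis k0 : 0 < k.
Local Notation sol := (@sol R k).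
Local Notation sol1 := (@sol1 R k).
Variable phi : R -> R.
Hypothesis bphi : test_fun `[1, 3]%classic phi.
Hypothesis phi_ge0 : forall x, 0 <= phi x.
Hypothesis phi_gt0 : forall x, 1 < x < 3 -> 0 < phi x.
Local Notation dphi := (derive1 phi).
Local Notation gam := (ip T sol dphi).
Local Notation arate := (@arate R phi).
Local Notation brate := (@brate R phi).

(** The weak equation for the extension by zero, which test functions supported in the open
    half-line cannot distinguish from the solution. *)
Definition evolves (f : R -> R -> R) : Prop := forall psi, test_fun Rp psi ->
  forall t, 0 < t -> is_derive t (1 : R) (fun s => ip T (f s) psi)
    (ip T (f t) (derive1n 3 psi) + ip T (f t * f t) (derive1 psi)).

Lemma time_increment f g y s t : flow f g -> evolves f -> 0 < y -> 0 <= s -> 0 <= t ->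
  exists r, [/\ 0 <= r, `|r - t| <= `|s - t| &
    ip T (shf y (f s)) phi - ip T (shf y (f t)) phi = (s - t) * arate (shf y (f r))].
Proof.
move=> [rep _ small _] ev y0 s0 t0; have tp := test_shf bphi y0.
have [p2 _ _] := test_H1 tp; have [q2 _ _] := test_H1 bphi.
have [B B1 HB] := ge1_sqr_bound (shf (- y) phi); have B0 := lt_le_trans ltr01 B1.
have L2f r : 0 <= r -> L2 (f r) by move=> r0; have [h _ _] := rep r r0.
have cP a (e : R) : 0 <= a -> 0 < e -> exists2 d, 0 < d & forall b, 0 <= b ->
     `|b - a| < d -> `|ip T (f b) (shf (- y) phi) - ip T (f a) (shf (- y) phi)| <= e.
  move=> a0 e0; have eB : 0 < e / B by rewrite divr_gt0.
  have [d d0 H] := small a _ a0 eB; exists d => // b b0 ba.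
  rewrite -(ipBl measurableT (L2f _ b0) (L2f _ a0) p2).
  have -> : e = e / B * B by rewrite divfK// gt_eqF.
  exact: (ip_CS_bd measurableT (L2B (L2f _ b0) (L2f _ a0)) p2 (ltW eB) (ltW B0) (nrm2_l (H b b0 ba)) HB).
have [r [r0 rt e]] := mean_value_time (ev _ tp) cP s0 t0.
exists r; split; [exact: r0|exact: rt|].
rewrite (ip_shf_swap y (L2_meas (L2f _ s0)) (L2_meas q2)).
rewrite (ip_shf_swap y (L2_meas (L2f _ t0)) (L2_meas q2)) e.
by rewrite (arate_shf bphi y (L2f _ r0) (L2_H1M (rep _ r0) (L2f _ r0))).
Qed.

(** [be] and [al] are the two rates at the current position. Since [Y] has no regularity yet,
    everything is phrased with increments: a Lipschitz bound, a relation between the increments of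
    [Y] and of time with rates [bs] and [a] at nearby states, and moduli of continuity for the rates
    that still contain the increment of [Y]. *)
Lemma modulation_local : exists E0 A B M K C, [/\ 0 < E0, [/\ 0 < A, 0 < B, 0 < M & 0 < K], 0 < C &
  forall f g (Y : R -> R) (E : R), flow f g -> evolves f -> 0 <= E <= E0 ->
  (forall t, 0 <= t -> [/\ 0 < Y t, ip T (shf (Y t) (f t) - sol) phi = 0 &
    nrm2 (shf (Y t) (f t) - sol) (shf (Y t) (g t) - sol1) <= E ^+ 2]) ->
  exists al be : R -> R, (forall t, 0 <= t -> [/\ gam / 2 <= be t, `|be t| <= B, `|al t| <= A &
     `|al t - 4 * k ^+ 2 * be t| <= K * E]) /\
  forall t (e : R), 0 <= t -> 0 < e -> exists2 d, 0 < d & forall s, 0 <= s -> `|s - t| < d ->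
    `|Y s - Y t| <= C * `|s - t| /\ exists bs a, [/\ `|bs - be t| <= e, `|a - al t| <= e,
      `|(Y s - Y t) * bs - (s - t) * a| <= M * (Y s - Y t) ^+ 2,
      `|be s - be t| <= e + M * `|Y s - Y t| & `|al s - al t| <= e + M * `|Y s - Y t|]].
Proof.
have Hs := H1_sol k0; have [s2 s12 _] := Hs; have [p2 d2 _] := test_H1 bphi.
have [M M0 HM] := ip_bump_translation bphi; have [S S1 HS] := ge1_sqr_bound sol.
have S0 := lt_le_trans ltr01 S1; pose A := S + 1; have A0 : 0 < A by rewrite addr_gt0.
have g0 := ip_sol_dphi k0 bphi phi_ge0 phi_gt0.
have [e3 [K3 [e30 K30 rate]]] := rate_near k0 bphi phi_ge0 phi_gt0.
have MA0 : 0 < M * A by rewrite mulr_gt0.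
(* For [|z| <= r] the quadratic remainder is at most [|z| gam / 4], half of the lower bound for
   [|z * brate|]; what remains is the Lipschitz bound with constant [4 Am / gam]. *)
pose r := Num.min 1 (gam / 4 / (M * A)).
have r0 : 0 < r by rewrite lt_min ltr01 !divr_gt0.
have r1 : r <= 1 by rewrite ge_min lexx.
have MAr : M * A * r <= gam / 4 by rewrite mulrC -ler_pdivlMr// ge_min lexx orbT.
have [e2 e20 close] := shift_close k0 r0.
pose m := Num.min e2 e3; have m0 : 0 < m by rewrite lt_min e20.
have me2 : m <= e2 by rewrite ge_min lexx.
have me3 : m <= e3 by rewrite ge_min lexx orbT.
have [B B1 HB] := ge1_sqr_bound dphi; have B0 := lt_le_trans ltr01 B1.
have [K1 K10 lip] := rate_lipschitz bphi; have [K2 K20 trans] := rate_translation bphi.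
have k2 : 0 < 4 * k ^+ 2 by rewrite mulr_gt0// exprn_gt0.
pose Am := 4 * k ^+ 2 * (A * B) + K3 * m.
have Am0 : 0 < Am by rewrite addr_gt0 ?mulr_gt0// mulr_gt0.
have AA : 0 < A + A ^+ 2 by rewrite addr_gt0// exprn_gt0.
(* The distance to the soliton and the change over a short time are each at most [m / 2]; with the
   factor 2 of [near_perturb] they add up to [m^2] in squares. *)
exists (Num.min 1 (m / 2)), Am, (A * B), (M * A + K2 * (A + A ^+ 2)), K3, (4 * Am / gam).
split; [by rewrite lt_min ltr01 divr_gt0| |by rewrite divr_gt0// mulr_gt0|].
  by split; rewrite ?mulr_gt0// addr_gt0// mulr_gt0.
clearbody r m; move=> f g Y E Fl ev /andP[E00]; rewrite le_min => /andP[E1 Em] HY.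
pose al t := arate (shf (Y t) (f t)); pose be t := brate (shf (Y t) (f t)).
exists al, be.
have [rep _ small _] := Fl.
have L2f s : 0 <= s -> L2 (f s) by move=> h; have [u _ _] := rep s h.
have nrmF y s : 0 <= s -> ip T (shf y (f s)) (shf y (f s)) <= A ^+ 2.
  move=> s0; have [_ _ h] := HY s s0; have mf := L2_meas (L2f _ s0).
  rewrite (ipT_shf y mf mf) -(ipT_shf (Y s) mf mf).
  have W2 := L2B (L2_shf (Y s) (L2f _ s0)) s2.
  have e : shf (Y s) (f s) = sol + (shf (Y s) (f s) - sol) by rewrite addrC subrK.
  rewrite {1 2}e; apply: (ip_triangle measurableT s2 W2 (ltW S0) ler01 HS).
  by apply: (le_trans (nrm2_l h)); rewrite lerXn2r ?nnegrE.
have Am_bd F F1 : H1 F F1 -> nrm2 (F - sol) (F1 - sol1) <= m ^+ 2 -> ip T F F <= A ^+ 2 ->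
    [/\ gam / 2 <= brate F, `|brate F| <= A * B & `|arate F| <= Am].
  move=> HF h hA; have m3 : 0 <= m <= e3 by rewrite (ltW m0).
  have [b1 b2] := rate F F1 m HF m3 h; have [F2 _ _] := HF.
  have b3 : `|brate F| <= A * B := ip_CS_bd measurableT F2 d2 (ltW A0) (ltW B0) hA HB.
  split=> //; have -> : arate F = 4 * k ^+ 2 * brate F + (arate F - 4 * k ^+ 2 * brate F).
    by rewrite addrC subrK.
  apply: (le_trans (ler_normD _ _)); apply: lerD => //.
  by rewrite normrM gtr0_norm// ler_pM2l.
have Em2 : E ^+ 2 <= (m / 2) ^+ 2 by rewrite lerXn2r ?nnegrE// divr_ge0// ltW.
have m42 : 2 * ((m / 2) ^+ 2 + (m / 2) ^+ 2) = m ^+ 2 by field.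
have mm : (m / 2) ^+ 2 <= m ^+ 2.
  by rewrite lerXn2r ?nnegrE ?(ltW m0)// ?divr_ge0 ?(ltW m0)// ler_pdivrMr// ler_peMr ?(ltW m0)// ler1n.
split=> [t t0|t e t0 e0].
  have [_ _ h] := HY t t0; have hm := le_trans (le_trans h Em2) mm.
  have HF := H1_shf (Y t) (rep t t0).
  have [b1 b2 b3] := Am_bd _ _ HF hm (nrmF _ _ t0); split=> //.
  have E3 : 0 <= E <= e3.
    rewrite E00/=; apply: (le_trans Em); apply: le_trans me3.
    by rewrite ler_pdivrMr// ler_peMr ?(ltW m0)// ler1n.
  by have [_ q] := rate _ _ E HF E3 h.
pose c := K1 * (1 + A); have c0 : 0 < c by rewrite mulr_gt0// addr_gt0.
pose e' := Num.min (m / 2) (e / c).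
have e'0 : 0 < e' by rewrite lt_min !divr_gt0.
have ce' : K1 * (1 + A) * e' <= e by rewrite mulrC -ler_pdivlMr// ge_min lexx orbT.
have e'm : e' <= m / 2 by rewrite ge_min lexx.
have [d d0 H] := small t e' t0 e'0; exists d => //.
clearbody c e'.
pose G s := shf (Y t) (f s).
have [Yt _ ht] := HY t t0.
have near_ s : 0 <= s -> `|s - t| < d -> [/\ nrm2 (G s - sol) (shf (Y t) (g s) - sol1) <= m ^+ 2,
    `|brate (G s) - be t| <= e & `|arate (G s) - al t| <= e].
  move=> s0 sd; have hs := H s s0 sd; have [fs ft] := (L2f _ s0, L2f _ t0).
  have e'2 : e' ^+ 2 <= (m / 2) ^+ 2 by rewrite lerXn2r ?nnegrE ?(ltW e'0)// divr_ge0// ltW.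
  have nn : nrm2 (G s - sol) (shf (Y t) (g s) - sol1) <= m ^+ 2.
    apply: (le_trans (near_perturb k0 (rep _ t0) (rep _ s0) ht hs)).
    by rewrite -m42 ler_pM2l// lerD.
  have D : ip T (G s - G t) (G s - G t) <= e' ^+ 2.
    have D2 := L2_meas (L2B fs ft).
    have q := ipT_shf (Y t) D2 D2.
    have -> : G s - G t = shf (Y t) (f s - f t) by [].
    by rewrite q; exact: nrm2_l hs.
  have [l1 l2] := lip (G s) (G t) A e' (L2_shf _ fs) (L2_shf _ ft)
    (L2_shf (Y t) (L2_H1M (rep _ s0) fs)) (L2_shf (Y t) (L2_H1M (rep _ t0) ft)) (ltW A0) (ltW e'0)
    (nrmF _ _ s0) (nrmF _ _ t0) D.
  split=> //; [exact: le_trans l1 ce'|exact: le_trans l2 ce'].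
move=> s s0 sd; have [ns bs as_] := near_ s s0 sd.
have [tau [tau0 taut inc]] := time_increment Fl ev Yt s0 t0.
have [ntau _ atau] := near_ tau tau0 (le_lt_trans taut sd).
set z := Y s - Y t.
have Fz : shf (Y s) (f s) = shf z (G s) by rewrite /G shfD /z subrK.
have Fz1 : shf (Y s) (g s) = shf z (shf (Y t) (g s)) by rewrite shfD /z subrK.
have [Ys os hs] := HY s s0.
have up (a : R) : a <= m ^+ 2 -> a <= e2 ^+ 2.
  by move=> h; apply: (le_trans h); rewrite lerXn2r ?nnegrE ?(ltW m0) ?(ltW e20).
have HG := H1_shf (Y t) (rep _ s0); have [G2 _ _] := HG.
(* [G s], and its translate by [z], which is the solution seen from [Y s], are both near the
   soliton. *)
have zr : `|z| <= r.
  apply: (close (G s) (shf (Y t) (g s)) z HG (up _ ns)).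
  by rewrite -Fz -Fz1; apply: up; exact: le_trans (le_trans hs Em2) mm.
have z1 := le_trans zr r1.
have GG2 : L2 (G s * G s) := L2_shf (Y t) (L2_H1M (rep _ s0) (L2f _ s0)).
have [t1 t2 _] := HM (G s) A z G2 (ltW A0) (nrmF _ _ s0) z1.
(* The conditions at [s] and at [t] give the same pairing with [phi]. From [G s], one state is
   reached by the shift [z], the other by the elapsed time at frozen position [Y t], so the two
   first-order changes must balance. *)
have key : `|z * brate (G s) - (s - t) * arate (G tau)| <= M * A * z ^+ 2.
  have [_ ot _] := HY t t0.
  have os' : ip T (shf z (G s)) phi = ip T sol phi.
    by apply/eqP; rewrite -subr_eq0 -Fz -(ipBl measurableT (L2_shf _ (L2f _ s0)) s2 p2) os.
  have ot' : ip T (G t) phi = ip T sol phi.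
    by apply/eqP; rewrite -subr_eq0 -(ipBl measurableT (L2_shf _ (L2f _ t0)) s2 p2) ot.
  move: t2; rewrite os' -ot' -[brate (G s)]/(ip T (G s) dphi) -inc -/(G s) -/(G t).
  congr (_ <= _); congr (Num.norm _).
  by move: (ip T (G t) phi) (ip T (G s) phi) (z * _); clear => *; ring.
have [b1 b2 b3] := Am_bd _ _ HG ns (nrmF _ _ s0).
have [_ _ a3] := Am_bd _ _ (H1_shf (Y t) (rep _ tau0)) ntau (nrmF _ _ tau0).
have zst : `|z| <= 4 * Am / gam * `|s - t|.
  have h1 : `|z| * (gam / 2) <= `|z * brate (G s)|.
    by rewrite normrM ler_wpM2l// (le_trans b1)// ler_norm.
  have h2 : M * A * z ^+ 2 <= `|z| * (gam / 4).
    rewrite -[z ^+ 2]real_normK ?num_real// expr2 mulrA mulrC ler_wpM2l//.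
    by apply: le_trans MAr; rewrite ler_pM2l.
  have h3 : `|(s - t) * arate (G tau)| <= `|s - t| * Am by rewrite normrM ler_wpM2l.
  have h4 : `|z * brate (G s)| <= M * A * z ^+ 2 + `|s - t| * Am.
    rewrite -[z * brate (G s)](subrK ((s - t) * arate (G tau))).
    by apply: (le_trans (ler_normD _ _)); exact: lerD.
  rewrite mulrAC ler_pdivlMr//.
  move: h1 h2 h4; rewrite [_ * (gam / 2)]mulrA [_ * (gam / 4)]mulrA.
  have -> : 4 * Am * `|s - t| = 4 * (`|s - t| * Am) by ring.
  move: (`|z| * gam) (`|s - t| * Am) (M * A * z ^+ 2) (`|z * brate (G s)|).
  by clear => *; lra.
split=> //; exists (brate (G s)), (arate (G tau)).
have [q1 q2] := trans (G s) A z G2 GG2 (ltW A0) (nrmF _ _ s0) z1.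
have Mle : K2 * (A + A ^+ 2) * `|z| <= (M * A + K2 * (A + A ^+ 2)) * `|z|.
  by rewrite ler_wpM2r// lerDr ltW.
split=> //.
- by apply: (le_trans key); rewrite ler_wpM2r ?sqr_ge0// lerDl mulr_ge0 ?ltW.
- rewrite /be Fz; apply: (le_trans (ler_distD (brate (G s)) _ _)).
  by rewrite addrC; apply: lerD; [exact: bs|exact: le_trans q1 Mle].
- rewrite /al Fz; apply: (le_trans (ler_distD (arate (G s)) _ _)).
  by rewrite addrC; apply: lerD; [exact: as_|exact: le_trans q2 Mle].
Qed.

End ModulationDynamics.

(** * Differentiability of the position and the initial datum *)

Section Assembly.
Context {R : realType}.
Implicit Types (y z s t : R).
Local Notation T := [set: R].
Local Notation Rp := (@Rplus R).

Section Regularity.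
Variable k : R.
Hypothesis k0 : 0 < k.
Local Notation sol := (@sol R k).
Local Notation sol1 := (@sol1 R k).
Variable phi : R -> R.
Hypothesis bphi : test_fun `[1, 3]%classic phi.
Hypothesis phi_ge0 : forall x, 0 <= phi x.
Hypothesis phi_gt0 : forall x, 1 < x < 3 -> 0 < phi x.
Local Notation gam := (ip T sol (derive1 phi)).

(** The derivative is [v = al / be]. The Lipschitz bound makes the quadratic remainder of the
    increment relation negligible, and turns the moduli of the rates into continuity of [v]. The
    deviation from [4 k^2] follows from that of [al] from [4 k^2 be], as [be] stays above
    [gam / 2]. *)
Lemma modulation_C1 : exists E0 K, [/\ 0 < E0, 0 < K &
  forall f g (Y : R -> R) (E : R), flow f g -> evolves f -> 0 <= E <= E0 ->
  (forall t, 0 <= t -> [/\ 0 < Y t, ip T (shf (Y t) (f t) - sol) phi = 0 &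
    nrm2 (shf (Y t) (f t) - sol) (shf (Y t) (g t) - sol1) <= E ^+ 2]) ->
  exists v : R -> R, [/\ forall t, 0 <= t -> `|v t - 4 * k ^+ 2| <= K * E,
    forall t (e : R), 0 <= t -> 0 < e -> exists2 d, 0 < d & forall s, 0 <= s ->
      `|s - t| < d -> `|v s - v t| <= e &
    forall t (e : R), 0 <= t -> 0 < e -> exists2 d, 0 < d & forall s, 0 <= s ->
      `|s - t| < d -> `|Y s - Y t - (s - t) * v t| <= e * `|s - t|]].
Proof.
have g0 := ip_sol_dphi k0 bphi phi_ge0 phi_gt0.
have [E0 [A [B [M [K [C [E00 [A0 B0 M0 K0] C0 H]]]]]]] := modulation_local k0 bphi phi_ge0 phi_gt0.
move: gam g0 H => ga g0 H; have g2 : 0 < ga / 2 by rewrite divr_gt0.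
exists E0, (K / (ga / 2)); split=> //; first exact: divr_gt0.
move=> f g Y E Fl ev hE HY; have [al [be [bd loc]]] := H f g Y E Fl ev hE HY; exists (fun t => al t / be t).
have bp t : 0 <= t -> 0 < be t by move=> t0; have [h _ _ _] := bd t t0; exact: lt_le_trans h.
have vb t (x d : R) : 0 <= t -> `|x * be t| <= d -> `|x| <= d / (ga / 2).
  move=> t0 h; have [b1 _ _ _] := bd t t0; rewrite ler_pdivlMr//; apply: le_trans h.
  by rewrite normrM ler_wpM2l// (le_trans b1)// ler_norm.
split=> [t t0|t e t0 e0|t e t0 e0].
- have [_ _ _ h] := bd t t0; rewrite [leRHS]mulrAC; apply: (vb t _ _ t0).
  by rewrite mulrBl divfK// gt_eqF// bp.
- pose D := e * (ga / 2) * (ga / 2) / (B + A).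
  have BA : 0 < B + A by rewrite addr_gt0.
  have D0 : 0 < D by rewrite !(divr_gt0, mulr_gt0).
  have D2 : 0 < D / 2 by exact: divr_gt0.
  have [d d0 Hd] := loc t (D / 2) t0 D2.
  have MC : 0 < M * C by rewrite mulr_gt0.
  exists (Num.min d (D / 2 / (M * C))); first by rewrite lt_min d0 (divr_gt0 D2 MC).
  move=> s s0; rewrite lt_min => /andP[sd]; rewrite (ltr_pdivlMr _ _ MC) => sD.
  have [zC [bs [a [_ _ _ h1 h2]]]] := Hd s s0 sd.
  have MD : M * `|Y s - Y t| <= D / 2.
    apply: le_trans (ltW sD); rewrite [leRHS]mulrC -mulrA.
    by rewrite ler_wpM2l ?(ltW M0).
  have {}h1 : `|be s - be t| <= D by apply: (le_trans h1); rewrite [leRHS]splitr lerD2l.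
  have {}h2 : `|al s - al t| <= D by apply: (le_trans h2); rewrite [leRHS]splitr lerD2l.
  have [_ b1 a1 _] := bd t t0.
  have -> : e = e * (ga / 2) / (ga / 2) by rewrite mulfK// gt_eqF.
  apply: (vb s _ _ s0); have -> : e * (ga / 2) = D * (B + A) / (ga / 2).
    by rewrite /D divfK ?mulfK// gt_eqF.
  apply: (vb t _ _ t0).
  have -> : (al s / be s - al t / be t) * be s * be t =
      (al s - al t) * be t - al t * (be s - be t).
    by field; rewrite !gt_eqF ?bp.
  apply: (le_trans (ler_normB _ _)); rewrite !normrM mulrDr.
  by apply: lerD; [exact: ler_pM|rewrite mulrC; exact: ler_pM].
- have C1 : 0 < C + 1 by rewrite addr_gt0.
  have M1 : 0 < M * C ^+ 2 by rewrite mulr_gt0// exprn_gt0.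
  pose e1 := e * (ga / 2) / 2; have e10 : 0 < e1 by rewrite divr_gt0// mulr_gt0.
  have eC : 0 < e1 / (C + 1) by rewrite divr_gt0.
  have [d d0 Hd] := loc t _ t0 eC.
  exists (Num.min d (e1 / (M * C ^+ 2))); first by rewrite lt_min d0 divr_gt0.
  move=> s s0; rewrite lt_min => /andP[sd]; rewrite ltr_pdivlMr// => sD.
  have [zC [bs [a [h1 h2 h3 _ _]]]] := Hd s s0 sd.
  have -> : e * `|s - t| = e * (ga / 2) * `|s - t| / (ga / 2).
    by rewrite mulrAC mulfK// gt_eqF.
  apply: (vb t _ _ t0); set z := Y s - Y t in zC h3 *.
  have -> : (z - (s - t) * (al t / be t)) * be t =
      (z * bs - (s - t) * a) + (z * (be t - bs) + (s - t) * (a - al t)).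
    by field; rewrite gt_eqF ?bp.
  have q1 : M * z ^+ 2 <= e1 * `|s - t|.
    rewrite -[z ^+ 2]real_normK ?num_real//.
    have : `|z| ^+ 2 <= (C * `|s - t|) ^+ 2 by rewrite lerXn2r ?nnegrE// mulr_ge0// ltW.
    move=> /(ler_wpM2l (ltW M0)) /le_trans; apply.
    have -> : M * (C * `|s - t|) ^+ 2 = `|s - t| * (M * C ^+ 2) * `|s - t| by ring.
    by rewrite ler_wpM2r// ltW.
  have q2 : `|z * (be t - bs)| <= C * `|s - t| * (e1 / (C + 1)).
    by rewrite normrM ler_pM// distrC.
  have q3 : `|(s - t) * (a - al t)| <= `|s - t| * (e1 / (C + 1)) by rewrite normrM ler_wpM2l.
  apply: (le_trans (ler_normD _ _)); apply: (le_trans (lerD h3 (ler_normD _ _))).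
  have -> : e * (ga / 2) * `|s - t| = e1 * `|s - t| +
      (C * `|s - t| * (e1 / (C + 1)) + `|s - t| * (e1 / (C + 1))).
    by rewrite /e1; field; rewrite gt_eqF.
  by apply: lerD => //; exact: lerD.
Qed.

(** On the right half-line the distance is that of the hypothesis; on the left it is the tail of the
    soliton. The boundary value of the difference is [- Q(- L)], hence at most [al] in size, and
    past the point [- L] a soliton is controlled in H^1 by its value there. *)
Lemma initial_close : exists2 K, 0 < K & forall (L al : R) (u0 f0 g0 : R -> R),
  k^-1 < L -> H1_plus u0 -> u0 0 = 0 -> H1 f0 g0 -> f0 = \1_Rp * u0 ->
  (Hk_plus_norm 1 (fun x => u0 x - sol (x - L))%R < al%:E)%E ->
  0 < al /\ nrm2 (shf L f0 - sol) (shf L g0 - sol1) <= (K * al) ^+ 2.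
Proof.
have Hs := H1_sol k0; have [s2 s12 _] := Hs; have Hq := H1_qq k0; have [q2 q12 _] := Hq.
(* [1] accounts for the right half-line, the quotient for the tail of [Q] and [Q'] relative to the
   square of the boundary value. Since [K >= 1], the squared distance is at most
   [K al^2 <= (K al)^2]. *)
pose K := 1 + (1 + 4 * k ^+ 2) / (2 * k).
have kk : 0 < (1 + 4 * k ^+ 2) / (2 * k).
  by rewrite divr_gt0 ?mulr_gt0// addr_gt0// mulr_gt0// exprn_gt0.
have K1 : 1 <= K by rewrite lerDl ltW.
exists K; first exact: lt_le_trans K1.
move=> L al u0 f0 g0 kL [_ cu] u00 Hf fE nal.
pose sg := shf (- L) sol; pose sg1 := shf (- L) sol1.
have Hsg : H1 sg sg1 := H1_shf (- L) Hs; have [sg2 sg12 _] := Hsg.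
have csg : {within `[0, +oo[, continuous sg}.
  by apply: continuous_subspaceT; exact: H1_cont Hsg.
have [F [G [FG al0 FE nFG]]] := Hk_plus1_H1 (within_continuousB_fun cu csg) nal.
have [F2 G2 _] := FG; split=> //.
have HU := H1D FG Hsg.
have U0 : (F + sg) 0 = 0.
  by rewrite fctE FE//= u00 sub0r addNr.
have fE' : f0 = \1_Rp * (F + sg).
  rewrite fE; apply/esym/zero_ext_eq => x x0.
  by rewrite fctE FE//= subrK.
have ext := H1_zero_ext HU U0; rewrite -fE' in ext.
have [f2 g2 _] := Hf; have [_ e2 _] := ext.
have W := H1B Hf Hsg; have W' := H1B ext Hsg; have [w2 w12 _] := W; have [_ w12' _] := W'.
have -> : nrm2 (shf L f0 - sol) (shf L g0 - sol1) = nrm2 (f0 - sg) (g0 - sg1).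
  rewrite -(nrm2_shf L (L2_meas w2) (L2_meas w12)).
  by rewrite !shfB /sg /sg1 !shfD subrr !shf0.
have -> : nrm2 (f0 - sg) (g0 - sg1) = nrm2 (f0 - sg) (\1_Rp * (G + sg1) - sg1).
  congr (_ + _); rewrite (H1_ip_uniq measurableT W W' w12) ipC.
  by rewrite (H1_ip_uniq measurableT W W' w12').
have split_ (h h1 tau : R -> R) : L2 h -> L2 tau -> L2 (h1 - tau) -> h1 = \1_Rp * (h + tau) ->
    ip T (h1 - tau) (h1 - tau) <= ip T h h + ip `]-oo, 0] tau tau.
  move=> h2 t2 d2 hE; rewrite (ip_splitT d2 d2) addrC; apply: lerD.
    have mP : measurable (`]0, +oo[%classic : set R) by [].
    apply: (le_trans _ (ip_leT mP h2)).
    rewrite le_eqVlt; apply/orP; left; apply/eqP; apply: eq_ip_mul => x /=.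
    rewrite in_itv/= andbT => x0; rewrite hE !fctE indicE mem_set// mul1r addrK//.
  rewrite le_eqVlt; apply/orP; left; apply/eqP; apply: eq_ip_mul => x /=.
  rewrite in_itv/= => x0; rewrite hE !fctE indicE memNset ?mul0r ?sub0r ?mulrNN//.
  by rewrite /Rplus/= => /(le_lt_trans x0); rewrite ltxx.
have S1 := split_ F f0 sg F2 sg2 w2 fE'.
have S2 := split_ G _ sg1 G2 sg12 w12' erefl.
have tail (h : R -> R) : L2 h -> ip `]-oo, 0] (shf (- L) h) (shf (- L) h) = ip `]-oo, - L] h h.
  move=> h2; have mD : measurable (`]-oo, - L]%classic : set R) by [].
  rewrite -(ip_shf (- L) mD (L2_meas h2) (L2_meas h2)).
  congr (ip _ _ _); apply/seteqP; split=> x /=; rewrite !in_itv/=; lra.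
set D := `]-oo, - L]%classic; have mD : measurable (D : set R) by exact: measurable_itv.
(* [L > 1/k] puts the tail beyond [x_mid], where [|th| >= 7/10]. So [qq' = - 2 k th qq] dominates
   [k qq], and integrating [qq qq'] bounds the tail by the boundary value. *)
have kth x : D x -> k * qq k x <= qq1 k x.
  rewrite /D/= in_itv/= => xL; have xm : x_mid k <= - x.
    rewrite /x_mid; apply: (@le_trans _ _ k^-1); first by rewrite ler_piMl ?invr_ge0 ?(ltW k0)//; lra.
    by move: kL xL; clear => *; lra.
  have := th_x_mid k0 xm; rewrite thN qq1E; move: (th k x) => tx h; rewrite -subr_ge0.
  have -> : - 2 * k * tx * qq k x - k * qq k x = k * qq k x * (2 * (- tx) - 1) by ring.
  apply: mulr_ge0; first by rewrite mulr_ge0 ?(ltW k0) ?(ltW (qq_gt0 k x)).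
  by rewrite subr_ge0 -ler_pdivrMl//; apply: le_trans h; lra.
have Q1 : k * ip D (qq k) (qq k) <= qq k (- L) ^+ 2 / 2.
  have := H1_ibp_left (- L) Hq Hq; rewrite -/D -expr2 [ip D (qq k) _]ipC => <-.
  have half (v : R) : (v + v) / 2 = v by field.
  rewrite half.
  rewrite -(ipZl k mD q2 q2); apply: (ip_le mD (L2Z k q2) q2 q12 q2).
  by move=> x xD; rewrite ler_wpM2r ?(ltW (qq_gt0 k x))//; exact: kth.
have Q2 : ip D (qq1 k) (qq1 k) <= 4 * k ^+ 2 * ip D (qq k) (qq k).
  rewrite -(ipZl _ mD q2 q2); apply: (ip_le mD q12 q12 (L2Z _ q2) q2).
  move=> x _; rewrite qq1E /GRing.scale/=; have := th_sqr k x; have := sqr_ge0 (qq k x) => a b.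
  have -> : - 2 * k * th k x * qq k x * (- 2 * k * th k x * qq k x) =
    4 * k ^+ 2 * qq k x ^+ 2 * th k x ^+ 2 by ring.
  have -> : 4 * k ^+ 2 * qq k x * qq k x = 4 * k ^+ 2 * qq k x ^+ 2 by ring.
  by rewrite ler_piMr ?(ltW b)// mulr_ge0// mulr_ge0 ?sqr_ge0.
have Q3 : (6 * k ^+ 2) ^+ 2 * qq k (- L) ^+ 2 <= al ^+ 2.
  have : F 0 ^+ 2 <= al ^+ 2 := le_trans (H1_sup 0 FG) (ltW nFG).
  by rewrite FE//= u00 sub0r sqrrN /sg /shf add0r /sol -exprMn.
have Z h : L2 h -> ip D ((6 * k ^+ 2) *: h) ((6 * k ^+ 2) *: h) = (6 * k ^+ 2) ^+ 2 * ip D h h.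
  by move=> h2; have zh := L2Z (6 * k ^+ 2) h2; rewrite ipZl// ipZr// mulrA -expr2.
rewrite /sg tail// -/D /sol Z// in S1; rewrite /sg1 tail// -/D /sol1 Z// in S2.
apply: (le_trans (lerD S1 S2)).
have tot : (6 * k ^+ 2) ^+ 2 * ip D (qq k) (qq k) + (6 * k ^+ 2) ^+ 2 * ip D (qq1 k) (qq1 k) <=
    (1 + 4 * k ^+ 2) / (2 * k) * al ^+ 2.
  have k4 : 0 <= 1 + 4 * k ^+ 2 by rewrite addr_ge0// mulr_ge0// sqr_ge0.
  have c0 : 0 <= (6 * k ^+ 2) ^+ 2 by exact: sqr_ge0.
  move: Q1 Q2 Q3 c0; move: (ip D (qq k) (qq k)) (ip D (qq1 k) (qq1 k)) (qq k (- L) ^+ 2).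
  move: ((6 * k ^+ 2) ^+ 2) => c X X1 q Q1 Q2 Q3 c0.
  have Xq : X <= q / (2 * k).
    by rewrite ler_pdivlMr ?mulr_gt0//; move: Q1; move: (k) => kk' h; lra.
  rewrite -mulrDr; apply: (@le_trans _ _ (c * ((1 + 4 * k ^+ 2) * (q / (2 * k))))).
    rewrite ler_wpM2l// mulrDl mul1r; apply: lerD => //; apply: (le_trans Q2).
    by rewrite ler_wpM2l// mulr_ge0// sqr_ge0.
  have -> : c * ((1 + 4 * k ^+ 2) * (q / (2 * k))) = (1 + 4 * k ^+ 2) / (2 * k) * (c * q).
    by field; rewrite gt_eqF.
  by rewrite ler_wpM2l// ltW.
apply: (@le_trans _ _ (K * al ^+ 2)).
  have -> : K * al ^+ 2 = al ^+ 2 + (1 + 4 * k ^+ 2) / (2 * k) * al ^+ 2.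
    by rewrite /K (mulrDl 1) mul1r.
  rewrite addrACA; exact: lerD (ltW nFG) tot.
by rewrite exprMn ler_wpM2r ?sqr_ge0// expr2 ler_peMr// (le_trans ler01).
Qed.

End Regularity.
End Assembly.

(** * From the initial boundary value problem to the abstract flow *)

Section Conclusion.
Context {R : realType}.
Local Notation mu := (@lebesgue_measure R).
Implicit Types (y z s t : R).
Local Notation T := [set: R].
Local Notation Rp := (@Rplus R).

Lemma kdv_flow (u0 : R -> R) (u : R -> R -> R) : H1_plus u0 -> u0 0 = 0 ->
  global_kdv_solution u0 u -> exists f g, [/\ flow f g, evolves f &
    forall t, 0 <= t -> f t = \1_Rp * u t].
Proof.
move=> hu0 u00 solu; have [f [g rep]] := global_rep hu0 u00 solu.
have mR := @measurable_Rplus R.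
exists f, g; split; last by move=> t t0; have [] := rep t t0.
- split.
  + by move=> t t0; have [] := rep t t0.
  + move=> t x t0 x0; have [_ ->] := rep t t0.
    by rewrite fctE indicE memNset ?mul0r// /Rplus/= => /(le_lt_trans x0); rewrite ltxx.
  + by move=> s e s0 e0; exact: (global_small hu0 u00 solu rep s0 e0).
  + by move=> t t0; exact: (global_mono hu0 u00 solu rep t0).
move=> psi tp t t0; have t1 : 0 < t + 1 by rewrite addr_gt0.
have [[_ eqn _ _] _] := solu _ t1.
have tI : 0 < t < t + 1 by rewrite t0 ltrDl ltr01.
have [p2 d2 _] := test_H1 tp; have [q2 _ _] := test_H1 (test_deriven 3 tp).
have := eqn psi tp t tI.
have -> : \int[mu]_(x in Rp) (u t x * derive1n 3 psi x + u t x ^+ 2 * derive1 psi x) =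
    ip T (f t) (derive1n 3 psi) + ip T (f t * f t) (derive1 psi).
  move: (derive1n 3 psi) q2 => d3 q2; have [ft fE] := rep t (ltW t0).
  have [f2 _ _] := ft; have ff2 := L2_H1M ft f2.
  rewrite -RintegralD//; [|exact: L2_itg|exact: L2_itg].
  rewrite Rintegral_mkcond; apply: eq_Rintegral => x _; rewrite patchE fE !fctE indicE.
  by case: (x \in Rp) => /=; rewrite ?mul1r// !mul0r addr0.
apply: near_eq_is_derive; near=> s.
have s0 : 0 <= s by near: s; apply: filterS (lt_nbhsr t0) => r /ltW.
by have [_ ->] := rep s s0; rewrite (ip_restr (u s) psi mR).
Unshelve. all: by end_near. Qed.

Lemma C1_halflineP (Y v : R -> R) (L : R) :
  (forall t (e : R), 0 <= t -> 0 < e -> exists2 d, 0 < d & forall s, 0 <= s ->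
     `|s - t| < d -> `|v s - v t| <= e) ->
  (forall t (e : R), 0 <= t -> 0 < e -> exists2 d, 0 < d & forall s, 0 <= s ->
     `|s - t| < d -> `|Y s - Y t - (s - t) * v t| <= e * `|s - t|) ->
  C1_halfline (fun t => Y t - L) v.
Proof.
move=> cv dY; split=> [t t0|]; last first.
  apply/subspace_continuousP => t /=; rewrite in_itv/= andbT => t0.
  apply: within_cvg => e e0; have [d d0 h] := cv t e t0 e0; exists d => // s /=.
  by rewrite in_itv/= andbT => s0; exact: h.
apply/cvgrPdist_le => e e0; have [d d0 h] := dY t e t0 e0; near_simpl.
rewrite near_withinE /dnbhs near_withinE; exists d => // s /= st nst.
rewrite in_itv/= andbT => s0; have st0 : s - t != 0 by rewrite subr_eq0.
have -> : v t - (Y s - L - (Y t - L)) / (s - t) = - ((Y s - Y t - (s - t) * v t) / (s - t)).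
  by field.
rewrite normrN normrM normfV ler_pdivrMr ?normr_gt0//; apply: h => //.
by rewrite distrC.
Qed.

End Conclusion.

Theorem theorem1p1 (R : realType) (c : R) (hc : 0 < c) :
  exists alpha0 C0 L0 C : R,
    [/\ 0 < alpha0, 0 < C0, 0 < L0 & 0 < C] /\
    forall alpha L : R, 0 < alpha < alpha0 -> L0 < L ->
    forall u0 : R -> R, H1_plus u0 -> u0 0 = 0 ->
      (Hk_plus_norm 1 (fun x => u0 x - Q c (x - L))%R < alpha%:E)%E ->
    forall u : R -> R -> R, global_kdv_solution u0 u ->
    exists rho rho' : R -> R,
      [/\ C1_halfline rho rho',
          (ereal_sup [set Hk_plus_norm 1 (fun x => (u t x - Q c (x - rho t - L))%R)
                     | t in `[0%R, +oo[]
             < (C0 * (alpha + expR (- (Num.sqrt c * L))))%:E)%E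
        & (ereal_sup [set (`|rho' t - c|)%:E | t in `[0%R, +oo[]
             < (C * C0 * alpha)%:E)%E].
Proof.
pose k := Num.sqrt c / 2; have k0 : 0 < k by rewrite divr_gt0// sqrtr_gt0.
have kc : 4 * k ^+ 2 = c.
  by rewrite /k expr_div_n sqr_sqrtr ?(ltW hc)//; field.
have QE x : Q c x = sol k x.
  rewrite /Q /sol /GRing.scale/= -sech_qq -kc; congr (_ * sech _ ^+ 2); first by field.
  by rewrite kc /k; field.
have [phi sphi [phi_ge0 phi_gt0 phi0]] := @smooth_bump_exists R.
have bphi : test_fun `[1, 3]%classic phi.
  apply: (@test_intro _ _ _ 1 3) => // x nx; apply: phi0; apply/negP => /andP[h1 h2].
  by apply: nx; rewrite !ltW.
have [eb [Ko [eb0 Ko0 orb]]] := orbital_stability k0 bphi phi_ge0 phi_gt0.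
have [Ki Ki0 init] := initial_close k0.
have [E0 [Km [E00 Km0 modul]]] := modulation_C1 k0 bphi phi_ge0 phi_gt0.
have KK : 0 < Ko * Ki by rewrite mulr_gt0.
(* The two bounds on [alpha] put [Ki * alpha] in the range of the orbital bound and
   [E = Ko * Ki * alpha] in that of the modulation. Adding 1 to the constants makes the final
   inequalities strict. *)
exists (Num.min (eb / Ki) (E0 / (Ko * Ki))), (Ko * Ki + 1), k^-1, (Km + 1).
split; first by rewrite lt_min !divr_gt0// !addr_gt0// invr_gt0.
move=> alpha L /andP[al0]; rewrite lt_min => /andP[al1 al2] hL u0 hu0 u00 hal u solu.
have [f [g [Fl ev fE]]] := kdv_flow hu0 u00 solu; have [rep _ _ _] := Fl.
have f0E : f 0 = \1_(@Rplus R) * u0.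
  have [[_ _ h _] _] := solu 1 ltr01; rewrite fE//; apply/funext => x; rewrite !fctE indicE.
  by case: (boolP (x \in @Rplus R)) => [/[!inE] x0|_]; rewrite ?mul0r// h.
have hal' : (Hk_plus_norm 1 (fun x => u0 x - sol k (x - L))%R < alpha%:E)%E.
  move: hal; congr (Hk_plus_norm 1 _ < _)%E.
  by apply/funext => x; rewrite QE.
have [_ h0] := init L alpha u0 (f 0) (g 0) hL hu0 u00 (rep 0 (lexx 0)) f0E hal'.
have Kal : 0 <= Ki * alpha <= eb.
  by rewrite mulr_ge0 ?(ltW Ki0) ?(ltW al0)//= mulrC -ler_pdivlMr// ltW.
have H := orb f g L (Ki * alpha) Fl Kal h0.
pose E := Ko * (Ki * alpha).
have [Y HY] : exists Y : R -> R, forall t, 0 <= t -> [/\ 0 < Y t,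
    ip setT (shf (Y t) (f t) - sol k) phi = 0 &
    nrm2 (shf (Y t) (f t) - sol k) (shf (Y t) (g t) - sol1 k) <= E ^+ 2].
  have /choice[Y HY] : forall t, exists y : R, 0 <= t -> [/\ 0 < y,
      ip setT (shf y (f t) - sol k) phi = 0 &
      nrm2 (shf y (f t) - sol k) (shf y (g t) - sol1 k) <= E ^+ 2].
    move=> t; have [t0|nt] := boolP (0 <= t); last by exists 0.
    by have [y hy] := H t t0; exists y.
  by exists Y.
have EE : E = Ko * Ki * alpha by rewrite /E mulrA.
have E_ge0 : 0 <= E by rewrite EE mulr_ge0 ?ltW.
have hE : 0 <= E <= E0 by rewrite E_ge0/= EE mulrC -ler_pdivlMr// ltW.
have [v [v1 v2 v3]] := modul f g Y E Fl ev hE HY.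
(* [Y] is the absolute position of the soliton; the statement measures it from [L]. *)
exists (fun t => Y t - L), v; split; first exact: C1_halflineP.
- apply: (@le_lt_trans _ _ E%:E); last first.
    rewrite lte_fin EE mulrDr mulrDl mul1r; have e0 := expR_gt0 (- (Num.sqrt c * L)).
    by rewrite -addrA ltrDl addr_gt0// mulr_gt0// addr_gt0.
  apply: ge_ereal_sup => _ [t /= + <-]; rewrite in_itv/= andbT => t0.
  have [_ _ h] := HY t t0; have Hs := H1_sol k0; have Hf := rep t t0.
  have D := H1B Hf (H1_shf (- Y t) Hs); have [D1 D2 _] := D.
  apply: (H1_Hk_plus D _ E_ge0) => [x x0|].
    rewrite !fctE fE// fctE indicE mem_set// mul1r QE /shf.
    by congr (_ - sol k _); ring.
  have := nrm2_shf (Y t) (L2_meas D1) (L2_meas D2).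
  by rewrite !shfB !shfD subrr !shf0 => e; rewrite -[leLHS]e.
- apply: (@le_lt_trans _ _ (Km * E)%:E); last first.
    rewrite lte_fin EE mulrA ltr_pM2r//.
    by apply: ltr_pM; rewrite ?(ltW Km0) ?(ltW KK)// ltrDl.
  apply: ge_ereal_sup => _ [t /= + <-]; rewrite in_itv/= andbT => t0.
  by rewrite lee_fin -kc; exact: v1.
Qed.
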